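(* For $\tau\in\mathbb{R}$ let $\zeta_1(\tau)<\zeta_2(\tau)$ be the first two eigenvalues of the operator $\mathfrak{g}(\tau)=-\partial_r^2-\frac1r\partial_r+(r-\tau)^2$ on $L^2_r(\mathbb{R}_+)$. Let $\tau_{\rm C}\in\mathbb{R}$ be a critical point of the function $\tau\mapsto\zeta_1(\tau)$. Then $$\zeta_1''(\tau_{\rm C})\geq 2\,\frac{\zeta_2(\tau_{\rm C})-3\zeta_1(\tau_{\rm C})}{\zeta_2(\tau_{\rm C})-\zeta_1(\tau_{\rm C})}.$$
   Context: $L^2_r(\mathbb{R}_+)$ is the space of functions on the half-line $\mathbb{R}_+$ that are square integrable for the weight $r\,\mathrm{d}r$, and $B^1_r(\mathbb{R}_+):=\{u\in L^2_r(\mathbb{R}_+):\ u'\in L^2_r(\mathbb{R}_+),\ ru\in L^2_r(\mathbb{R}_+)\}$. For $\tau\in\mathbb{R}$, $\mathfrak{g}(\tau):=-\partial_r^2-\frac1r\partial_r+(r-\tau)^2$ is the self-adjoint operator on $L^2_r(\mathbb{R}_+)$ associated with the quadratic form $\mathfrak{q}_\tau(u):=\int_{\mathbb{R}_+}\left(|u'(r)|^2+(r-\tau)^2|u(r)|^2\right)r\,\mathrm{d}r$ with form domain $B^1_r(\mathbb{R}_+)$; its domain is $\{u\in B^1_r(\mathbb{R}_+):\ u''\in L^2_r(\mathbb{R}_+),\ \frac1r u'\in L^2_r(\mathbb{R}_+),\ r^2u\in L^2_r(\mathbb{R}_+),\ (ru'(r))_{|r=0}=0\}$. It has compact resolvent,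 and $\zeta_n(\tau)$, $n\ge1$, denotes its $n$-th eigenvalue (in increasing order; the eigenvalues are simple and analytic in $\tau$). *)

(* Defs.v *)
From HB Require Import structures.
From mathcomp Require Export all_boot all_order all_algebra.
From mathcomp Require Export all_classical all_reals all_analysis.
Export Order.TTheory GRing.Theory Num.Theory.
Export numFieldNormedType.Exports.

Set Implicit Arguments.
Unset Strict Implicit.
Unset Printing Implicit Defensive.

#[export] Set Implicit Arguments.
#[export] Unset Strict Implicit.

Local Open Scope classical_set_scope.
Local Open Scope ring_scope.

(* Elements of L^2_r are represented by functions on R whose values are only
   used on the open half-line, up to equality almost everywhere there. The
   functions are real valued: the operator has real coefficients, so working
   over the complex numbers would give the same eigenvalues. *)

Definition half_line (R : realType) : set R := `]0, +oo[.

Definition L2r (R : realType) (u : R -> R) : Prop :=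
  measurable_fun (@half_line R) u /\
  (\int[lebesgue_measure]_(r in @half_line R) ((u r) ^+ 2 * r)%:E < +oo)%E.

Definition ae_half_line (R : realType) (P : R -> Prop) : Prop :=
  {ae (@lebesgue_measure R), forall r, half_line r -> P r}.

(* C^1 functions with compact support in the open half-line. *)
Definition test_function (R : realType) (phi : R -> R) : Prop :=
  [/\ forall r, derivable phi r 1,
      continuous (derive1 phi) &
      exists a b : R, 0 < a /\ (forall r, r \notin `[a, b] -> phi r = 0)].

(* v is the derivative of u in the sense of distributions on ]0, +oo[. *)
Definition weak_derivative (R : realType) (u v : R -> R) : Prop :=
  [/\ locally_integrable (@half_line R) u,
      locally_integrable (@half_line R) v &
      forall phi : R -> R, test_function phi ->
        \int[lebesgue_measure]_(r in @half_line R) (u r * derive1 phi r) =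
        - \int[lebesgue_measure]_(r in @half_line R) (v r * phi r)].

Definition B1r (R : realType) (u : R -> R) : Prop :=
  [/\ L2r u,
      exists2 v, weak_derivative u v & L2r v &
      L2r (fun r => r * u r)].

(* u belongs to the operator domain, with u' = v and u'' = w. Since u'' is
   locally integrable, u' has a continuous representative on ]0, +oo[; v is
   taken to be that one, so that the trace of r u' at 0 is a limit. *)
Definition dom_g (R : realType) (u v w : R -> R) : Prop :=
  B1r u /\
  [/\ weak_derivative u v, {in @half_line R, continuous v} & weak_derivative v w]
  /\
  [/\ L2r w,
      L2r (fun r => r^-1 * v r),
      L2r (fun r => r ^+ 2 * u r) &
      r * v r @[r --> 0^'+] --> (0 : R)].

(* (u, f) is in the graph of - d^2/dr^2 - (1/r) d/dr + (r - tau)^2. *)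
Definition graph_g (R : realType) (tau : R) (u f : R -> R) : Prop :=
  exists v w : R -> R, dom_g u v w /\
    ae_half_line (fun r => f r = - w r - r^-1 * v r + (r - tau) ^+ 2 * u r).

Definition eigenvalue_g (R : realType) (tau lambda : R) : Prop :=
  exists2 u : R -> R, ~ ae_half_line (fun r => u r = 0) &
    graph_g tau u (fun r => lambda * u r).

(* z is an eigenvalue and exactly n eigenvalues are <= z. The eigenvalues are
   simple, hence counted without multiplicity; numbering starts at n = 1. *)
Definition nth_eigenvalue_g (R : realType) (tau : R) (n : nat) (z : R) : Prop :=
  eigenvalue_g tau z /\ ([set l : R | eigenvalue_g tau l /\ l <= z] #= `I_n)%card.

(* Main.v *)
Require Import Defs.
From mathcomp Require Import measurable_realfun ring lra.
Local Open Scope classical_set_scope.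
Local Open Scope ring_scope.

(** Let [z1 < z2] be the first two eigenvalues at a critical point [tau] of
    [zeta1], and [u] the first eigenfunction. Replacing [tau] by [tau + h] changes
    the potential [(r - tau)^2] by [- 2 h (r - tau) + h^2], so perturbation theory
    would express [zeta1''] through the reduced resolvent of the operator applied to
    [(r - tau) u]. A lower bound needs only the spectral gap. Write an eigenfunction
    at [tau + h] as [b u + v] with [v] orthogonal to [u]; the quadratic form of [v]
    is at least [z2 |v|^2] ([spectral_gap]), and Cauchy-Schwarz absorbs the cross
    term between [u] and [v] into [z2 - z1]. With [A = |u|^2],
    [c = <(r - tau) u, u>] and [B = |(r - tau) u|^2] this gives
    [zeta1 (tau + h) - z1 >= h^2 - 2 h c / A - 4 h^2 B / (A (z2 - z1))], up to
    [o(h^2)] ([second_order_bound]).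

    As [zeta1' tau = 0], both signs of [h] give [c = 0] ([first_moment_zero]), and
    then [zeta1'' tau >= 2 - 8 B / (A (z2 - z1))] ([second_order_comparison]).
    Pohozaev's identity ([pohozaev]), from the multiplier [r^2 u'], reads
    [2 B = z1 A] when [c = 0], so the right-hand side is
    [2 (z2 - 3 z1) / (z2 - z1)] ([critical_second_derivative]).

    The spectral information comes from the differential equation. Up to a factor,
    [phi tau lam], an entire function given by its power series, is the only
    solution of [u'' + u' / r = ((r - tau)^2 - lam) u] regular at the origin. Far
    out it either grows, or it decays faster than every exponential along with its
    derivative; [lam] is an eigenvalue exactly in the second case
    ([decaying_eigenvalue], [eigenvalue_decaying]). The converse part requires that
    an eigenfunction in the weak sense is a classical solution, which rests on the
    lemma of du Bois-Reymond ([weak_derivative0_ae_const]).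

    That the two lowest eigenvalues have the expected eigenfunctions is a shooting
    argument. The parameters whose solution takes a negative value form an open
    set, and its infimum is an eigenvalue with a positive solution
    ([first_threshold]); likewise the infimum of those whose solution becomes
    positive again after a negative value is an eigenvalue ([second_threshold]). As
    only two eigenvalues lie below or at [z2], the first solution is positive and
    the second one, [w], changes sign exactly once ([first_two_shapes]). The gap
    follows by Jacobi's identity: for [g] vanishing at the zero of [w], the form of
    [g] minus [z2 |g|^2] is the integral of [r (g' - g w' / w)^2] ([jacobi_ge0]),
    and subtracting a multiple of [u] from a function orthogonal to [u] makes it
    vanish there. *)

(** * Pointwise calculus *)

(** The class [is_derive] is wrapped so that derivatives are computed by
    explicit rules on the body of the function, rather than by instance search. *)
Definition has_deriv (R : realType) (f : R -> R) (x a : R) : Prop :=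
  is_derive x 1 f a.

Section Calculus.
Variable R : realType.
Implicit Types (f g : R -> R) (x a b : R).

Lemma has_deriv_eq f x a b : has_deriv f x a -> a = b -> has_deriv f x b.
Proof. by move=> h <-. Qed.

Lemma has_deriv_ext f g x a :
  (forall y, f y = g y) -> has_deriv f x a -> has_deriv g x a.
Proof. by move=> /funext ->. Qed.

Lemma has_deriv_cst (k : R) x : has_deriv (fun=> k) x 0.
Proof. exact: is_derive_cst. Qed.

Lemma has_deriv_id x : has_deriv (fun y => y) x 1.
Proof. exact: is_derive_id. Qed.

Lemma has_derivD f g x a b : has_deriv f x a -> has_deriv g x b ->
  has_deriv (fun r => f r + g r) x (a + b).
Proof. by move=> fa gb; exact: (@is_deriveD _ _ _ f g x 1 a b fa gb). Qed.

Lemma has_derivN f x a : has_deriv f x a -> has_deriv (fun r => - f r) x (- a).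
Proof. by move=> fa; exact: (@is_deriveN _ _ _ f x 1 a fa). Qed.

Lemma has_derivM f g x a b : has_deriv f x a -> has_deriv g x b ->
  has_deriv (fun r => f r * g r) x (f x * b + g x * a).
Proof. by move=> fa gb; exact: (@is_deriveM _ _ f g x 1 a b fa gb). Qed.

Lemma has_derivX f n x a : has_deriv f x a ->
  has_deriv (fun r => f r ^+ n) x (n%:R * f x ^+ n.-1 * a).
Proof.
move=> h; apply: (has_deriv_ext (f := f ^+ n)) => [y|]; first by rewrite exprfctE.
exact: (@is_deriveX _ _ f n x 1 a h).
Qed.

Lemma has_derivV f x a : f x != 0 -> has_deriv f x a ->
  has_deriv (fun r => (f r)^-1) x (- (f x) ^- 2 * a).
Proof. by move=> fx fa; exact: (@is_deriveV _ f x a 1 fx fa). Qed.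

Lemma has_deriv_exp f x a : has_deriv f x a ->
  has_deriv (fun r => expR (f r)) x (expR (f x) * a).
Proof.
move=> h; exact: (@is_derive1_comp _ expR f x _ _ (is_derive_expR (f x)) h).
Qed.

Lemma has_deriv_continuous f x a : has_deriv f x a -> {for x, continuous f}.
Proof. by move=> [h _]; apply: differentiable_continuous; apply/derivable1_diffP. Qed.

Lemma has_deriv1E f x a : has_deriv f x a -> derive1 f x = a.
Proof. by move=> h; rewrite derive1E; apply: derive_val. Qed.

Lemma continuous_within f a b : (forall x, a <= x <= b -> {for x, continuous f}) ->
  {within `[a, b], continuous f}.
Proof.
move=> h; apply/continuous_in_subspaceT => x; rewrite inE/= in_itv/= => /h.
done.
Qed.

Lemma has_deriv_ge0_le f df a b : a <= b ->
  (forall x, a <= x <= b -> {for x, continuous f}) ->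
  (forall x, a < x < b -> has_deriv f x (df x)) ->
  (forall x, a < x < b -> 0 <= df x) -> f a <= f b.
Proof.
move=> ab fc fd df0.
move: ab; rewrite le_eqVlt => /predU1P[->//|ab].
have [x xab|x] := @MVT _ f df _ _ ab _ (continuous_within fc).
  by apply: fd; rewrite in_itv/= in xab.
rewrite in_itv/= => xab; rewrite -subr_ge0 => ->.
by rewrite mulr_ge0 ?df0// subr_ge0 ltW.
Qed.

Lemma has_deriv_le0_ge f df a b : a <= b ->
  (forall x, a <= x <= b -> {for x, continuous f}) ->
  (forall x, a < x < b -> has_deriv f x (df x)) ->
  (forall x, a < x < b -> df x <= 0) -> f b <= f a.
Proof.
move=> ab fc fd df0; rewrite -lerN2.
apply: (@has_deriv_ge0_le (fun x => - f x) (fun x => - df x)) => // x xab.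
- by apply: continuousN; exact: fc.
- by apply: has_derivN; exact: fd.
- by rewrite oppr_ge0 df0.
Qed.

End Calculus.

Create HintDb deriv discriminated.

(* Syntactic dispatch on the body: unification up to conversion could unfold
   functions defined as sums of series. *)
Ltac solve_deriv_step := cbv beta; match goal with
  | H : has_deriv ?f ?x _ |- has_deriv ?f ?x _ => exact H
  | |- has_deriv (fun r => r) _ _ => apply: has_deriv_id
  | |- has_deriv (fun _ => ?k) _ _ => apply: has_deriv_cst
  | |- has_deriv (fun r => @?f r + @?g r) _ _ => eapply (@has_derivD _ f g)
  | |- has_deriv (fun r => - @?f r) _ _ => eapply (@has_derivN _ f)
  | |- has_deriv (fun r => @?f r ^+ ?n) _ _ => eapply (@has_derivX _ f n)
  | |- has_deriv (fun r => @?f r * @?g r) _ _ => eapply (@has_derivM _ f g)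
  | |- has_deriv (fun r => (@?f r)^-1) _ _ => eapply (@has_derivV _ f)
  | |- has_deriv (fun r => expR (@?f r)) _ _ => eapply (@has_deriv_exp _ f)
  | |- has_deriv (fun r => ?f r) ?x _ => change (fun r => f r) with f
  | |- has_deriv _ _ _ => solve [eauto 2 with deriv nocore]
  end.
Ltac solve_deriv := eapply has_deriv_eq; [repeat solve_deriv_step |].

(** * Power series with infinite radius of convergence *)

Section PowerSeries.
Variable R : realType.
Implicit Types (a b : nat -> R).

(** An infinite radius of convergence, stated on the coefficients: in this form it
    passes to the derivative and can be checked by induction on a recurrence. *)
Definition superexp_small a :=
  forall rho : R, 0 < rho -> exists C : R, forall n, `|a n| <= C * rho ^+ n.

Definition psum a (x : R) : R := limn (pseries a x).

Definition shift_seq a n : R := if n is m.+1 then a m else 0.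

Lemma superexp_small_cvg a x : superexp_small a -> cvgn (pseries a x).
Proof.
move=> fa; have x1 : 0 < `|x| + 1 by rewrite ltr_wpDl.
have [|C hC] := fa ((2 * (`|x| + 1))^-1); first by rewrite invr_gt0 mulr_gt0.
have C0 : 0 <= C by have := le_trans (normr_ge0 _) (hC 0%N); rewrite expr0 mulr1.
apply: normed_cvg.
apply: (@series_le_cvg _ _ (geometric C 2^-1)); first by move=> n; exact: normr_ge0.
- by move=> n; apply: mulr_ge0 => //; apply: exprn_ge0.
- move=> n; rewrite [leLHS]normrM normrX.
  apply: (@le_trans _ _ (C * (2 * (`|x| + 1))^-1 ^+ n * `|x| ^+ n)).
    by rewrite ler_wpM2r// exprn_ge0.
  rewrite -mulrA -exprMn; apply: ler_wpM2l => //.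
  have q0 : 0 <= (2 * (`|x| + 1))^-1 * `|x|.
    by rewrite mulr_ge0// invr_ge0 mulr_ge0// ltW.
  apply: lerXn2r; rewrite ?nnegrE// invfM -mulrA ler_piMr//.
  by rewrite mulrC ler_pdivrMr// mul1r lerDl.
apply: is_cvg_geometric_series.
by rewrite ger0_norm ?invf_lt1 // ltr1n.
Qed.

Lemma small_diffs a : superexp_small a -> superexp_small (pseries_diffs a).
Proof.
move=> fa rho rho0.
have [|C hC] := fa (rho / 2); first by rewrite divr_gt0.
exists (C * rho) => n; rewrite /pseries_diffs normrM ger0_norm//.
have C0 : 0 <= C by have := le_trans (normr_ge0 _) (hC 0%N); rewrite expr0 mulr1.
apply: (@le_trans _ _ (n.+1%:R * (C * (rho / 2) ^+ n.+1))).
  by rewrite ler_wpM2l.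
rewrite mulrCA -mulrA -exprS ler_wpM2l// exprMn mulrCA ler_piMr//.
  by rewrite exprn_ge0// ltW.
rewrite exprVn ler_pdivrMr ?exprn_gt0// mul1r -natrX ler_nat.
by apply: ltnW; exact: ltn_expl.
Qed.

Lemma small_lin a b (k : R) : superexp_small a -> superexp_small b ->
  superexp_small (k *: a + b).
Proof.
move=> fa fb rho rho0.
have [A hA] := fa _ rho0; have [B hB] := fb _ rho0.
exists (`|k| * A + B) => n.
rewrite mulrDl (le_trans (ler_normD _ _))// lerD// normrM -mulrA.
by rewrite ler_wpM2l.
Qed.

Lemma small_shift a : superexp_small a -> superexp_small (shift_seq a).
Proof.
move=> fa rho rho0; have [A hA] := fa _ rho0.
have A0 : 0 <= A by have := le_trans (normr_ge0 _) (hA 0%N); rewrite expr0 mulr1.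
exists (A / rho) => -[|n]/=; first by rewrite normr0 expr0 mulr1 divr_ge0// ltW.
by rewrite exprS mulrA divfK ?gt_eqF.
Qed.

Lemma psum_lin a b k x : superexp_small a -> superexp_small b ->
  psum (k *: a + b) x = k * psum a x + psum b x.
Proof.
move=> fa fb; have ca := superexp_small_cvg (x := x) fa; have cb := superexp_small_cvg (x := x) fb.
rewrite /psum /pseries.
have -> : (fun i => (k *: a + b) i * x ^+ i) =
   k *: (fun i => a i * x ^+ i) + (fun i => b i * x ^+ i).
  apply/funext => i; rewrite [LHS](_ : _ = (k * a i + b i) * x ^+ i)//.
  by rewrite [RHS](_ : _ = k * (a i * x ^+ i) + b i * x ^+ i)//; ring.
rewrite lim_seriesD//; last exact: is_cvg_seriesZ.
by rewrite lim_seriesZ.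
Qed.

Lemma small_scale a (k : R) : superexp_small a -> superexp_small (k *: a).
Proof.
by move=> fa; rewrite -[k](subrK 1) scalerDl scale1r; exact: small_lin.
Qed.

Lemma psum_scale a k x : superexp_small a -> psum (k *: a) x = k * psum a x.
Proof.
move=> fa; rewrite -[k](subrK 1) scalerDl scale1r psum_lin//; ring.
Qed.

Lemma psum_shift a x : superexp_small a -> psum (shift_seq a) x = x * psum a x.
Proof.
move=> fa; have ca := superexp_small_cvg (x := x) fa.
rewrite /psum.
have -> : x * limn (pseries a x) = limn (series (x *: (fun i => a i * x ^+ i))).
  by rewrite lim_seriesZ.
apply: cvg_lim => //.
rewrite -(cvg_shiftS (pseries (shift_seq a) x)).
have -> : (fun n => pseries (shift_seq a) x n.+1) =
   series (x *: (fun i => a i * x ^+ i)).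
  apply/funext => n; rewrite /pseries /series /= big_nat_recl//= mul0r add0r.
  by apply: eq_bigr => i _; rewrite exprS /GRing.scale/= mulrCA.
exact: is_cvg_seriesZ.
Qed.

Lemma psum_deriv a x : superexp_small a ->
  has_deriv (psum a) x (psum (pseries_diffs a) x).
Proof.
move=> fa; apply: (@pseries_snd_diffs _ a (`|x| + 1)).
- exact: superexp_small_cvg.
- exact/superexp_small_cvg/small_diffs.
- exact/superexp_small_cvg/small_diffs/small_diffs.
by rewrite [ltRHS]ger0_norm ?addr_ge0// ltrDl.
Qed.

Lemma psum0 a : psum a 0 = a 0%N.
Proof.
rewrite /psum; apply: cvg_lim => //.
rewrite -(cvg_shiftS (pseries a 0)).
apply: cvg_near_cst; apply: nearW => n.
rewrite /pseries /series /= big_nat_recl//= expr0 mulr1 big1 ?addr0// => i _.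
by rewrite exprS mul0r mulr0.
Qed.

End PowerSeries.

(** * The regular solution of the radial equation *)

Section RegularSolution.
Variable R : realType.
Variables (tau lam : R).

(** The coefficients of the solution satisfy a recurrence reaching back four terms,
    so the iteration carries the last four of them. *)
Definition phi_coef_step (n : nat) (s : R * R * R * R) : R * R * R * R :=
  let: (x0, x1, x2, x3) := s in
  ((x3 - 2 * tau * x2 + (tau ^+ 2 - lam) * x1) / n.+1%:R ^+ 2, x0, x1, x2).

Definition phi_coef_state (n : nat) : R * R * R * R :=
  iteri n phi_coef_step (1, 0, 0, 0).

Definition phi_coef (n : nat) : R := (phi_coef_state n).1.1.1.

Lemma phi_coef_stateE n : phi_coef_state n =
  (phi_coef n, shift_seq phi_coef n, shift_seq (shift_seq phi_coef) n,
   shift_seq (shift_seq (shift_seq phi_coef)) n).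
Proof.
elim: n => // n IH.
by rewrite /phi_coef /= IH.
Qed.

Lemma phi_coef_rec n : n.+2%:R ^+ 2 * phi_coef n.+2 =
  shift_seq (shift_seq phi_coef) n - 2 * tau * shift_seq phi_coef n + (tau ^+ 2 - lam) * phi_coef n.
Proof.
rewrite {1}/phi_coef /phi_coef_state iteriS -/(phi_coef_state n.+1) phi_coef_stateE /=.
by rewrite mulrC divfK// expf_neq0.
Qed.

Lemma phi_coef1 : phi_coef 1 = 0.
Proof. by rewrite /phi_coef /= !mulr0 subrr add0r mul0r. Qed.

Lemma phi_coef0 : phi_coef 0 = 1. Proof. exact: erefl. Qed.

Opaque phi_coef.

(** The factor [n^2] on the left of the recurrence beats any geometric rate. *)
Lemma phi_coef_small : superexp_small phi_coef.
Proof.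
move=> rho rho0.
pose M := rho ^- 4 + 2 * `|tau| * rho ^- 3 + `|tau ^+ 2 - lam| * rho ^- 2.
have M0 : 0 <= M by rewrite !addr_ge0// ?mulr_ge0// invr_ge0 exprn_ge0// ltW.
pose N := Num.bound M.
have MN n : (N <= n)%N -> M <= n.+2%:R ^+ 2.
  move=> Nn; apply: (@le_trans _ _ n.+2%:R).
    apply: ltW; apply: (lt_le_trans (archi_boundP M0)).
    by rewrite ler_nat; apply: (leq_trans Nn); rewrite -addn2 leq_addr.
  by rewrite expr2 ler_peMl// ler1n.
pose C := \sum_(i < N.+2) `|phi_coef i| / rho ^+ i.
have C0 : 0 <= C.
  by apply: sumr_ge0 => i _; rewrite divr_ge0// exprn_ge0// ltW.
have sh (a : nat -> R) (K : R) n : 0 <= K ->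
    (forall m, (m <= n)%N -> `|a m| <= K * rho ^+ m) ->
    (forall m, (m <= n)%N -> `|shift_seq a m| <= K / rho * rho ^+ m).
  move=> K0 h [|m] mn /=; first by rewrite normr0 expr0 mulr1 divr_ge0// ltW.
  by rewrite exprS mulrA divfK ?gt_eqF// h// ltnW.
exists C; elim/ltn_ind => n IH.
have [nN|Nn] := ltnP n N.+2.
  rewrite -ler_pdivrMr ?exprn_gt0// /C (bigD1 (Ordinal nN))//= lerDl.
  by apply: sumr_ge0 => i _; rewrite divr_ge0// exprn_ge0// ltW.
case: n Nn IH => [|[|n]]// Nn IH.
have IH' m : (m <= n)%N -> `|phi_coef m| <= C * rho ^+ m.
  by move=> mn; apply: IH; apply: leq_ltn_trans mn _; rewrite ltnS leqnSn.
have C1 : 0 <= C / rho by rewrite divr_ge0// ltW.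
have h0 := IH' n (leqnn n).
have h1 := sh phi_coef C n C0 IH' n (leqnn n).
have h2 := sh (shift_seq phi_coef) (C / rho) n C1 (sh phi_coef C n C0 IH') n (leqnn n).
have e := phi_coef_rec n.
clearbody C; clear IH IH' sh.
move: (phi_coef n) (phi_coef n.+2) (shift_seq phi_coef n) (shift_seq _ n) e h0 h1 h2.
move=> c0 c4 c1 c2 e h0 h1 h2.
have n2 : 0 < n.+2%:R ^+ 2 :> R by rewrite exprn_gt0.
rewrite -(ler_pM2l n2) -{1}(ger0_norm (ltW n2)) -normrM e.
apply: (@le_trans _ _ (M * (C * rho ^+ n.+2))); last first.
  by rewrite ler_wpM2r ?MN// mulr_ge0// exprn_ge0// ltW.
have -> : M * (C * rho ^+ n.+2) = C / rho / rho * rho ^+ n +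
   2 * `|tau| * (C / rho * rho ^+ n) + `|tau ^+ 2 - lam| * (C * rho ^+ n).
  by rewrite /M !exprS; field; rewrite gt_eqF.
rewrite (le_trans (ler_normD _ _))// lerD//; last first.
  by rewrite normrM ler_wpM2l.
rewrite (le_trans (ler_normB _ _))// lerD//.
by rewrite !normrM ger0_norm// ler_wpM2l// mulr_ge0.
Qed.

Definition potential (r : R) : R := (r - tau) ^+ 2 - lam.

Definition phi : R -> R := psum phi_coef.

Definition sig_coef (n : nat) : R := n.+2%:R * phi_coef n.+2.

(** [sig r] is [phi' r / r], which is entire because [phi' 0 = 0]: in terms of
    it the equation has no singularity at the origin. *)
Definition sig : R -> R := psum sig_coef.

Definition phi_prime (r : R) : R := r * sig r.

Lemma diffs_phi_coef : pseries_diffs phi_coef = shift_seq sig_coef.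
Proof.
apply/funext => -[|n]; rewrite /pseries_diffs; last exact: erefl.
by rewrite phi_coef1 mulr0.
Qed.

Lemma sig_coef_small : superexp_small sig_coef.
Proof.
move=> rho rho0; have [C hC] := small_diffs phi_coef_small rho0.
exists (C * rho) => n; rewrite -mulrA -exprS.
by have := hC n.+1; rewrite diffs_phi_coef.
Qed.

Lemma phi0 : phi 0 = 1. Proof. by rewrite /phi psum0 phi_coef0. Qed.

Lemma phi_prime0 : phi_prime 0 = 0. Proof. by rewrite /phi_prime mul0r. Qed.

Lemma phi_deriv x : has_deriv phi x (phi_prime x).
Proof.
apply: has_deriv_eq; first exact: (psum_deriv _ phi_coef_small).
by rewrite diffs_phi_coef psum_shift//; exact: sig_coef_small.
Qed.

Lemma sig_deriv x : has_deriv sig x (psum (pseries_diffs sig_coef) x).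
Proof. exact: (psum_deriv _ sig_coef_small). Qed.

Lemma phi_prime_deriv x : has_deriv phi_prime x (potential x * phi x - sig x).
Proof.
have e : x * psum (pseries_diffs sig_coef) x + 2 * sig x = potential x * phi x.
  have s0 := phi_coef_small; have s1 := small_shift s0; have s2 := small_shift s1.
  have ss := sig_coef_small; have sds := small_diffs ss.
  have sA := small_scale (tau ^+ 2 - lam) s0.
  have sB := small_lin (- 2 * tau) s1 sA.
  have -> : potential x * phi x = psum (1 *: shift_seq (shift_seq phi_coef) +
      ((- 2 * tau) *: shift_seq phi_coef + (tau ^+ 2 - lam) *: phi_coef)) x.
    rewrite (psum_lin 1 x s2 sB) (psum_lin _ x s1 sA) (psum_scale _ x s0).
    by rewrite (psum_shift x s1) (psum_shift x s0) /potential /phi; ring.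
  rewrite addrC -(psum_shift x sds) -(psum_lin _ x ss (small_shift sds)).
  congr (psum _ x); apply/funext => n.
  rewrite [LHS](_ : _ = 2 * sig_coef n + shift_seq (pseries_diffs sig_coef) n)//.
  rewrite [RHS](_ : _ = 1 * shift_seq (shift_seq phi_coef) n + ((- 2 * tau) * shift_seq phi_coef n
    + (tau ^+ 2 - lam) * phi_coef n))//.
  rewrite [RHS](_ : _ = n.+2%:R ^+ 2 * phi_coef n.+2); last by rewrite phi_coef_rec; ring.
  have -> : shift_seq (pseries_diffs sig_coef) n = n%:R * sig_coef n.
    by case: n => [|n]; [rewrite mul0r | rewrite /pseries_diffs].
  by rewrite /sig_coef -[n.+2]addn2 natrD; ring.
rewrite /phi_prime; have sd := sig_deriv x; solve_deriv.
by rewrite -e; ring.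
Qed.

Hint Resolve phi_deriv phi_prime_deriv : deriv.

Lemma phi_continuous : continuous phi.
Proof. by move=> x; apply: has_deriv_continuous (phi_deriv x). Qed.

Lemma sig_continuous : continuous sig.
Proof. by move=> x; apply: has_deriv_continuous (sig_deriv x). Qed.

Lemma phi_prime_continuous : continuous phi_prime.
Proof. by move=> x; apply: has_deriv_continuous (phi_prime_deriv x). Qed.

End RegularSolution.

#[global] Hint Resolve phi_deriv phi_prime_deriv : deriv.

(** * Continuous functions on segments *)

Section Segments.
Variable R : realType.
Implicit Types (f : R -> R) (a b x : R).

Lemma continuous_bounded f a b : continuous f ->
  exists2 M : R, 0 <= M & forall x, a <= x <= b -> `|f x| <= M.
Proof.
move=> fc; have [ab|ba] := leP a b; last first.
  exists 0 => // x /andP[ax xb]; have := le_lt_trans (le_trans ax xb) ba.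
  by rewrite ltxx.
have [|c _ hc] := @EVT_max R (fun x => `|f x|) a b ab.
  by apply: continuous_within => x _; apply: continuous_comp; [exact: fc|exact: norm_continuous].
by exists `|f c| => // x xab; apply: hc; rewrite in_itv.
Qed.

Lemma continuous_pos_lb f a b : a <= b -> continuous f ->
  (forall x, a <= x <= b -> 0 < f x) ->
  exists2 c : R, 0 < c & forall x, a <= x <= b -> c <= f x.
Proof.
move=> ab fc fp; have [|c cab hc] := @EVT_min R f a b ab.
  by apply: continuous_within => x _; exact: fc.
exists (f c); first by apply: fp; rewrite in_itv/= in cab.
by move=> x xab; apply: hc; rewrite in_itv.
Qed.

Lemma continuous_root f a b : a <= b -> continuous f -> f a * f b <= 0 ->
  exists2 c, a <= c <= b & f c = 0.
Proof.
move=> ab fc fab; have [| |c cab fc0] := @IVT R f a b 0 ab.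
- by apply: continuous_within => x _; exact: fc.
- have [fa|fa] := leP (f a) (f b); apply/andP; split; nra.
by exists c => //; rewrite in_itv/= in cab.
Qed.

Lemma continuous_pos_near f x : {for x, continuous f} -> 0 < f x ->
  exists2 e : R, 0 < e & forall y, `|y - x| < e -> 0 < f y.
Proof.
move=> fc fx.
have /nbhs_ballP[e /= e0 he] : \forall y \near x, 0 < f y by exact: (cvgr_gt (f x) fc _ fx).
by exists e => // y yx; apply: he; rewrite /ball/= distrC.
Qed.

Lemma exists_below a b c : 0 < a -> 0 < b -> 0 < c ->
  exists m : R, [/\ 0 < m, m < a, m < b & m < c].
Proof.
move=> a0 b0 c0; exists (Num.min a (Num.min b c) / 2).
have m0 : 0 < Num.min a (Num.min b c) by rewrite !lt_min a0 b0.
have h : Num.min a (Num.min b c) / 2 < Num.min a (Num.min b c) by lra.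
split; first by rewrite divr_gt0.
- by apply: lt_le_trans h _; rewrite ge_min lexx.
- by apply: lt_le_trans h _; rewrite !ge_min lexx orbT.
- by apply: lt_le_trans h _; rewrite !ge_min lexx !orbT.
Qed.

(** The position of the intermediate point is recorded as a distance to [z], which
    makes sense on either side of it. *)
Lemma mean_value f df x z : (forall r, has_deriv f r (df r)) ->
  exists2 xi, `|xi - z| <= `|x - z| & f x - f z = df xi * (x - z).
Proof.
move=> hf; have fc y : {for y, continuous f} := has_deriv_continuous (hf y).
have [xz|/ltW zx] := leP x z.
- have [||xi] := @MVT_segment R f df x z xz.
  + by move=> y _; exact: hf.
  + exact: continuous_within.
  rewrite in_itv/= => hxi e; exists xi; last by lra.
  by rewrite !ler0_norm; lra.
- have [||xi] := @MVT_segment R f df z x zx.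
  + by move=> y _; exact: hf.
  + exact: continuous_within.
  rewrite in_itv/= => hxi e; exists xi; last by lra.
  by rewrite !ger0_norm; lra.
Qed.

End Segments.

Section Gronwall.
Variable R : realType.
Implicit Types (E dE : R -> R) (a b K c : R).

Lemma gronwall E dE K c a b : a <= b -> 0 < K ->
  (forall x, has_deriv E x (dE x)) ->
  (forall x, a < x < b -> dE x <= K * E x + c) ->
  E b + c / K <= (E a + c / K) * expR (K * (b - a)).
Proof.
move=> ab K0 hE hd.
pose G x := (E x + c / K) * expR (- (K * x)).
have hG x : has_deriv G x ((dE x - K * E x - c) * expR (- (K * x))).
  by have h := hE x; rewrite /G; solve_deriv; field; rewrite gt_eqF.
have : G b <= G a.
  apply: (has_deriv_le0_ge ab) => x xab.
  - exact: has_deriv_continuous (hG x).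
  - exact: hG.
  - by rewrite mulr_le0_ge0 ?expR_ge0//; have := hd x xab; lra.
rewrite /G expRN ler_pdivrMr ?expR_gt0// => /le_trans; apply.
by rewrite -mulrA -expRD le_eqVlt; apply/orP; left; apply/eqP; congr (_ * expR _); ring.
Qed.

End Gronwall.

(** * Dependence on the spectral parameter, uniqueness *)

Section Solutions.
Variable R : realType.
Variable tau : R.
Implicit Types (lam mu r a b : R).
Local Notation V := (potential tau).
Local Notation phi := (phi tau).
Local Notation sig := (sig tau).
Local Notation dphi := (phi_prime tau).

(** The damping term [- phi' / r] only decreases the energy [d^2 + d'^2] of the
    difference of two solutions. *)
Lemma solution_energy lam mu (K M b : R) : 0 < K -> `|mu - lam| <= 1 ->
  (forall r, 0 <= r <= b -> `|V lam r| <= K) ->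
  (forall r, 0 <= r <= b -> `|phi lam r| <= M) ->
  forall r, 0 <= r <= b ->
  (phi mu r - phi lam r) ^+ 2 + (dphi mu r - dphi lam r) ^+ 2 <=
  (mu - lam) ^+ 2 * (M ^+ 2 / (K + 3)) * expR ((K + 3) * b).
Proof.
move=> K0 ml hV hM r /andP[r0 rb].
pose E x := (phi mu x - phi lam x) ^+ 2 + (dphi mu x - dphi lam x) ^+ 2.
pose dE x := 2 * (phi mu x - phi lam x) * (dphi mu x - dphi lam x) +
  2 * (dphi mu x - dphi lam x) *
    ((V mu x * phi mu x - sig mu x) - (V lam x * phi lam x - sig lam x)).
have hE x : has_deriv E x (dE x) by rewrite /E; solve_deriv; rewrite /dE /=; ring.
have K3 : 0 < K + 3 by lra.
have b0 : 0 <= b by lra.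
have M0 : 0 <= M by apply: le_trans (hM r _); rewrite ?r0.
have := @gronwall _ E dE (K + 3) ((mu - lam) ^+ 2 * M ^+ 2) 0 r r0 K3 hE.
have E0 : E 0 = 0 by rewrite /E !phi0 !phi_prime0; ring.
rewrite E0 add0r subr0 => G.
apply: (@le_trans _ _ (E r + (mu - lam) ^+ 2 * M ^+ 2 / (K + 3))).
  rewrite lerDl; apply: divr_ge0; last exact: ltW.
  by apply: mulr_ge0; apply: sqr_ge0.
apply: le_trans (G _) _ => [x /andP[x0 xr]|]; last first.
  rewrite mulrA; apply: ler_wpM2l.
    by apply: divr_ge0; [apply: mulr_ge0; apply: sqr_ge0 | exact: ltW].
  by rewrite ler_expR; apply: ler_wpM2l => //; exact: ltW.
have xb : 0 <= x <= b by rewrite (ltW x0)/=; lra.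
have := hV x xb; have := hM x xb.
rewrite /dE /E /dphi.
set d := phi mu x - phi lam x.
rewrite (_ : phi mu x = phi lam x + d); last by rewrite /d; ring.
rewrite (_ : V mu x = V lam x + (lam - mu)); last by rewrite /potential; ring.
move: (phi lam x) (sig lam x) (sig mu x) (V lam x) d => p s1 s2 v d.
rewrite !ler_norml => /andP[p1 p2] /andP[v1 v2].
move: ml; rewrite ler_norml => /andP[m1 m2].
set D := x * s2 - x * s1.
have -> : (v + (lam - mu)) * (p + d) - s2 - (v * p - s1) =
   (v + (lam - mu)) * d + (lam - mu) * p - (s2 - s1) by ring.
have h1 : 0 <= D * (s2 - s1).
  rewrite /D -mulrBr -mulrA; apply: mulr_ge0; first exact: ltW.
  by rewrite -expr2; exact: sqr_ge0.
have h2 : 2 * d * D * (1 + (v + (lam - mu))) <= (K + 2) * (d ^+ 2 + D ^+ 2).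
  have k1 : 0 <= (K + 2 + (1 + (v + (lam - mu)))) * (d - D) ^+ 2.
    by rewrite mulr_ge0 ?sqr_ge0//; lra.
  have k2 : 0 <= (K + 2 - (1 + (v + (lam - mu)))) * (d + D) ^+ 2.
    by rewrite mulr_ge0 ?sqr_ge0//; lra.
  nra.
have h3 : 2 * D * ((lam - mu) * p) <= D ^+ 2 + (mu - lam) ^+ 2 * M ^+ 2.
  have k1 := sqr_ge0 (D - (lam - mu) * p).
  have k2 : 0 <= (lam - mu) ^+ 2 * ((M - p) * (M + p)).
    by rewrite mulr_ge0 ?sqr_ge0// mulr_ge0//; lra.
  nra.
have := sqr_ge0 d; nra.
Qed.

Lemma solution_continuity lam b (e : R) : 0 < e -> exists2 del : R, 0 < del &
  forall mu, `|mu - lam| < del -> forall r, 0 <= r <= b ->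
  `|phi mu r - phi lam r| < e /\ `|dphi mu r - dphi lam r| < e.
Proof.
move=> e0.
have [M M0 hM] := continuous_bounded 0 b (@phi_continuous R tau lam).
pose K := (`|b| + `|tau|) ^+ 2 + `|lam| + 1.
have K0 : 0 < K by rewrite ltr_wpDl// addr_ge0// sqr_ge0.
have hV r : 0 <= r <= b -> `|V lam r| <= K.
  move=> /andP[r0 rb]; rewrite /potential /K (le_trans (ler_normB _ _))//.
  have : (r - tau) ^+ 2 <= (`|b| + `|tau|) ^+ 2.
    rewrite -real_normK ?num_real// lerXn2r ?nnegrE ?addr_ge0//.
    rewrite (le_trans (ler_normB _ _))// lerD// ger0_norm//.
    by rewrite (le_trans rb)// ler_norm.
  by rewrite (ger0_norm (sqr_ge0 (r - tau))) => h; rewrite -addrA lerD// lerDl.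
pose A := M ^+ 2 / (K + 3) * expR ((K + 3) * b).
have A0 : 0 <= A by rewrite mulr_ge0 ?expR_ge0// divr_ge0 ?sqr_ge0//; lra.
exists (Num.min 1 (e / (A + 1))); first by rewrite lt_min ltr01 divr_gt0//; lra.
move=> mu; rewrite lt_min => /andP[m1 m2] r rb.
have := solution_energy K0 (ltW m1) hV hM rb; rewrite -[leRHS]mulrA -/A => h.
have h2 : (mu - lam) ^+ 2 * A < e ^+ 2.
  apply: (@le_lt_trans _ _ ((`|mu - lam| * (A + 1)) ^+ 2)).
    by rewrite exprMn real_normK ?num_real// ler_wpM2l ?sqr_ge0//; nra.
  rewrite ltrXn2r ?nnegrE ?mulr_ge0 ?addr_ge0 ?(ltW e0)//.
  by rewrite -ltr_pdivlMr//; lra.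
move: h; set x := phi mu r - _; set y := dphi mu r - _ => h.
by split; rewrite -(ltr_pXn2r (_ : 0 < 2)%N)// ?nnegrE ?(ltW e0)//
  real_normK ?num_real//; have := sqr_ge0 x; have := sqr_ge0 y; lra.
Qed.

End Solutions.

(** * Zeros of the regular solution *)

Section Zeros.
Variable R : realType.
Variable tau : R.
Implicit Types (lam mu r a b : R).
Local Notation V := (potential tau).
Local Notation phi := (phi tau).
Local Notation sig := (sig tau).
Local Notation dphi := (phi_prime tau).

Lemma phi_pos_near0 lam : exists2 e : R, 0 < e & forall r, 0 <= r < e -> 0 < phi lam r.
Proof.
have [|e e0 he] := continuous_pos_near (@phi_continuous R tau lam 0).
  by rewrite phi0.
by exists e => // r /andP[r0 re]; apply: he; rewrite subr0 ger0_norm.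
Qed.

(** For [K] large, [exp (K x) (phi^2 + phi'^2)] is nondecreasing away from the
    singular point, and it is positive near the origin because [phi 0 = 1]. *)
Lemma no_double_zero lam r : 0 < r -> phi lam r = 0 -> dphi lam r = 0 -> False.
Proof.
move=> r0 p0 d0; have [e e0 he] := phi_pos_near0 lam.
have [a [a0 ae /ltW ar _]] := exists_below e0 r0 r0.
have [M M0 hM] : exists2 M : R, 0 <= M & forall x, a <= x <= r -> `|V lam x| <= M.
  apply: continuous_bounded => x.
  apply: (@has_deriv_continuous _ _ _ (2 * (x - tau))).
  by rewrite /potential; solve_deriv; ring.
pose K := M + 1 + 2 / a.
pose E x := (phi lam x ^+ 2 + dphi lam x ^+ 2) * expR (K * x).
pose dE x := (2 * phi lam x * dphi lam x +
  2 * dphi lam x * (V lam x * phi lam x - sig lam x) + K * (phi lam x ^+ 2 + dphi lam x ^+ 2)) * expR (K * x).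
have hE x : has_deriv E x (dE x) by rewrite /E; solve_deriv; rewrite /dE /=; ring.
have : E a <= E r.
  apply: (has_deriv_ge0_le ar) => x xar.
  - exact: has_deriv_continuous (hE x).
  - exact: hE.
  have xar' : a <= x <= r by lra.
  have := hM x xar'; rewrite ler_norml => /andP[v1 v2].
  rewrite /dE mulr_ge0 ?expR_ge0//.
  have x0 : 0 < x by lra.
  have -> : sig lam x = dphi lam x / x by rewrite /phi_prime mulrC mulKf// gt_eqF.
  move: (phi lam x) (dphi lam x) (V lam x) v1 v2 => p d v v1 v2.
  have xa : x^-1 <= a^-1 by rewrite lef_pV2//; lra.
  have h1 : 2 * d * (d / x) <= 2 / a * d ^+ 2.
    have : 0 <= (a^-1 - x^-1) * d ^+ 2 by rewrite mulr_ge0 ?sqr_ge0//; lra.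
    by nra.
  have k1 : 0 <= (M + v) * (p + d) ^+ 2 by rewrite mulr_ge0 ?sqr_ge0//; lra.
  have k2 : 0 <= (M - v) * (p - d) ^+ 2 by rewrite mulr_ge0 ?sqr_ge0//; lra.
  have a2 : 0 <= 2 / a by rewrite divr_ge0// ltW.
  have := sqr_ge0 (p + d); have := sqr_ge0 (p - d).
  have : 0 <= 2 / a * p ^+ 2 by rewrite mulr_ge0 ?sqr_ge0.
  rewrite /K; nra.
rewrite /E p0 d0 expr0n/= addr0 mul0r leNgt.
apply/negP; rewrite negbK; apply: mulr_gt0; last exact: expR_gt0.
apply: ltr_wpDr; first exact: sqr_ge0.
by apply: exprn_gt0; apply: he; rewrite ae ltW.
Qed.

Definition flux lam r : R := r * (phi lam r * dphi lam r).

(** The singular terms cancel: [(r phi phi')' = r (phi'^2 + V phi^2)]. *)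
Lemma flux_deriv lam r : has_deriv (flux lam) r
  (r * (dphi lam r ^+ 2 + V lam r * phi lam r ^+ 2)).
Proof. by rewrite /flux; solve_deriv; rewrite /phi_prime; ring. Qed.

Lemma flux_le lam a b : 0 <= a -> a <= b ->
  (forall x, a < x < b -> 0 <= V lam x) -> flux lam a <= flux lam b.
Proof.
move=> a0 ab Vp; apply: (has_deriv_ge0_le ab) => x xab.
- exact: has_deriv_continuous (flux_deriv lam x).
- exact: flux_deriv.
- have x0 : 0 <= x by lra.
  by rewrite mulr_ge0// addr_ge0 ?sqr_ge0// mulr_ge0 ?sqr_ge0// Vp.
Qed.

Lemma phi_sqr_deriv lam r : has_deriv (fun x => phi lam x ^+ 2) r
  (2 * (phi lam r * dphi lam r)).
Proof. by solve_deriv; rewrite /=; ring. Qed.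

Lemma phi_sqr_le lam a b : 0 < a -> a <= b -> 0 <= flux lam a ->
  (forall x, a < x < b -> 0 <= V lam x) -> phi lam a ^+ 2 <= phi lam b ^+ 2.
Proof.
move=> a0 ab fa Vp.
apply: (@has_deriv_ge0_le _ (fun x => phi lam x ^+ 2) _ _ _ ab) => x xab.
- exact: has_deriv_continuous (phi_sqr_deriv lam x).
- exact: phi_sqr_deriv.
- have x0 : 0 < x by lra.
  apply: mulr_ge0 => //; rewrite -(pmulr_rge0 _ x0) -/(flux lam x).
  apply: (le_trans fa); apply: flux_le; [lra|lra|] => y yx; apply: Vp; lra.
Qed.

(** Where [0 <= V] the flux [r phi phi'] is nondecreasing, so [phi^2] cannot come
    back to zero. *)
Lemma one_zero lam a b : 0 < a -> a < b ->
  (forall x, a < x < b -> 0 <= V lam x) ->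
  phi lam a = 0 -> phi lam b = 0 -> False.
Proof.
move=> a0 ab Vp pa pb.
have fa : flux lam a = 0 by rewrite /flux pa; ring.
have z x : a <= x <= b -> phi lam x = 0.
  move=> /andP[ax xb]; apply/eqP; rewrite -sqrf_eq0 eq_le sqr_ge0 andbT.
  have -> : 0 = phi lam b ^+ 2 by rewrite pb expr0n.
  apply: phi_sqr_le => //; [lra| |by move=> y yx; apply: Vp; lra].
  by rewrite -fa; apply: flux_le; [exact: ltW|done|move=> y yx; apply: Vp; lra].
have [||c cab] := @MVT R (phi lam) (dphi lam) a b ab.
- by move=> x _; exact: phi_deriv.
- by apply: continuous_within => x _; exact: phi_continuous.
rewrite in_itv/= in cab; rewrite pa pb subrr => /esym/eqP.
rewrite mulf_eq0 => /orP[/eqP dc|]; last by lra.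
apply: (@no_double_zero lam c) => //; [lra|apply: z; lra].
Qed.

Lemma flux_gt0 lam a b : 0 < a -> a <= b ->
  (forall x, a < x < b -> 0 <= V lam x) ->
  0 < phi lam a * dphi lam a -> 0 < phi lam b * dphi lam b.
Proof.
move=> a0 ab Vp h; have b0 : 0 < b by lra.
rewrite -(pmulr_rgt0 _ b0) -/(flux lam b); apply: lt_le_trans (flux_le (ltW a0) ab Vp).
by rewrite /flux mulr_gt0.
Qed.

Lemma growth_no_zero lam a b : 0 < a -> a <= b ->
  (forall x, a < x < b -> 0 <= V lam x) ->
  0 < phi lam a * dphi lam a -> 0 < phi lam a * phi lam b.
Proof.
move=> a0 ab Vp h; rewrite ltNge; apply/negP => /(continuous_root ab).
case=> [|c cab pc]; first exact: phi_continuous.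
have ac : a <= c by lra.
have := flux_gt0 a0 ac _ h; rewrite pc mul0r ltxx => H; suff: false by [].
by apply: H => x xc; apply: Vp; lra.
Qed.

Lemma V_large lam (k r : R) : 0 <= k -> `|tau| + `|lam| + k + 1 <= r ->
  k ^+ 2 + 1 <= V lam r.
Proof.
move=> k0 hr; rewrite /potential.
have := ler_norm tau; have := ler_norm lam; have := normr_ge0 lam.
move: `|tau| `|lam| hr => t l hr l0 hl ht.
have : l + k + 1 <= r - tau by lra.
nra.
Qed.

End Zeros.

(** * Decay faster than every exponential *)

Section Decay.
Variable R : realType.
Implicit Types (f g : R -> R) (a b r k C : R).

(** Demanding more than integrability makes the condition stable under products
    with polynomials, and the eigenfunctions satisfy it. *)
Definition decays f : Prop :=
  forall k, exists C, forall r, 0 <= r -> `|f r| <= C * expR (- (k * r)).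

Lemma decays_tail f : continuous f ->
  (forall k, exists C a, forall r, a <= r -> `|f r| <= C * expR (- (k * r))) ->
  decays f.
Proof.
move=> fc h k; have [C [a hC]] := h k.
have [M M0 hM] := continuous_bounded 0 a fc.
exists (`|C| + M * expR (`|k| * `|a|)) => r r0.
have [ra|ar] := leP r a; last first.
  apply: le_trans (hC r (ltW ar)) _; apply: ler_wpM2r; first exact: expR_ge0.
  by apply: ler_wpDr; [rewrite mulr_ge0 ?expR_ge0 | exact: ler_norm].
apply: le_trans (hM r _) _; first by rewrite r0.
rewrite mulrDl; apply: ler_wpDl; first by rewrite mulr_ge0 ?expR_ge0.
rewrite -mulrA -expRD; apply: ler_peMr => //.
rewrite -expR0 ler_expR subr_ge0 (le_trans (ler_norm _))// normrM.
by apply: ler_wpM2l => //; rewrite ger0_norm// (le_trans ra)// ler_norm.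
Qed.

Lemma decays_ext f g : (forall r, 0 <= r -> f r = g r) -> decays f -> decays g.
Proof. by move=> e df k; have [C hC] := df k; exists C => r r0; rewrite -e ?hC. Qed.

Lemma decaysD f g : decays f -> decays g -> decays (fun r => f r + g r).
Proof.
move=> df dg k; have [C hC] := df k; have [D hD] := dg k; exists (C + D) => r r0.
by rewrite mulrDl (le_trans (ler_normD _ _))// lerD ?hC ?hD.
Qed.

Lemma decaysZ f (c : R) : decays f -> decays (fun r => c * f r).
Proof.
move=> df k; have [C hC] := df k; exists (`|c| * C) => r r0.
by rewrite normrM -mulrA ler_wpM2l ?hC.
Qed.

Lemma decaysX f : decays f -> decays (fun r => r * f r).
Proof.
move=> df k; have [C hC] := df (k + 1).
have C0 : 0 <= C.
  by have := le_trans (normr_ge0 _) (hC 0 (lexx 0)); rewrite mulr0 oppr0 expR0 mulr1.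
exists C => r r0; rewrite normrM (ger0_norm r0).
apply: (@le_trans _ _ (expR r * (C * expR (- ((k + 1) * r))))).
  apply: ler_pM => //; last exact: hC.
  by apply: le_trans (expR_ge1Dx r); rewrite lerDr.
by rewrite mulrCA -expRD; apply: ler_wpM2l => //; rewrite ler_expR; lra.
Qed.

Lemma decaysM f g : decays f -> decays g -> decays (fun r => f r * g r).
Proof.
move=> df dg k; have [C hC] := df k; have [D hD] := dg 0.
exists (C * D) => r r0; rewrite normrM mulrAC; apply: ler_pM => //; first exact: hC.
by have := hD r r0; rewrite mul0r oppr0 expR0 mulr1.
Qed.

Lemma decaysB f g : decays f -> decays g -> decays (fun r => f r - g r).
Proof.
move=> df dg; apply: decays_ext (decaysD df (decaysZ (-1) dg)) => r _ /=.
by rewrite mulN1r.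
Qed.

Lemma decays_small f (e : R) : decays f -> 0 < e ->
  exists2 a, 0 <= a & forall r, a <= r -> `|f r| < e.
Proof.
move=> df e0; have [C hC] := df 1.
exists (Num.max 0 (C / e)); first by rewrite le_max lexx.
move=> r; rewrite ge_max => /andP[r0 Cr].
apply: le_lt_trans (hC r r0) _; rewrite mul1r expRN ltr_pdivrMr ?expR_gt0//.
apply: le_lt_trans (_ : C <= e * r) _; first by rewrite mulrC -ler_pdivrMr.
rewrite ltr_pM2l//; apply: lt_le_trans (expR_ge1Dx r).
by rewrite ltrDr.
Qed.

(** If [y' + k y] were positive somewhere it would from there on grow at least like
    [exp (k r)], while it is at most [k y], which is nonincreasing. The bound on
    [y'] follows from that on [y], since [y] is convex. *)
Lemma monotone_solution_decays (y dy W : R -> R) (a k : R) : 0 < k -> 0 < a ->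
  (forall r, has_deriv y r (dy r)) ->
  (forall r, 0 < r -> has_deriv dy r (W r * y r - dy r / r)) ->
  (forall r, a <= r -> k ^+ 2 <= W r) ->
  (forall r, a <= r -> 0 <= y r) -> (forall r, a <= r -> dy r <= 0) ->
  exists C, forall r, a + 1 <= r ->
    y r <= C * expR (- (k * r)) /\ - dy r <= C * expR (- (k * r)).
Proof.
move=> k0 a0 hy hdy hW y0 dy0.
have y_mono b c : a <= b -> b <= c -> y c <= y b.
  move=> ab bc; apply: (@has_deriv_le0_ge _ y dy) => // x xbc.
    exact: has_deriv_continuous (hy x).
  by apply: dy0; lra.
have dk r : a <= r -> dy r + k * y r <= 0.
  move=> ar; rewrite leNgt; apply/negP => p0.
  set p0v := dy r + k * y r in p0.
  pose p x := (dy x + k * y x) * expR (- (k * x)).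
  pose dp x := (W x * y x - dy x / x + k * dy x - k * (dy x + k * y x)) * expR (- (k * x)).
  have hp x : 0 < x -> has_deriv p x (dp x).
    by move=> x0; have h1 := hdy x x0; have h2 := hy x; rewrite /p; solve_deriv; rewrite /dp; ring.
  have p_mono b : r <= b -> p r <= p b.
    move=> rb; apply: (@has_deriv_ge0_le _ p dp) => // x xrb.
    - by apply: has_deriv_continuous (hp x _); lra.
    - by apply: hp; lra.
    have ax : a <= x by lra.
    rewrite /dp mulr_ge0 ?expR_ge0//.
    have : 0 <= (W x - k ^+ 2) * y x by rewrite mulr_ge0 ?y0// subr_ge0 hW.
    have : 0 <= - dy x / x by rewrite divr_ge0 ?oppr_ge0 ?dy0//; lra.
    by rewrite mulNr; nra.
  pose s := r + y r / p0v.
  have rs : r <= s by rewrite lerDl divr_ge0 ?y0// ltW.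
  have := p_mono s rs; rewrite /p -/p0v => h.
  have : p0v * expR (k * (s - r)) <= dy s + k * y s.
    have -> : expR (k * (s - r)) = expR (- (k * r)) * expR (k * s).
      by rewrite -expRD; congr expR; ring.
    rewrite mulrA; apply: le_trans (ler_wpM2r (expR_ge0 _) h) _.
    by rewrite -mulrA -expRD addNr expR0 mulr1.
  have h2 : p0v * (1 + k * (s - r)) <= p0v * expR (k * (s - r)).
    by rewrite ler_pM2l// expR_ge1Dx.
  have h3 : k * y s <= k * y r by rewrite ler_pM2l// y_mono.
  have h4 : p0v * (k * (s - r)) = k * y r.
    by rewrite /s; field; rewrite gt_eqF.
  have h5 : dy s <= 0 by apply: dy0; lra.
  nra.
pose C := y a * expR (k * a).
have C0 : 0 <= C by rewrite mulr_ge0 ?expR_ge0// y0.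
have hC r : a <= r -> y r <= C * expR (- (k * r)).
  move=> ar; rewrite expRN ler_pdivlMr ?expR_gt0//.
  apply: (@has_deriv_le0_ge _ (fun x => y x * expR (k * x))
     (fun x => (dy x + k * y x) * expR (k * x)) _ _ ar) => x xar.
  - apply: (@has_deriv_continuous _ _ _ ((dy x + k * y x) * expR (k * x))).
    by have h := hy x; solve_deriv; ring.
  - by have h := hy x; solve_deriv; ring.
  - by rewrite mulr_le0_ge0 ?expR_ge0// dk//; lra.
exists (C * expR k) => r ar.
have e : expR k * expR (- (k * r)) = expR (- (k * (r - 1))).
  by rewrite -expRD; congr expR; ring.
split.
  apply: le_trans (hC r _) _; first lra.
  rewrite -mulrA e; apply: ler_wpM2l => //; rewrite ler_expR; lra.
rewrite -mulrA e.
have r1 : a <= r - 1 by lra.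
apply: le_trans (hC _ r1).
have hdyx x : a <= x -> x <= r -> dy x <= dy r.
  move=> ax xr.
  have : x * dy x <= r * dy r.
    apply: (@has_deriv_ge0_le _ (fun x => x * dy x) (fun x => x * (W x * y x))) => // z zx.
    - apply: (@has_deriv_continuous _ _ _ (z * (W z * y z))).
      have z0 : 0 < z by lra.
      by have h := hdy z z0; solve_deriv; field; rewrite gt_eqF.
    - have z0 : 0 < z by lra.
      by have h := hdy z z0; solve_deriv; field; rewrite gt_eqF.
    - have az : a <= z by lra.
      rewrite mulr_ge0 ?mulr_ge0 ?y0//; first lra.
      by apply: le_trans (hW z az); exact: sqr_ge0.
  have dr : dy r <= 0 by apply: dy0; lra.
  have x0 : 0 < x by lra.
  have : 0 <= (r - x) * - dy r by rewrite mulr_ge0//; lra.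
  move=> h1 h2; rewrite -(ler_pM2l x0); lra.
have : y r - dy r * r <= y (r - 1) - dy r * (r - 1).
  apply: (@has_deriv_le0_ge _ (fun x => y x - dy r * x) (fun x => dy x - dy r)) => [|x xr|x xr|x xr].
  - lra.
  - apply: (@has_deriv_continuous _ _ _ (dy x - dy r)).
    by have h := hy x; solve_deriv; ring.
  - by have h := hy x; solve_deriv; ring.
  - by rewrite subr_le0; apply: hdyx; lra.
have : 0 <= y r by apply: y0; lra.
lra.
Qed.

End Decay.

Section Decaying.
Variable R : realType.
Variable tau : R.
Implicit Types (lam mu r a b : R).
Local Notation V := (potential tau).
Local Notation phi := (phi tau).
Local Notation sig := (sig tau).
Local Notation dphi := (phi_prime tau).

Definition decaying lam : Prop := decays (phi lam) /\ decays (dphi lam).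

(** Far out [phi] is then of constant sign with [phi^2] nonincreasing, and the
    potential exceeds any [k^2]. *)
Lemma not_growing_decaying lam a :
  (forall r, a <= r -> phi lam r * dphi lam r <= 0) -> decaying lam.
Proof.
move=> h.
pose b := Num.max a 0 + `|tau| + `|lam| + 1.
have b0 : 0 < b /\ a <= b.
  rewrite /b; have := normr_ge0 tau; have := normr_ge0 lam.
  by case: (leP a 0) => ?; split; lra.
have Vb r : b <= r -> 1 <= V lam r.
  move=> br; have := @V_large R tau lam 0 r (lexx 0).
  rewrite expr0n add0r; apply; apply: le_trans br; rewrite /b.
  by case: (leP a 0) => ?; lra.
have nz r : b <= r -> phi lam r != 0.
  move=> br; apply/eqP => pr.
  have r0 : 0 < r by lra.
  apply: (@one_zero R tau lam r (r + 1)) => //; first lra.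
    by move=> x xr; have := Vb x; lra.
  apply/eqP; rewrite -sqrf_eq0 eq_le sqr_ge0 andbT.
  rewrite (_ : 0 = phi lam r ^+ 2); last by rewrite pr expr0n.
  apply: (@has_deriv_le0_ge _ (fun x => phi lam x ^+ 2)
    (fun x => 2 * (phi lam x * dphi lam x))) => [|x xr|x xr|x xr].
  - lra.
  - exact: has_deriv_continuous (phi_sqr_deriv tau lam x).
  - exact: phi_sqr_deriv.
  - have := h x; lra.
pose s := phi lam b.
have sp r : b <= r -> 0 < s * phi lam r.
  move=> br; rewrite ltNge; apply/negP => /(continuous_root br).
  case=> [|c cbr pc]; first exact: phi_continuous.
  by have := nz c; rewrite pc eqxx; case/andP: cbr => bc _ /(_ bc).
have sd r : b <= r -> s * dphi lam r <= 0.
  move=> br; rewrite -(pmulr_rle0 _ (sp r br)).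
  have -> : s * phi lam r * (s * dphi lam r) = s ^+ 2 * (phi lam r * dphi lam r) by ring.
  by rewrite mulr_ge0_le0 ?sqr_ge0// h//; lra.
have s0 : 0 < `|s| by rewrite normr_gt0 nz.
have tail k : exists C a, forall r, a <= r ->
    `|phi lam r| <= C * expR (- (k * r)) /\ `|dphi lam r| <= C * expR (- (k * r)).
  pose k' := `|k| + 1.
  pose c := b + k'.
  have k0 : 0 < k' by rewrite ltr_wpDl.
  have kk : k <= k' by rewrite ler_wpDr// ler_norm.
  have [| | | | | |C hC] := @monotone_solution_decays R (fun r => s * phi lam r)
    (fun r => s * dphi lam r) (V lam) c k' k0.
  - rewrite /c; lra.
  - by move=> r; solve_deriv; ring.
  - by move=> r r0; solve_deriv; rewrite {2}/phi_prime; field; rewrite gt_eqF.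
  - move=> r cr; have := @V_large R tau lam k' r (ltW k0).
    move: cr; rewrite /c /b => cr H; suff : k' ^+ 2 + 1 <= V lam r by lra.
    by apply: H; move: cr; case: (leP a 0) => ? ?; lra.
  - by move=> r cr; apply/ltW/sp; move: cr; rewrite /c; lra.
  - by move=> r cr; apply: sd; move: cr; rewrite /c; lra.
  exists (`|C| / `|s|), (c + 1) => r cr; have [h1 h2] := hC r cr.
  have r0 : 0 <= r by move: cr; rewrite /c; lra.
  have ekk : C * expR (- (k' * r)) <= `|C| * expR (- (k * r)).
    apply: (@le_trans _ _ (`|C| * expR (- (k' * r)))).
      by apply: ler_wpM2r; [exact: expR_ge0 | exact: ler_norm].
    by apply: ler_wpM2l => //; rewrite ler_expR lerN2; apply: ler_wpM2r.
  have bound x : `|s * x| <= C * expR (- (k' * r)) -> `|x| <= `|C| / `|s| * expR (- (k * r)).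
    by move=> H; rewrite mulrAC ler_pdivlMr// mulrC -normrM (le_trans H).
  split; apply: bound.
    by rewrite gtr0_norm// sp//; move: cr; rewrite /c; lra.
  by rewrite ler0_norm// sd//; move: cr; rewrite /c; lra.
split; apply: decays_tail => [|k]; try exact: phi_continuous; try exact: phi_prime_continuous;
  by have [C [a' hC]] := tail k; exists C, a' => r /hC[].
Qed.

End Decaying.

(** * Shooting: the first threshold *)

Section Shooting.
Variable R : realType.
Variable tau : R.
Implicit Types (lam mu r a b : R).
Local Notation V := (potential tau).
Local Notation phi := (phi tau).
Local Notation sig := (sig tau).
Local Notation dphi := (phi_prime tau).
Local Notation decaying := (decaying tau).

(** Otherwise [(s phi' + 2 r s phi) r exp (- r^2)], which is nonincreasing far
    out, would stay below a negative constant, against the decay of [phi]. *)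
Lemma log_derivative_lb lam s a : decaying lam ->
  (forall r, a <= r -> 0 < s * phi lam r) ->
  exists b, forall r, b <= r -> - (2 * r) * (s * phi lam r) <= s * dphi lam r.
Proof.
move=> [dp dd] sp; exists (Num.max a 0 + `|tau| + `|lam| + 3) => r br.
have [ar Tr] : a <= r /\ `|tau| + `|lam| + 3 <= r.
  have := normr_ge0 tau; have := normr_ge0 lam.
  by move: br; case: (leP a 0) => *; split; lra.
have r0 : 0 < r by have := normr_ge0 tau; have := normr_ge0 lam; lra.
rewrite leNgt; apply/negP => hr.
pose p x := x * (s * dphi lam x + 2 * (x * (s * phi lam x))).
pose q x := p x * expR (- (x ^+ 2)).
pose dq x := expR (- (x ^+ 2)) * (x * (s * phi lam x) * (V lam x + 4 - 4 * x ^+ 2)).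
have hq x : has_deriv q x (dq x).
  by rewrite /q /p; solve_deriv; rewrite /dq /phi_prime /=; ring.
have q_mono x : r <= x -> q x <= q r.
  move=> rx; apply: (@has_deriv_le0_ge _ q dq) => // y yrx.
    exact: has_deriv_continuous (hq y).
  rewrite /dq; apply: mulr_ge0_le0; first exact: expR_ge0.
  apply: mulr_ge0_le0.
    by apply: mulr_ge0; [lra|apply/ltW/sp; lra].
  rewrite /potential.
  have : `|tau| + `|lam| + 3 <= y by lra.
  have := ler_norm tau; have := ler_norm (- tau); have := ler_norm (- lam).
  rewrite !normrN; have := normr_ge0 lam; have := normr_ge0 tau.
  move: `|tau| `|lam| => t l t0 l0 h1 h2 h3 h4.
  have : tau ^+ 2 <= t ^+ 2 by nra.
  have : - (tau * y) <= t * y by nra.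
  nra.
have pr : p r < 0.
  by rewrite /p pmulr_rlt0//; lra.
have qr : q r < 0 by rewrite /q pmulr_llt0// expR_gt0.
have dp' : decays p.
  apply: decaysX; apply: decaysD; first exact: decaysZ.
  by apply: decaysZ; apply: decaysX; exact: decaysZ.
have q0 : 0 < - q r by rewrite oppr_gt0.
have [x0 _ hx0] := decays_small dp' q0.
have := hx0 (Num.max x0 r); rewrite le_max lexx => /(_ isT).
have rx : r <= Num.max x0 r by rewrite le_max lexx orbT.
move: (Num.max x0 r) rx => x rx.
have := q_mono x rx.
have e1 : expR (- x ^+ 2) <= 1 by rewrite -expR0 ler_expR oppr_le0 sqr_ge0.
have e0 : 0 < expR (- x ^+ 2) := expR_gt0 _.
rewrite {1}/q ltr_norml opprK => h /andP[h1 _].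
nra.
Qed.

(** The number of zeros is expressed through signs, which are open conditions in
    the spectral parameter. *)
Definition takes_neg lam := exists2 r, 0 < r & phi lam r < 0.

Definition changes_twice lam :=
  exists a b, [/\ 0 < a, a < b, phi lam a < 0 & 0 < phi lam b].

Lemma changes_twice_neg lam : changes_twice lam -> takes_neg lam.
Proof. by move=> [a [b [a0 _ pa _]]]; exists a. Qed.

Lemma takes_neg_open lam : takes_neg lam ->
  exists2 del, 0 < del & forall mu, `|mu - lam| < del -> takes_neg mu.
Proof.
move=> [r r0 pr]; have [|del d0 hd] := solution_continuity tau lam r (_ : 0 < - phi lam r).
  by rewrite oppr_gt0.
exists del => // mu /hd/(_ r); rewrite lexx (ltW r0) => /(_ isT)[+ _].
by rewrite ltr_norml => /andP[_ h]; exists r => //; lra.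
Qed.

Lemma changes_twice_open lam : changes_twice lam ->
  exists2 del, 0 < del & forall mu, `|mu - lam| < del -> changes_twice mu.
Proof.
move=> [a [b [a0 ab pa pb]]].
have [|d1 d10 hd1] := solution_continuity tau lam b (_ : 0 < - phi lam a).
  by rewrite oppr_gt0.
have [d2 d20 hd2] := solution_continuity tau lam b pb.
exists (Num.min d1 d2); first by rewrite lt_min d10.
move=> mu; rewrite lt_min => /andP[/hd1/(_ a) h1 /hd2/(_ b) h2].
have [|+ _] := h1; first lra; have [|+ _] := h2; first lra.
by rewrite !ltr_norml => /andP[? ?] /andP[? ?]; exists a, b; split => //; lra.
Qed.

(** For [lam <= 0] the potential is nonnegative, so [phi^2] never decreases. *)
Lemma takes_neg_gt0 lam : takes_neg lam -> 0 < lam.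
Proof.
move=> [r r0 pr]; rewrite ltNge; apply/negP => lam0.
have Vp x : 0 <= V lam x by rewrite /potential; have := sqr_ge0 (x - tau); lra.
have [e e0 he] := phi_pos_near0 tau lam.
have [a [a0 ae /ltW ar _]] := exists_below e0 r0 r0.
have pa : 0 < phi lam a by apply: he; rewrite ae ltW.
have [||c cab pc] := @continuous_root R (phi lam) a r ar.
- exact: phi_continuous.
- by rewrite mulr_ge0_le0// ltW.
have fa : 0 <= flux tau lam a.
  have -> : 0 = flux tau lam 0 by rewrite /flux; ring.
  by apply: flux_le => //; exact: ltW.
have [ac _] := andP cab.
have := phi_sqr_le a0 ac fa (fun x _ => Vp x).
by rewrite pc expr0n/= leNgt exprn_gt0.
Qed.

(** A zero without change of sign would be a minimum, hence a double zero. *)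
Lemma not_neg_pos lam : ~ takes_neg lam -> forall r, 0 <= r -> 0 < phi lam r.
Proof.
move=> nneg r; rewrite le_eqVlt => /predU1P[<-|r0]; first by rewrite phi0.
have p0 x : 0 < x -> 0 <= phi lam x.
  by move=> x0; rewrite leNgt; apply/negP => px; apply: nneg; exists x.
rewrite lt_neqAle p0// andbT; apply/eqP => /esym pr.
apply: (no_double_zero r0 pr).
have rin : r \in `]0, r + 1[ by rewrite in_itv/= r0; lra.
have r1 : 0 < r + 1 by lra.
have [||+] := @derive1_at_min R (phi lam) 0 (r + 1) r (ltW r1) _ rin.
- by move=> t _; have [] := phi_deriv tau lam t.
- by move=> t; rewrite in_itv/= pr => /andP[t0 _]; exact: p0.
have [_ <-] := phi_deriv tau lam r; done.
Qed.

(** An open set does not contain its infimum, which is thus approached strictly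
    from above. *)
Lemma inf_of_open (P : R -> Prop) : (exists z, P z) -> (forall z, P z -> 0 < z) ->
  (forall z, P z -> exists2 del : R, 0 < del & forall y, `|y - z| < del -> P y) ->
  exists l, (forall z, P z -> l < z) /\
    (forall del, 0 < del -> exists z, [/\ P z, l < z & z < l + del]).
Proof.
move=> [z Pz] P0 Po.
have hP : has_inf [set x | P x].
  by split; [exists z | exists 0 => x /P0/ltW].
pose l := inf [set x | P x].
have lP x : P x -> l <= x by move=> Px; apply: ge_inf => //; case: hP.
have nl : ~ P l.
  move=> /Po[del d0 /(_ (l - del / 2))].
  have -> : l - del / 2 - l = - (del / 2) by ring.
  rewrite normrN gtr0_norm; last lra.
  by move=> H; have := lP _ (H _); lra.
have lP' x : P x -> l < x.
  move=> Px; rewrite lt_neqAle lP// andbT; apply/eqP => e; apply: nl.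
  by rewrite e.
exists l; split => // del d0.
have [x Px xl] := inf_adherent d0 hP.
by exists x; split => //; exact: lP'.
Qed.

(** The margin leaves room for a change of [lam] by 1 in [V_far]. *)
Definition far lam : R := `|tau| + `|lam| + 2.

Lemma far_gt0 lam : 0 < far lam.
Proof. by rewrite /far; have := normr_ge0 tau; have := normr_ge0 lam; lra. Qed.

Lemma V_far lam mu r : `|mu - lam| <= 1 -> far lam <= r -> 0 <= V mu r.
Proof.
move=> ml; rewrite /far => hr.
have : `|mu| <= `|lam| + 1.
  by rewrite -[mu](subrK lam) (le_trans (ler_normD _ _))// addrC lerD2l.
move=> h; have := @V_large R tau mu 0 r (lexx 0); rewrite expr0n add0r => H.
by apply: le_trans (H _); lra.
Qed.

Lemma not_decaying_grows lam a : ~ decaying lam ->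
  exists2 r, a <= r & 0 < phi lam r * dphi lam r.
Proof.
move=> nd; apply: contrapT => h; apply: nd; apply: (@not_growing_decaying _ _ _ a) => r ar.
by rewrite leNgt; apply/negP => pr; apply: h; exists r.
Qed.

(** Growth at one far point is an open condition which fixes the sign of all
    nearby solutions from that point on. *)
Lemma growth_stable lam b : far lam <= b -> 0 < phi lam b * dphi lam b ->
  exists2 del, 0 < del & forall mu, `|mu - lam| < del -> forall r, b <= r ->
    0 < phi lam b * phi mu r.
Proof.
move=> fb pb; have b0 : 0 < b := lt_le_trans (far_gt0 lam) fb.
have pn : 0 < `|phi lam b|.
  by rewrite normr_gt0; apply/eqP => e; move: pb; rewrite e mul0r ltxx.
have dn : 0 < `|dphi lam b|.
  by rewrite normr_gt0; apply/eqP => e; move: pb; rewrite e mulr0 ltxx.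
have [|del d0 hd] := solution_continuity tau lam b (_ : 0 < Num.min `|phi lam b| `|dphi lam b|).
  by rewrite lt_min pn.
exists (Num.min del 1); first by rewrite lt_min d0 ltr01.
move=> mu; rewrite lt_min => /andP[md m1] r br.
have [|] := hd mu md b; first by rewrite lexx ltW.
rewrite !lt_min => /andP[h1 _] /andP[_ h2].
have e1 : 0 < phi lam b * phi mu b.
  have := pn; move: h1; case: (ltgtP (phi lam b) 0) => h.
  - by rewrite (ltr0_norm h) ltr_norml => /andP[? ?] _; nra.
  - by rewrite (gtr0_norm h) ltr_norml => /andP[? ?] _; nra.
  - by rewrite h normr0 ltxx.
have e2 : 0 < dphi lam b * dphi mu b.
  have := dn; move: h2; case: (ltgtP (dphi lam b) 0) => h.
  - by rewrite (ltr0_norm h) ltr_norml => /andP[? ?] _; nra.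
  - by rewrite (gtr0_norm h) ltr_norml => /andP[? ?] _; nra.
  - by rewrite h normr0 ltxx.
have e3 : 0 < phi mu b * dphi mu b.
  have : 0 < (phi lam b * phi mu b) * (dphi lam b * dphi mu b) by rewrite mulr_gt0.
  have -> : (phi lam b * phi mu b) * (dphi lam b * dphi mu b) =
    (phi lam b * dphi lam b) * (phi mu b * dphi mu b) by ring.
  by rewrite pmulr_rgt0.
have e4 : 0 < phi mu b * phi mu r.
  apply: growth_no_zero e3 => // x xbr; apply: (@V_far lam); [exact: ltW|lra].
have : 0 < (phi lam b * phi mu b) * (phi mu b * phi mu r) by rewrite mulr_gt0.
have -> : (phi lam b * phi mu b) * (phi mu b * phi mu r) =
  phi mu b ^+ 2 * (phi lam b * phi mu r) by ring.
rewrite pmulr_rgt0// exprn_even_gt0//=.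
by apply/eqP => e; move: e1; rewrite e mulr0 ltxx.
Qed.

(** At the infimum [l] the solution is positive. If it did not decay it would grow,
    and the solutions for nearby parameters would be positive as well: up to the
    point of growth by continuity, beyond it by [growth_stable]. *)
Lemma first_threshold z : takes_neg z ->
  exists2 l, l < z & decaying l /\ ~ takes_neg l.
Proof.
move=> zn; have [|||l [lP lim]] := @inf_of_open takes_neg.
- by exists z.
- exact: takes_neg_gt0.
- exact: takes_neg_open.
exists l; first exact: lP.
have nl : ~ takes_neg l by move=> /lP; rewrite ltxx.
split => //; apply: contrapT => /(@not_decaying_grows l (far l))[b fb pb].
have pos := not_neg_pos nl.
have b0 : 0 < b := lt_le_trans (far_gt0 l) fb.
have pb0 : 0 < phi l b by apply: pos; exact: ltW.
have [d1 d10 h1] := growth_stable fb pb.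
have [||c c0 hc] := @continuous_pos_lb R (phi l) 0 b (ltW b0).
- exact: phi_continuous.
- by move=> x /andP[x0 _]; exact: pos.
have [d2 d20 h2] := solution_continuity tau l b c0.
have [|mu [[r r0 pr] lm ml]] := lim (Num.min d1 d2); first by rewrite lt_min d10.
have : `|mu - l| < Num.min d1 d2 by rewrite gtr0_norm; lra.
rewrite lt_min => /andP[m1 m2].
have [br|rb] := leP b r.
  by have := h1 mu m1 r br; rewrite pmulr_rgt0//; lra.
have rb' : 0 <= r <= b by rewrite !ltW.
have [+ _] := h2 mu m2 r rb'; rewrite ltr_norml => /andP[? _].
by have := hc r rb'; lra.
Qed.

End Shooting.

(** * Shooting: the second threshold *)

Section SecondThreshold.
Variable R : realType.
Variable tau : R.
Implicit Types (lam mu r a b : R).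
Local Notation V := (potential tau).
Local Notation phi := (phi tau).
Local Notation sig := (sig tau).
Local Notation dphi := (phi_prime tau).
Local Notation decaying := (decaying tau).
Local Notation takes_neg := (takes_neg tau).
Local Notation changes_twice := (changes_twice tau).
Local Notation far := (far tau).

(** Such a zero would be an extremum of [phi], hence a double zero. *)
Lemma no_touching_zero lam (s a b c : R) : 0 <= a -> a < c -> c < b -> s != 0 ->
  (forall t, a < t < b -> 0 <= s * phi lam t) -> phi lam c = 0 -> False.
Proof.
move=> a0 ac cb s0 hs pc; have c0 : 0 < c by lra.
apply: (no_double_zero c0 pc).
have cin : c \in `]a, b[ by rewrite in_itv/= ac cb.
have hd t : has_deriv (fun x => s * phi lam x) t (s * dphi lam t) by solve_deriv; ring.
have ab : a <= b by lra.
have [||+] := @derive1_at_min R (fun x => s * phi lam x) a b c ab _ cin.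
- by move=> t _; have [] := hd t.
- by move=> t; rewrite in_itv/= pc mulr0; exact: hs.
by have [_ ->] := hd c => _ /eqP; rewrite mulf_eq0 (negPf s0) => /eqP.
Qed.

Definition changes_once lam z :=
  [/\ 0 < z, phi lam z = 0, forall r, 0 <= r < z -> 0 < phi lam r &
      forall r, z < r -> phi lam r < 0].

Lemma changes_onceP lam : takes_neg lam -> ~ changes_twice lam ->
  exists z, changes_once lam z.
Proof.
move=> [r r0 pr] nt.
have nt' a b : 0 < a -> a < b -> phi lam a < 0 -> phi lam b <= 0.
  by move=> a0 ab pa; rewrite leNgt; apply/negP => pb; apply: nt; exists a, b.
have [||z zr pz] := @continuous_root R (phi lam) 0 r (ltW r0).
- exact: phi_continuous.
- by rewrite phi0 mul1r ltW.
have z0 : 0 < z.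
  rewrite lt_neqAle (andP zr).1 andbT; apply/eqP => e.
  by move: pz; rewrite -e phi0 => /eqP; rewrite oner_eq0.
have h1 x : 0 < x < z -> 0 <= phi lam x.
  move=> /andP[x0 xz]; rewrite leNgt; apply/negP => px.
  apply: (@no_touching_zero lam (-1) x (z + 1) z) => //; [exact: ltW|lra|].
  by move=> t /andP[xt _]; rewrite mulN1r oppr_ge0 (nt' x).
exists z; split => //.
- move=> x /andP[]; rewrite le_eqVlt => /predU1P[<- _|x0 xz]; first by rewrite phi0.
  rewrite lt_neqAle h1 ?x0// andbT; apply/eqP => /esym px.
  apply: (@no_touching_zero lam 1 0 z x) => // t tz.
  by rewrite mul1r h1.
have h2 y : z < y -> phi lam y <= 0.
  move=> zy; rewrite leNgt; apply/negP => py.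
  apply: (@no_touching_zero lam 1 0 y z) => // t /andP[t0 ty]; rewrite mul1r.
  have [tz|zt|->] := ltgtP t z; last by rewrite pz.
    by apply: h1; rewrite t0.
  rewrite leNgt; apply/negP => pt.
  by have := nt' t y t0 ty pt; rewrite leNgt py.
move=> y zy; rewrite lt_neqAle h2// andbT; apply/eqP => py.
apply: (@no_touching_zero lam (-1) z (y + 1) y) => //; [exact: ltW|lra|].
by move=> t /andP[zt _]; rewrite mulN1r oppr_ge0 h2.
Qed.

Lemma changes_once_slope lam z : changes_once lam z -> dphi lam z < 0.
Proof.
move=> [z0 pz pl pr]; rewrite lt_neqAle; apply/andP; split.
  by apply/eqP => dz; exact: (no_double_zero z0 pz dz).
rewrite leNgt; apply/negP => dz.
have [e e0 he] := continuous_pos_near (@phi_prime_continuous R tau lam z) dz.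
have [d [d0 de dz' _]] := exists_below e0 z0 z0.
pose a := z - d.
have [a0 [az ae]] : 0 < a /\ a < z /\ z - a < e.
  by rewrite /a; split; [lra|split; lra].
have : phi lam a <= phi lam z.
  apply: (@has_deriv_ge0_le _ (phi lam) (dphi lam)); first exact: ltW.
  - by move=> x _; exact: phi_continuous.
  - by move=> x _; exact: phi_deriv.
  - by move=> x xa; apply/ltW/he; rewrite ler0_norm; lra.
by rewrite pz leNgt pl// az ltW.
Qed.

(** Just above a parameter whose solution is positive, a second change of sign
    would give two zeros in the far region. *)
Lemma positive_not_limit l : ~ takes_neg l ->
  exists2 del, 0 < del & forall mu, `|mu - l| < del -> ~ changes_twice mu.
Proof.
move=> nn; have pos := not_neg_pos nn.
have f0 := far_gt0 tau l.
have [||c c0 hc] := @continuous_pos_lb R (phi l) 0 (far l) (ltW f0).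
- exact: phi_continuous.
- by move=> x /andP[x0 _]; exact: pos.
have [d d0 hd] := solution_continuity tau l (far l) c0.
exists (Num.min d 1); first by rewrite lt_min d0 ltr01.
move=> mu; rewrite lt_min => /andP[md m1] [a [b [a0 ab pa pb]]].
have pf x : 0 <= x <= far l -> 0 < phi mu x.
  move=> xf; have [+ _] := hd mu md x xf; have := hc x xf.
  by rewrite ltr_norml => ? /andP[? _]; lra.
have fa : far l < a.
  rewrite ltNge; apply/negP => af; have := pf a; rewrite af ltW// => /(_ isT).
  by move=> /(lt_trans pa); rewrite ltxx.
have pff : 0 < phi mu (far l) by apply: pf; rewrite lexx ltW.
have [||c1 hc1 pc1] := @continuous_root R (phi mu) (far l) a (ltW fa).
- exact: phi_continuous.
- by rewrite mulr_ge0_le0// ltW.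
have [||c2 hc2 pc2] := @continuous_root R (phi mu) a b (ltW ab).
- exact: phi_continuous.
- by rewrite mulr_le0_ge0// ltW.
have c1a : c1 < a.
  rewrite lt_neqAle (andP hc1).2 andbT; apply/eqP => e.
  by move: pa; rewrite -e pc1 ltxx.
apply: (@one_zero R tau mu c1 c2) => //; [lra|lra|].
by move=> x hx; apply: (@V_far R tau l); [exact: ltW|lra].
Qed.

(** Three pieces of the solution are stable under a small C1 change: it is positive
    up to near [z], decreasing around [z], and negative from there to a point of
    growth, which fixes the sign beyond. *)
Lemma growing_not_limit l z : changes_once l z -> ~ decaying l ->
  exists2 del, 0 < del & forall mu, `|mu - l| < del -> ~ changes_twice mu.
Proof.
move=> hz nd; have [z0 pz pl pr] := hz; have dz := changes_once_slope hz.
have [b + pb] := @not_decaying_grows R tau l (Num.max (far l) (z + 1)) nd.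
rewrite ge_max => /andP[fb zb].
have b0 : 0 < b := lt_le_trans (far_gt0 tau l) fb.
have pb0 : phi l b < 0 by apply: pr; lra.
have [d1 d10 h1] := growth_stable fb pb.
have ndc : continuous (fun x => - dphi l x).
  by move=> x; apply: continuousN; exact: phi_prime_continuous.
have [|e e0 he] := continuous_pos_near (ndc z) _; first by rewrite oppr_gt0.
have [d [d0 dz' de d1']] := exists_below z0 e0 (@ltr01 R).
have [|||c1 c10 hc1] := @continuous_pos_lb R (fun x => - dphi l x) (z - d) (z + d).
- lra.
- exact: ndc.
- by move=> x hx; apply: he; rewrite ltr_norml; lra.
have [|||c2 c20 hc2] := @continuous_pos_lb R (phi l) 0 (z - d).
- lra.
- exact: phi_continuous.
- by move=> x hx; apply: pl; lra.
have [|||c3 c30 hc3] := @continuous_pos_lb R (fun x => - phi l x) (z + d) b.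
- lra.
- by move=> x; apply: continuousN; exact: phi_continuous.
- by move=> x hx; rewrite oppr_gt0; apply: pr; lra.
have [|d2 d20 hd2] := solution_continuity tau l b (_ : 0 < Num.min c1 (Num.min c2 c3)).
  by rewrite !lt_min c10 c20.
exists (Num.min d1 d2); first by rewrite lt_min d10.
move=> mu; rewrite lt_min => /andP[m1 m2] [a [b' [a0 ab' pa pb']]].
have b'b : b' < b.
  rewrite ltNge; apply/negP => bb'; have := h1 mu m1 b' bb'.
  by rewrite nmulr_rgt0//; lra.
have close x : 0 <= x <= b -> [/\ `|phi mu x - phi l x| < c2,
   `|phi mu x - phi l x| < c3 & `|dphi mu x - dphi l x| < c1].
  by move=> hx; have [] := hd2 mu m2 x hx; rewrite !lt_min => /and3P[? ? ?] /and3P[].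
have az : z - d < a.
  rewrite ltNge; apply/negP => h; have [|+ _ _] := close a; first lra.
  by rewrite ltr_norml => /andP[? ?]; have := hc2 a; lra.
have bz : b' < z + d.
  rewrite ltNge; apply/negP => h; have [|_ + _] := close b'; first lra.
  by rewrite ltr_norml => /andP[? ?]; have := hc3 b'; lra.
have : phi mu b' <= phi mu a; last by lra.
apply: (@has_deriv_le0_ge _ (phi mu) (dphi mu)); first exact: ltW.
- by move=> x _; exact: phi_continuous.
- by move=> x _; exact: phi_deriv.
- move=> x hx; have [|_ _ +] := close x; first lra.
  by rewrite ltr_norml => /andP[? ?]; have := hc1 x; lra.
Qed.

(** By definition of the infimum [l], parameters arbitrarily close to [l] have
    solutions changing sign twice. This excludes that the solution for [l] is
    positive, and that it changes sign once and grows. *)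
Lemma second_threshold z : changes_twice z ->
  exists2 l, l < z & decaying l /\ takes_neg l.
Proof.
move=> zn; have [|||l [lP lim]] := @inf_of_open R changes_twice.
- by exists z.
- by move=> x /changes_twice_neg/takes_neg_gt0.
- exact: changes_twice_open.
exists l; first exact: lP.
have nl : ~ changes_twice l by move=> /lP; rewrite ltxx.
have far_away : ~ exists2 del, 0 < del & forall mu, `|mu - l| < del -> ~ changes_twice mu.
  move=> [d d0 hd]; have [x [Px lx xl]] := lim _ d0.
  by apply: (hd x) => //; rewrite gtr0_norm; lra.
have tn : takes_neg l.
  by apply: contrapT => /positive_not_limit.
split => //; apply: contrapT => nd.
have [y hy] := changes_onceP tn nl.
by apply: far_away; exact: growing_not_limit hy nd.
Qed.

Lemma wronskian_deriv l1 l2 r :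
  has_deriv (fun x => x * (dphi l1 x * phi l2 x - phi l1 x * dphi l2 x)) r
    ((l2 - l1) * (r * (phi l1 r * phi l2 r))).
Proof. by solve_deriv; rewrite /phi_prime /potential; ring. Qed.

(** Otherwise both solutions are positive, and their Wronskian, weighted by [r],
    increases strictly from 0 at the origin to 0 at infinity. *)
Lemma positive_decaying_unique l1 l2 : l1 < l2 -> decaying l1 -> decaying l2 ->
  ~ takes_neg l1 -> takes_neg l2.
Proof.
move=> l12 [p1 d1] [p2 d2] n1; apply: contrapT => n2.
have pos1 := not_neg_pos n1; have pos2 := not_neg_pos n2.
pose W x := x * (dphi l1 x * phi l2 x - phi l1 x * dphi l2 x).
have hW x : has_deriv W x ((l2 - l1) * (x * (phi l1 x * phi l2 x))).
  exact: wronskian_deriv.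
have Wc x : {for x, continuous W} := has_deriv_continuous (hW x).
have [|c c01] := @MVT R W _ 0 1 ltr01 (fun x _ => hW x).
  by apply: continuous_within => x _; exact: Wc.
rewrite in_itv/= in c01.
have W0 : W 0 = 0 by rewrite /W mul0r.
have c0 : 0 < c by lra.
have W1 : 0 < W 1 -> False.
  move=> W1; have dW : decays W.
    by apply: decaysX; apply: decaysB; exact: decaysM.
  have [a _ ha] := decays_small dW W1.
  have := ha (Num.max a 1); rewrite le_max lexx => /(_ isT).
  have h1 : 1 <= Num.max a 1 by rewrite le_max lexx orbT.
  move: (Num.max a 1) h1 => y h1.
  have : W 1 <= W y.
    apply: (@has_deriv_ge0_le _ W (fun x => (l2 - l1) * (x * (phi l1 x * phi l2 x))))
      => // x xy.
    have x0 : 0 <= x by lra.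
    by rewrite !mulr_ge0 ?subr_ge0 ?(ltW l12)// ltW// ?pos1 ?pos2.
  by rewrite ltr_norml => ? /andP[]; lra.
rewrite W0 !subr0 mulr1 => e; apply: W1; rewrite e.
by rewrite !mulr_gt0 ?subr_gt0 ?pos1 ?pos2 ?ltW.
Qed.

(** A negative value for [z1] would give a decaying parameter below [z1] by
    [first_threshold]. Two changes of sign for [z2] would give one below [z2] by
    [second_threshold], whose solution takes negative values, so it is not [z1]. *)
Lemma first_two_shapes z1 z2 : z1 < z2 -> decaying z1 -> decaying z2 ->
  (forall l, decaying l -> l <= z2 -> l = z1 \/ l = z2) ->
  ~ takes_neg z1 /\ exists z, changes_once z2 z.
Proof.
move=> z12 d1 d2 only.
have n1 : ~ takes_neg z1.
  move=> /first_threshold[l lz [dl _]]; have [||] := only l dl; lra.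
split => //; apply: changes_onceP.
  exact: positive_decaying_unique z12 d1 d2 n1.
move=> /second_threshold[l lz [dl nl]]; have [||e] := only l dl; [lra| |lra].
by move=> e; apply: n1; rewrite -e.
Qed.

End SecondThreshold.

(** * Integrals over the half-line *)

Section Primitive.
Variable R : realType.
Local Notation mu := (@lebesgue_measure R).
Implicit Types (f g F : R -> R).

Lemma continuous_integrable f a b : (forall x, a <= x <= b -> {for x, continuous f}) ->
  mu.-integrable `[a, b] (EFin \o f).
Proof.
move=> fc; apply: continuous_compact_integrable; first exact: segment_compact.
exact: continuous_within.
Qed.

(** The base point is kept below the interval of interest so that the derivative
    is two-sided at its left end too. *)
Lemma primitive_exists f a c : a < c -> (forall x, a <= x -> {for x, continuous f}) ->
  exists2 F, F c = 0 & forall x, a < x -> has_deriv F x (f x).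
Proof.
move=> ac fc; pose G x := \int[mu]_(t in `[a, x]) f t.
exists (fun x => G x + - G c); first by rewrite subrr.
move=> x ax.
have xx1 : x < x + 1 by rewrite ltrDl.
have fi : mu.-integrable `[a, x + 1] (EFin \o f).
  by apply: continuous_integrable => y /andP[ay _]; exact: fc.
have [dG eG] := continuous_FTC1_closed xx1 fi ax (fc x (ltW ax)).
have hG : has_deriv G x (f x).
  by rewrite -eG derive1E; exact/derivableP.
by solve_deriv; rewrite addr0.
Qed.

End Primitive.

Section HalfLineIntegral.
Variable R : realType.
Implicit Types (f g F G : R -> R) (l m : R).

(** The integral over the half-line, as the limit at infinity of a primitive. The
    integrands of the spectral argument are continuous and decay, so this elementary
    notion suffices, and by linearity an identity between integrals reduces to a
    polynomial identity between integrands. *)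
Definition integral_is f l := exists F, [/\ F 0 = 0,
  forall x, 0 <= x -> has_deriv F x (f x) &
  forall e, 0 < e -> exists a, forall x, a <= x -> `|F x - l| < e].

Lemma integral_is_ext f g l : (forall x, 0 <= x -> f x = g x) ->
  integral_is f l -> integral_is g l.
Proof. by move=> fg [F [F0 dF lF]]; exists F; split => // x x0; rewrite -fg//; exact: dF. Qed.

Lemma integral_is_lin f g l m (k : R) : integral_is f l -> integral_is g m ->
  integral_is (fun x => k * f x + g x) (k * l + m).
Proof.
move=> [F [F0 dF lF]] [G [G0 dG lG]]; exists (fun x => k * F x + G x); split.
- by rewrite F0 G0; ring.
- by move=> x x0; have h1 := dF x x0; have h2 := dG x x0; solve_deriv; ring.
move=> e e0; have k0 : 0 < `|k| + 1 by rewrite ltr_wpDl.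
have [|a ha] := lF (e / 2 / (`|k| + 1)); first by rewrite !divr_gt0.
have [|b hb] := lG (e / 2); first by rewrite divr_gt0.
exists (Num.max a b) => x; rewrite ge_max => /andP[ax bx].
rewrite (_ : _ - _ = k * (F x - l) + (G x - m)); last by ring.
rewrite (le_lt_trans (ler_normD _ _))// normrM.
have := hb x bx; have := ha x ax; rewrite ltr_pdivlMr//.
have := normr_ge0 (F x - l); have := normr_ge0 k.
by move: `|k| `|F x - l| `|G x - m| => *; nra.
Qed.

Lemma integral_is_ge0 f l : (forall x, 0 <= x -> 0 <= f x) -> integral_is f l -> 0 <= l.
Proof.
move=> f0 [F [F0 dF lF]]; rewrite leNgt; apply/negP => ll.
have [|a ha] := lF (- l); first by rewrite oppr_gt0.
have := ha (Num.max a 0); rewrite le_max lexx => /(_ isT).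
have : 0 <= Num.max a 0 by rewrite le_max lexx orbT.
move: (Num.max a 0) => x x0.
have : F 0 <= F x.
  apply: (@has_deriv_ge0_le _ F f) => // [y|y|y] /andP[y0 yx].
  - exact: has_deriv_continuous (dF y y0).
  - by apply: dF; exact: ltW.
  - by apply: f0; exact: ltW.
by rewrite F0 ltr_norml => ? /andP[? ?]; lra.
Qed.

Lemma integral_is0 : integral_is (fun=> 0 : R) 0.
Proof.
exists (fun=> 0); split => // [x _|e e0]; first exact: has_deriv_cst.
by exists 0 => x _; rewrite subrr normr0.
Qed.

Lemma integral_is_uniq f l m : integral_is f l -> integral_is f m -> l = m.
Proof.
move=> hl hm.
have h (k : R) : 0 <= k * l + (- k * m + 0).
  apply: integral_is_ge0 (integral_is_lin k hl (integral_is_lin (- k) hm integral_is0)).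
  by move=> x _; rewrite le_eqVlt; apply/orP; left; apply/eqP; ring.
by have := h 1; have := h (-1); lra.
Qed.

Lemma integral_is_gt0 f l (e : R) : 0 < e -> (forall x, 0 <= x -> 0 <= f x) ->
  (forall x, 0 < x < e -> 0 < f x) -> integral_is f l -> 0 < l.
Proof.
move=> e0 f0 fp hl; have [F [F0 dF lF]] := hl.
have [||c c01] := @MVT R F f 0 e e0.
- by move=> x; rewrite in_itv/= => /andP[/ltW x0 _]; exact: dF.
- by apply: continuous_within => x /andP[x0 _]; exact: has_deriv_continuous (dF x x0).
rewrite in_itv/= in c01; rewrite F0 !subr0 => eF.
have Fe : 0 < F e by rewrite eF mulr_gt0// fp.
have [a ha] := lF (F e) Fe.
have := ha (Num.max a e); rewrite le_max lexx => /(_ isT).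
have : e <= Num.max a e by rewrite le_max lexx orbT.
move: (Num.max a e) => x x1.
have : F e <= F x.
  apply: (@has_deriv_ge0_le _ F f) => // y hy.
  - by apply: has_deriv_continuous (dF y _); lra.
  - by apply: dF; lra.
  - by apply: f0; lra.
by rewrite ltr_norml => ? /andP[? ?]; lra.
Qed.

Lemma integral_is_derivative F f : decays F ->
  (forall x, 0 <= x -> has_deriv F x (f x)) -> integral_is f (- F 0).
Proof.
move=> dF hF; exists (fun x => F x + - F 0); split.
- exact: subrr.
- by move=> x x0; have h := hF x x0; solve_deriv; rewrite addr0.
move=> e e0; have [a _ ha] := decays_small dF e0; exists a => x ax.
by rewrite addrK ha.
Qed.

(** If [|f| <= C exp (- x)] and [F] is a primitive of [f], then [F - C exp (- x)] is
    nondecreasing and bounded. *)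
Lemma integral_is_exists f : continuous f -> decays f -> exists l, integral_is f l.
Proof.
move=> fc df; have [C hC] := df 1.
have C0 : 0 <= C.
  by have := le_trans (normr_ge0 _) (hC 0 (lexx 0)); rewrite mulr0 oppr0 expR0 mulr1.
have [||F F0 dF] := @primitive_exists R f (-1) 0; [lra|by move=> x _; exact: fc|].
have dF0 x : 0 <= x -> has_deriv F x (f x) by move=> x0; apply: dF; lra.
pose G x := F x - C * expR (- x).
have dG x : 0 <= x -> has_deriv G x (f x + C * expR (- x)).
  by move=> x0; have h := dF0 x x0; rewrite /G; solve_deriv; ring.
have fC x : 0 <= x -> - (C * expR (- x)) <= f x <= C * expR (- x).
  by move=> x0; have := hC x x0; rewrite mul1r ler_norml.
have G_mono x y : 0 <= x -> x <= y -> G x <= G y.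
  move=> x0 xy; apply: (@has_deriv_ge0_le _ G _ _ _ xy) => z hz; last first.
  - by have := fC z; instantiate (1 := fun x => f x + C * expR (- x)); cbv beta; lra.
  - by apply: dG; lra.
  - by apply: has_deriv_continuous (dG z _); lra.
have G_le x : 0 <= x -> G x <= C.
  move=> x0; have dH y : 0 <= y -> has_deriv (fun y => F y + C * expR (- y)) y (f y - C * expR (- y)).
    by move=> y0; have h := dF0 y y0; solve_deriv; ring.
  have : F x + C * expR (- x) <= F 0 + C * expR (- 0).
    apply: (@has_deriv_le0_ge _ (fun y => F y + C * expR (- y)) (fun y => f y - C * expR (- y)) _ _ x0) => z hz.
    - by apply: has_deriv_continuous (dH z _); lra.
    - by apply: dH; lra.
    - by have := fC z; lra.
  have : 0 <= C * expR (- x) by rewrite mulr_ge0 ?expR_ge0.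
  by rewrite F0 oppr0 expR0 /G; lra.
pose S := [set y | exists2 x, 0 <= x & y = G x].
have hS : has_sup S.
  by split; [exists (G 0), 0 | exists C => _ [x x0 ->]; exact: G_le].
exists (sup S), F; split => // e e0.
have e2 : 0 < e / 2 by rewrite divr_gt0.
have [_ [x0 x00 ->] hx0] := sup_adherent e2 hS.
exists (Num.max x0 (C / (e / 2))) => x; rewrite ge_max => /andP[xx cx].
have xp : 0 <= x by lra.
have h1 : G x0 <= G x by exact: G_mono.
have h2 : G x <= sup S by apply: ub_le_sup; [case: hS|exists x].
have h3 : C * expR (- x) < e / 2.
  rewrite expRN ltr_pdivrMr ?expR_gt0//.
  move: cx; rewrite ler_pdivrMr// => cx; apply: (le_lt_trans cx); rewrite mulrC ltr_pM2l//.
  by apply: lt_le_trans (expR_ge1Dx x); rewrite ltrDr.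
have h4 : 0 <= C * expR (- x) by rewrite mulr_ge0 ?expR_ge0.
move: h1 h2; rewrite {2 3}/G => h1 h2.
by rewrite ltr_norml; lra.
Qed.

End HalfLineIntegral.

(** * Stability of decay under products *)

Section Tame.
Variable R : realType.
Implicit Types (f g p q : R -> R).

(** The multipliers of decaying functions: polynomials, and the decaying functions
    themselves. *)
Definition tame p := forall f, decays f -> decays (fun r => p r * f r).

Lemma tame_cst (k : R) : tame (fun=> k).
Proof. by move=> f df; exact: decaysZ. Qed.

Lemma tame_id : tame (fun x => x).
Proof. by move=> f df; exact: decaysX. Qed.

Lemma tame_decays p : decays p -> tame p.
Proof. by move=> dp f df; exact: decaysM. Qed.

Lemma tameD p q : tame p -> tame q -> tame (fun x => p x + q x).
Proof.
move=> tp tq f df; apply: decays_ext (decaysD (tp f df) (tq f df)) => r _.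
by rewrite mulrDl.
Qed.

Lemma tameM p q : tame p -> tame q -> tame (fun x => p x * q x).
Proof.
move=> tp tq f df; apply: decays_ext (tp _ (tq f df)) => r _.
by rewrite mulrA.
Qed.

Lemma tameN p : tame p -> tame (fun x => - p x).
Proof.
move=> tp f df; apply: decays_ext (decaysZ (-1) (tp f df)) => r _.
by rewrite mulN1r mulNr.
Qed.

Lemma tame_sqr p : tame p -> tame (fun x => p x ^+ 2).
Proof. by move=> tp; under eq_fun do rewrite expr2; exact: tameM. Qed.

Lemma decaysN f : decays f -> decays (fun x => - f x).
Proof. by move=> df; apply: decays_ext (decaysZ (-1) df) => r _; rewrite mulN1r. Qed.

Lemma decays_tame_l p f : tame p -> decays f -> decays (fun r => p r * f r).
Proof. by move=> tp; exact: tp. Qed.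

Lemma decays_tame_r p f : decays f -> tame p -> decays (fun r => f r * p r).
Proof. by move=> df tp; apply: decays_ext (tp f df) => r _; rewrite mulrC. Qed.

Lemma decays_sqr f : decays f -> decays (fun r => f r ^+ 2).
Proof. by move=> df; under eq_fun do rewrite expr2; exact: decaysM. Qed.

Lemma continuous_cst (k : R) : continuous (fun _ : R => k).
Proof. by move=> x; exact: cst_continuous. Qed.

Lemma continuous_idfun : continuous (fun x : R => x).
Proof. by move=> x; exact. Qed.

Lemma continuousfD f g : continuous f -> continuous g -> continuous (fun x => f x + g x).
Proof. by move=> cf cg x; apply: continuousD; [exact: cf|exact: cg]. Qed.

Lemma continuousfM f g : continuous f -> continuous g -> continuous (fun x => f x * g x).
Proof. by move=> cf cg x; apply: continuousM; [exact: cf|exact: cg]. Qed.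

Lemma continuousfN f : continuous f -> continuous (fun x => - f x).
Proof. by move=> cf x; apply: continuousN; exact: cf. Qed.

Lemma continuousf_sqr f : continuous f -> continuous (fun x => f x ^+ 2).
Proof. by move=> cf; under eq_fun do rewrite expr2; exact: continuousfM. Qed.

End Tame.

Ltac solve_cont := cbv beta; match goal with
  | H : continuous ?f |- continuous ?f => exact H
  | |- continuous (fun x => x) => exact: continuous_idfun
  | |- continuous (fun _ => ?k) => exact: continuous_cst
  | |- continuous (fun r => @?f r + @?g r) => apply: (@continuousfD _ f g); solve_cont
  | |- continuous (fun r => - @?f r) => apply: (@continuousfN _ f); solve_cont
  | |- continuous (fun r => @?f r ^+ 2) => apply: (@continuousf_sqr _ f); solve_cont
  | |- continuous (fun r => @?f r * @?g r) => apply: (@continuousfM _ f g); solve_cont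
  | |- continuous (fun r => ?f r) => change (continuous f); solve_cont
  | |- continuous (phi _ _) => exact: phi_continuous
  | |- continuous (phi_prime _ _) => exact: phi_prime_continuous
  end.

Ltac solve_tame := cbv beta; match goal with
  | H : decays ?f |- tame ?f => exact (tame_decays H)
  | |- tame (fun x => x) => exact: tame_id
  | |- tame (fun _ => ?k) => exact: tame_cst
  | |- tame (fun r => @?f r + @?g r) => apply: (@tameD _ f g); solve_tame
  | |- tame (fun r => - @?f r) => apply: (@tameN _ f); solve_tame
  | |- tame (fun r => @?f r ^+ 2) => apply: (@tame_sqr _ f); solve_tame
  | |- tame (fun r => @?f r * @?g r) => apply: (@tameM _ f g); solve_tame
  | |- tame (fun r => ?f r) => change (tame f); solve_tame
  end.

Ltac solve_decays := cbv beta; match goal with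
  | H : decays ?f |- decays ?f => exact H
  | |- decays (fun r => @?f r + @?g r) => apply: (@decaysD _ f g); solve_decays
  | |- decays (fun r => - @?f r) => apply: (@decaysN _ f); solve_decays
  | |- decays (fun r => @?f r ^+ 2) => apply: (@decays_sqr _ f); solve_decays
  | |- decays (fun r => @?f r * @?g r) => first
      [ solve [apply: (@decays_tame_l _ f g); [solve_tame | solve_decays]]
      | solve [apply: (@decays_tame_r _ g f); [solve_decays | solve_tame]] ]
  | |- decays (fun r => ?f r) => change (decays f); solve_decays
  end.

(** * The spectral gap *)

Section Gap.
Variable R : realType.
Variable tau : R.
Implicit Types (lam mu r a b : R).
Local Notation V := (potential tau).
Local Notation phi := (phi tau).
Local Notation sig := (sig tau).
Local Notation dphi := (phi_prime tau).
Local Notation decaying := (decaying tau).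
Local Notation changes_once := (changes_once tau).

Section Jacobi.
Variables (lam z : R) (g dg : R -> R).
Hypotheses (dec_lam : decaying lam) (hz : changes_once lam z)
  (hg : forall r, has_deriv g r (dg r)) (dgc : continuous dg)
  (decg : decays g) (gz : g z = 0).
Local Notation w := (phi lam).
Local Notation dw := (dphi lam).

(** The boundary term of Jacobi's identity, singular at the zero [z] of [w]. *)
Definition boundary x := x * (g x ^+ 2 * (dw x / w x)).

Definition boundary_prime x := x * (V lam x * g x ^+ 2)
  + 2 * x * (g x * dg x) * (dw x / w x) - x * (g x ^+ 2 * (dw x / w x) ^+ 2).

Lemma off_zero x : 0 <= x -> x != z -> w x != 0.
Proof.
have [_ _ wl wr] := hz => x0; rewrite neq_lt => /orP[xz|zx].
  by rewrite gt_eqF// wl// x0.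
by rewrite lt_eqF// wr.
Qed.

Lemma boundary_deriv x : 0 <= x -> x != z -> has_deriv boundary x (boundary_prime x).
Proof.
move=> x0 xz; have wx := off_zero x0 xz; have h := hg x.
rewrite /boundary; solve_deriv; first exact: wx.
rewrite /boundary_prime /phi_prime /=; field; exact: wx.
Qed.

(** [g] vanishes at [z] while the zero of [w] is simple, so [g^2 w' / w] is of the
    order of [x - z]. *)
Lemma boundary_near_zero : exists K d, [/\ 0 <= K, 0 < d & forall x, 0 <= x -> x != z ->
  `|x - z| <= d -> `|boundary x| <= K * `|x - z|].
Proof.
have [z0 wz _ _] := hz; have slope := changes_once_slope hz.
pose c := - dw z / 2; have c0 : 0 < c by rewrite /c; lra.
have dwc : continuous dw by exact: phi_prime_continuous.
have cc : continuous (fun x => - dw x + - c) by solve_cont.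
have [|e1 e10 he1] := continuous_pos_near (cc z) _; first by rewrite /c; lra.
have [G G0 hG] := continuous_bounded (z - 1) (z + 1) dgc.
have [M M0 hM] := continuous_bounded (z - 1) (z + 1) dwc.
have [d [d0 de1 d1 _]] := exists_below e10 (@ltr01 R) (@ltr01 R).
exists ((z + 1) * G ^+ 2 * M / c), d; split => //.
  apply: divr_ge0; last exact: ltW.
  by apply: mulr_ge0 => //; apply: mulr_ge0; [lra | exact: sqr_ge0].
move=> x x0 xz xd.
have near y : `|y - z| <= `|x - z| -> z - 1 <= y <= z + 1.
  by move=> h; rewrite -ler_distl (le_trans h)// (le_trans xd)// ltW.
have /near/andP[_ xz1] := lexx `|x - z|.
have t0 : 0 < `|x - z| by rewrite normr_gt0 subr_eq0.
have [xi xi2 eg] := mean_value x z hg.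
have [eta eta2 ew] := mean_value x z (phi_deriv tau lam).
rewrite gz subr0 in eg; rewrite wz subr0 in ew.
have gx : g x ^+ 2 <= G ^+ 2 * `|x - z| ^+ 2.
  rewrite -exprMn -real_normK ?num_real// eg normrM.
  by rewrite lerXn2r ?nnegrE ?mulr_ge0// ler_wpM2r// hG// near.
have wx : c * `|x - z| <= `|w x|.
  rewrite ew normrM ler_wpM2r//.
  have /he1 : `|eta - z| < e1 by exact: le_lt_trans eta2 (le_lt_trans xd de1).
  rewrite subr_gt0 => h; apply: le_trans (ltW h) _.
  by rewrite -normrN ler_norm.
have dwx : `|dw x| <= M by apply: hM; exact: near.
have Tw : `|boundary x| * `|w x| <= (z + 1) * (G ^+ 2 * `|x - z| ^+ 2 * M).
  rewrite -normrM /boundary (_ : _ * w x = x * (g x ^+ 2 * dw x)); last first.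
    by field; exact: off_zero.
  rewrite normrM (normrM (g x ^+ 2)) (ger0_norm x0) (ger0_norm (sqr_ge0 (g x))).
  by apply: ler_pM => //; [rewrite mulr_ge0 ?sqr_ge0|apply: ler_pM; rewrite ?sqr_ge0].
rewrite -(ler_pM2r (mulr_gt0 c0 t0)).
apply: (@le_trans _ _ (`|boundary x| * `|w x|)); first by rewrite ler_wpM2l.
apply: (le_trans Tw); rewrite le_eqVlt; apply/orP; left; apply/eqP.
by field; rewrite gt_eqF.
Qed.

Lemma boundary_small e : 0 < e -> exists2 d, 0 < d & forall x, 0 <= x -> x != z ->
  `|x - z| < d -> `|boundary x| < e.
Proof.
move=> e0; have [K [d [K0 d0 hK]]] := boundary_near_zero.
have K1 : 0 < K + 1 by lra.
have q0 : 0 < e / (K + 1) by rewrite divr_gt0.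
have [m [m0 md mq _]] := exists_below d0 q0 q0.
exists m => // x x0 xz xm; apply: (le_lt_trans (hK x x0 xz _)).
  exact: ltW (lt_trans xm md).
move: mq; rewrite ltr_pdivlMr// => mq; have := normr_ge0 (x - z).
by move: `|x - z| xm => t tm t0; nra.
Qed.

Lemma boundary_infinity e : 0 < e -> exists a, forall x, a <= x -> - e < boundary x.
Proof.
have [z0 _ _ wr] := hz.
move=> e0; have [|b hb] := @log_derivative_lb R tau lam (-1) (z + 1) dec_lam.
  by move=> r hr; rewrite mulN1r oppr_gt0 wr//; lra.
have dg2 : decays (fun x => 2 * x * (x * g x ^+ 2)) by solve_decays.
have [a a0 ha] := decays_small dg2 e0.
exists (Num.max (Num.max a b) (z + 1)) => x; rewrite !ge_max => /andP[/andP[ax bx] zx].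
have := ha x ax; rewrite ltr_norml => /andP[_ h].
apply: lt_le_trans (_ : - (2 * x * (x * g x ^+ 2)) <= _); first by lra.
have wx : w x < 0 by apply: wr; lra.
have dwx : - (2 * x) <= dw x / w x.
  by have := hb x bx; rewrite -(mulNr) ler_ndivlMr//; lra.
have : 0 <= x * g x ^+ 2 * (dw x / w x + 2 * x).
  by apply: mulr_ge0; [apply: mulr_ge0; [lra | exact: sqr_ge0] | lra].
by rewrite /boundary; move: (dw x / w x) => q; lra.
Qed.

(** [r (g'^2 + V g^2) = r (g' - g w' / w)^2 + (r g^2 w' / w)'] away from [z], and the
    boundary terms disappear at the origin, at [z] and at infinity. *)
Lemma jacobi_ge0 l :
  integral_is (fun r => r * (dg r ^+ 2 + V lam r * g r ^+ 2)) l -> 0 <= l.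
Proof.
move=> [F [F0 dF lF]]; have [z0 _ _ _] := hz.
have mono x y : 0 <= x -> x <= y -> (y < z \/ z < x) ->
    F x - boundary x <= F y - boundary y.
  move=> x0 xy hz'.
  have tz t : x <= t <= y -> t != z.
    by move=> ht; apply/eqP => e; move: hz'; rewrite -e => -[]; lra.
  apply: (@has_deriv_ge0_le _ (fun t => F t - boundary t)
    (fun t => t * (dg t ^+ 2 + V lam t * g t ^+ 2) - boundary_prime t) _ _ xy) => t ht.
  - have t0 : 0 <= t by lra.
    have h1 := dF t t0; have h2 := boundary_deriv t0 (tz t ht).
    exact: has_deriv_continuous (has_derivD h1 (has_derivN h2)).
  - have t0 : 0 <= t by lra.
    have h1 := dF t t0; have h2 : has_deriv boundary t (boundary_prime t).
      by apply: boundary_deriv => //; apply: tz; lra.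
    exact: has_derivD h1 (has_derivN h2).
  - rewrite /boundary_prime (_ : _ - _ = t * (dg t - g t * (dw t / w t)) ^+ 2);
      last by ring.
    by apply: mulr_ge0; [lra | exact: sqr_ge0].
rewrite leNgt; apply/negP => l0.
have [e e0 el] : exists2 e, 0 < e & l = - (6 * e).
  by exists (- l / 6); [lra | field].
have [d d0 hd] := boundary_small e0.
have [a ha] := boundary_infinity e0.
have [b hb] := lF e e0.
have [d' d'0 hd'] : exists2 d', 0 < d' & forall x, `|x - z| < d' -> `|F x - F z| < e.
  have : {for z, continuous F} := has_deriv_continuous (dF z (ltW z0)).
  move=> /cvgrPdist_lt/(_ e e0)/nbhs_ballP[d' /= d'0 hd'].
  by exists d' => // x xz; rewrite distrC; apply: hd'; rewrite /ball/= distrC.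
have [m [m0 md md' mz]] := exists_below d0 d'0 z0.
pose y := Num.max (Num.max a b) (z + m).
have ya : a <= y by rewrite /y !le_max lexx.
have yb : b <= y by rewrite /y !le_max lexx orbT.
have yz : z + m <= y by rewrite /y le_max lexx orbT.
have zm0 : 0 <= z - m by rewrite subr_ge0 ltW.
have zp0 : 0 <= z + m by apply: addr_ge0; exact: ltW.
have h1 : F 0 - boundary 0 <= F (z - m) - boundary (z - m).
  by apply: mono => //; left; rewrite gtrBl.
have h2 : F (z + m) - boundary (z + m) <= F y - boundary y.
  by apply: mono => //; right; rewrite ltrDl.
have T0 : boundary 0 = 0 by rewrite /boundary mul0r.
have h3 := ha y ya; have h4 := hb y yb.
have nm : `|z - m - z| = m by rewrite addrAC subrr sub0r normrN gtr0_norm.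
have np : `|z + m - z| = m by rewrite addrAC subrr add0r gtr0_norm.
have k1 : `|boundary (z + m)| < e by apply: hd; rewrite ?np// gt_eqF// ltrDl.
have k2 : `|boundary (z - m)| < e by apply: hd; rewrite ?nm// lt_eqF// gtrBl.
have k3 : `|F (z - m) - F z| < e by apply: hd'; rewrite nm.
have k4 : `|F (z + m) - F z| < e by apply: hd'; rewrite np.
rewrite F0 T0 in h1; move: k1 k2 k3 k4 h4; rewrite !ltr_norml.
move=> /andP[? ?] /andP[? ?] /andP[? ?] /andP[? ?] /andP[? ?]; lra.
Qed.

End Jacobi.

End Gap.

(** * Weak form, gap inequality and second-order bound *)

Section WeakForm.
Variable R : realType.
Implicit Types (tau lam r : R).

Lemma r_phi_prime_deriv tau lam r :
  has_deriv (fun x => x * phi_prime tau lam x) r (r * (potential tau lam r * phi tau lam r)).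
Proof. by solve_deriv; rewrite /phi_prime; ring. Qed.

(** The equation of [phi] tested against [v]: the integrand is [(r phi' v)']. *)
Lemma weak_form tau lam (v dv : R -> R) : decaying tau lam ->
  (forall r, has_deriv v r (dv r)) -> decays v ->
  integral_is (fun r => r * (phi_prime tau lam r * dv r + potential tau lam r * (phi tau lam r * v r))) 0.
Proof.
move=> [dp dd] hv decv.
pose F r := r * phi_prime tau lam r * v r.
have -> : (0 : R) = - F 0 by rewrite /F !mul0r oppr0.
apply: (@integral_is_derivative _ F) => [|x _]; first by rewrite /F; solve_decays.
have h1 := r_phi_prime_deriv tau lam x; have h2 := hv x.
eapply has_deriv_eq; first exact: (has_derivM h1 h2).
by rewrite /=; ring.
Qed.

(** Pohozaev identity, from the multiplier [r^2 phi']. *)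
Lemma pohozaev tau lam : decaying tau lam ->
  integral_is (fun r => (2 * r * potential tau lam r + 2 * r ^+ 2 * (r - tau)) * phi tau lam r ^+ 2) 0.
Proof.
move=> [dp dd].
pose F r := r ^+ 2 * (r - tau) ^+ 2 * phi tau lam r ^+ 2
  - lam * r ^+ 2 * phi tau lam r ^+ 2 - (r * phi_prime tau lam r) ^+ 2.
have -> : (0 : R) = - F 0 by rewrite /F; ring.
apply: (@integral_is_derivative _ F) => [|x _]; first by rewrite /F; solve_decays.
have h1 := r_phi_prime_deriv tau lam x.
rewrite /F; solve_deriv.
by rewrite /potential /=; ring.
Qed.

End WeakForm.

Section GapInequality.
Variable R : realType.
Variables (tau z1 z2 z : R).
Hypotheses (z12 : z1 < z2) (dec1 : decaying tau z1) (dec2 : decaying tau z2)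
  (neg1 : ~ takes_neg tau z1) (once2 : changes_once tau z2 z).
Local Notation u := (phi tau z1).
Local Notation du := (phi_prime tau z1).
Implicit Types (v dv : R -> R).

(** Let [g = v - c u] vanish at [z]. By orthogonality and the equation of [u], the
    integral in [jacobi_ge0] for [g] is [q - z2 n - c^2 (z2 - z1) |u|^2]. *)
Lemma spectral_gap v dv q n : (forall r, has_deriv v r (dv r)) -> continuous dv ->
  decays v -> decays dv -> integral_is (fun r => r * (v r * u r)) 0 ->
  integral_is (fun r => r * (dv r ^+ 2 + (r - tau) ^+ 2 * v r ^+ 2)) q ->
  integral_is (fun r => r * v r ^+ 2) n -> z2 * n <= q.
Proof.
move=> hv dvc decv decdv orth hq hn.
have [du1 dd1] := dec1; have [zp _ _ _] := once2.
have uz : u z != 0 by rewrite gt_eqF// not_neg_pos// ltW.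
have uc : continuous u by exact: phi_continuous.
have vc : continuous v by move=> x; exact: has_deriv_continuous (hv x).
pose c := v z / u z.
have [A hA] : exists l, integral_is (fun r => r * u r ^+ 2) l.
  by apply: integral_is_exists; [solve_cont | solve_decays].
have A0 : 0 <= A.
  by apply: integral_is_ge0 hA => x x0; rewrite mulr_ge0// sqr_ge0.
have W1 := weak_form dec1 hv decv.
have W2 := weak_form dec1 (phi_deriv tau z1) du1.
pose g r := v r + - c * u r; pose dg r := dv r + - c * du r.
have hg r : has_deriv g r (dg r) by have h := hv r; rewrite /g; solve_deriv; rewrite /dg; ring.
have dgc : continuous dg by rewrite /dg; solve_cont.
have dg1 : decays g by rewrite /g; solve_decays.
have dg2 : decays dg by rewrite /dg; solve_decays.
have gz : g z = 0 by rewrite /g /c mulNr divfK ?subrr.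
have hJ : integral_is (fun r => r * (dg r ^+ 2 + potential tau z2 r * g r ^+ 2))
   (1 * q + (- z2 * n + (- 2 * c * 0 + (c ^+ 2 * 0 +
     (2 * c * (z2 - z1) * 0 + (- c ^+ 2 * (z2 - z1) * A + 0)))))).
  apply: integral_is_ext (integral_is_lin 1 hq (integral_is_lin (- z2) hn
    (integral_is_lin (- 2 * c) W1 (integral_is_lin (c ^+ 2) W2
    (integral_is_lin (2 * c * (z2 - z1)) orth
    (integral_is_lin (- c ^+ 2 * (z2 - z1)) hA (@integral_is0 R))))))) => r _.
  by rewrite /g /dg /potential; ring.
have J0 := jacobi_ge0 dec2 once2 hg dgc dg1 gz hJ.
have : 0 <= c ^+ 2 * (z2 - z1) * A.
  apply: mulr_ge0 => //; apply: mulr_ge0; first exact: sqr_ge0.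
  by rewrite subr_ge0 ltW.
lra.
Qed.

(** Let [f = b u + v] be an eigenfunction at [tau + h], with [v] orthogonal to [u].
    Testing the equations of [f] and [u] gives
    [q v - z1 |v|^2 = (zeta - z1 - h^2) |f|^2 + 2 h <(r - tau) f, f>]. The gap bounds
    the left side from below; on the right, the term in [v^2] is absorbed by a small
    part of [q v], and the cross term by Cauchy-Schwarz. The coefficient [b] is not
    zero, as otherwise [f = v] would vanish. *)
Lemma second_order_bound (A c B h zeta : R) :
  integral_is (fun r => r * u r ^+ 2) A ->
  integral_is (fun r => r * (r - tau) * u r ^+ 2) c ->
  integral_is (fun r => r * (r - tau) ^+ 2 * u r ^+ 2) B ->
  decaying (tau + h) zeta -> `|h| <= 1 ->
  0 < z2 - z1 - `|h| * (z2 + 1) + h ^+ 2 - (zeta - z1) ->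
  0 <= (zeta - z1 - h ^+ 2) * A + 2 * h * c +
    4 * h ^+ 2 * B / (z2 - z1 - `|h| * (z2 + 1) + h ^+ 2 - (zeta - z1)).
Proof.
move=> hA hc hB dech h1 del0.
set del := z2 - z1 - `|h| * (z2 + 1) + h ^+ 2 - (zeta - z1) in del0 *.
have [du1 dd1] := dec1; have [df1 df2] := dech.
pose f := phi (tau + h) zeta; pose df := phi_prime (tau + h) zeta.
have uc : continuous u by exact: phi_continuous.
have fc : continuous f by exact: phi_continuous.
have duc : continuous du by exact: phi_prime_continuous.
have dfc : continuous df by exact: phi_prime_continuous.
have decf : decays f := df1. have decdf : decays df := df2.
have ex (F : R -> R) : continuous F -> decays F -> exists l, integral_is F l.
  exact: integral_is_exists.
have [N hN] : exists l, integral_is (fun r => r * f r ^+ 2) l by apply: ex; [solve_cont | solve_decays].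
have [p hp] : exists l, integral_is (fun r => r * (f r * u r)) l by apply: ex; [solve_cont | solve_decays].
have [e0 e00 he0] := phi_pos_near0 tau z1.
have A0 : 0 < A.
  apply: integral_is_gt0 e00 _ _ hA => x hx; first by rewrite mulr_ge0 ?sqr_ge0.
  by rewrite mulr_gt0 ?exprn_gt0 ?he0//; lra.
have [e1 e10 he1] := phi_pos_near0 (tau + h) zeta.
have N0 : 0 < N.
  apply: integral_is_gt0 e10 _ _ hN => x hx; first by rewrite mulr_ge0 ?sqr_ge0.
  by rewrite mulr_gt0 ?exprn_gt0 ?he1//; lra.
pose b := p / A.
pose v r := f r + - b * u r; pose dv r := df r + - b * du r.
have hf r : has_deriv f r (df r) by exact: phi_deriv.
have hv r : has_deriv v r (dv r).
  by have h' := hf r; rewrite /v; solve_deriv; rewrite /dv; ring.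
have vc : continuous v by rewrite /v; solve_cont.
have dvc : continuous dv by rewrite /dv; solve_cont.
have decv : decays v by rewrite /v; solve_decays.
have decdv : decays dv by rewrite /dv; solve_decays.
have [n hn] : exists l, integral_is (fun r => r * v r ^+ 2) l by apply: ex; [solve_cont | solve_decays].
have [q hq] : exists l, integral_is (fun r => r * (dv r ^+ 2 + (r - tau) ^+ 2 * v r ^+ 2)) l.
  by apply: ex; [solve_cont | solve_decays].
have [Y hY] : exists l, integral_is (fun r => r * ((r - tau) * v r ^+ 2)) l.
  by apply: ex; [solve_cont | solve_decays].
have [Z hZ] : exists l, integral_is (fun r => r * ((r - tau) * (u r * v r))) l.
  by apply: ex; [solve_cont | solve_decays].
have lin := @integral_is_lin R.
have i0 := @integral_is0 R.
have orth : integral_is (fun r => r * (v r * u r)) 0.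
  have -> : 0 = 1 * p + (- b * A + 0) by rewrite /b mulNr divfK ?gt_eqF//; ring.
  by apply: integral_is_ext (lin _ _ _ _ 1 hp (lin _ _ _ _ (- b) hA i0)) => r _; rewrite /v; ring.
have gap_v := spectral_gap hv dvc decv decdv orth hq hn.
have n0 : 0 <= n by apply: integral_is_ge0 hn => x x0; rewrite mulr_ge0 ?sqr_ge0.
have eN : N = b ^+ 2 * A + n.
  rewrite (_ : _ + n = 1 * n + (2 * b * 0 + (b ^+ 2 * A + 0))); last by ring.
  apply: integral_is_uniq hN _.
  apply: integral_is_ext (lin _ _ _ _ 1 hn (lin _ _ _ _ (2 * b) orth (lin _ _ _ _ (b ^+ 2) hA i0))) => r _.
  by rewrite /v; ring.
have W1 := weak_form dec1 hv decv.
have W2 := weak_form dec1 (phi_deriv tau z1) du1.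
have W3 := weak_form dech hf decf.
have eq1 : q - z1 * n = (zeta - z1 - h ^+ 2) * N + 2 * h * (Y + 2 * b * Z + b ^+ 2 * c).
  have hX := lin _ _ _ _ 1 hY (lin _ _ _ _ (2 * b) hZ (lin _ _ _ _ (b ^+ 2) hc i0)).
  have H1 := lin _ _ _ _ 1 hq (lin _ _ _ _ (2 * b) W1 (lin _ _ _ _ (b ^+ 2) W2
     (lin _ _ _ _ (2 * b * z1) orth (lin _ _ _ _ (b ^+ 2 * z1) hA i0)))).
  have H2 := lin _ _ _ _ 1 W3 (lin _ _ _ _ (zeta - h ^+ 2) hN (lin _ _ _ _ (2 * h) hX i0)).
  have key : 1 * q + (2 * b * 0 + (b ^+ 2 * 0 + (2 * b * z1 * 0 + (b ^+ 2 * z1 * A + 0)))) =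
      1 * 0 + ((zeta - h ^+ 2) * N + (2 * h * (1 * Y + (2 * b * Z + (b ^+ 2 * c + 0))) + 0)).
    apply: integral_is_uniq H1 _; apply: integral_is_ext H2 => r _.
    by rewrite /v /dv /potential /f /df; ring.
  by move: key; rewrite eN; lra.
(* [2 h (r - tau) <= |h| ((r - tau)^2 + 1)] pointwise. *)
have hYq : 2 * h * Y <= `|h| * (q + n).
  have H := lin _ _ _ _ `|h| hq (lin _ _ _ _ `|h| hn (lin _ _ _ _ (- (2 * h)) hY i0)).
  suff : 0 <= `|h| * q + (`|h| * n + (- (2 * h) * Y + 0)) by lra.
  apply: integral_is_ge0 H => x x0.
  have -> : `|h| * (x * (dv x ^+ 2 + (x - tau) ^+ 2 * v x ^+ 2)) +
      (`|h| * (x * v x ^+ 2) + (- (2 * h) * (x * ((x - tau) * v x ^+ 2)) + 0)) =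
    x * (`|h| * dv x ^+ 2 + (`|h| * ((x - tau) ^+ 2 + 1) - 2 * h * (x - tau)) * v x ^+ 2).
    by ring.
  apply: mulr_ge0 => //; apply: addr_ge0.
    by apply: mulr_ge0 => //; exact: sqr_ge0.
  apply: mulr_ge0; last exact: sqr_ge0.
  have := ler_norm h; have := ler_norm (- h); rewrite normrN => k1 k2.
  have : 0 <= (`|h| + h) * (x - tau - 1) ^+ 2 by rewrite mulr_ge0 ?sqr_ge0//; lra.
  have : 0 <= (`|h| - h) * (x - tau + 1) ^+ 2 by rewrite mulr_ge0 ?sqr_ge0//; lra.
  lra.
(* Integrate the square of [del v - 2 h b (r - tau) u]. *)
have hCS : 4 * h * b * Z <= del * n + 4 * h ^+ 2 * b ^+ 2 * B / del.
  have H := lin _ _ _ _ (del ^+ 2) hn (lin _ _ _ _ (- (4 * del * h * b)) hZ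
    (lin _ _ _ _ (4 * h ^+ 2 * b ^+ 2) hB i0)).
  have : 0 <= del ^+ 2 * n + (- (4 * del * h * b) * Z + (4 * h ^+ 2 * b ^+ 2 * B + 0)).
    apply: integral_is_ge0 H => x x0.
    have -> : del ^+ 2 * (x * v x ^+ 2) + (- (4 * del * h * b) * (x * ((x - tau) * (u x * v x)))
       + (4 * h ^+ 2 * b ^+ 2 * (x * (x - tau) ^+ 2 * u x ^+ 2) + 0)) =
      x * (del * v x - 2 * h * b * (x - tau) * u x) ^+ 2 by ring.
    by rewrite mulr_ge0 ?sqr_ge0.
  move=> H'; rewrite -(ler_pM2l del0) mulrDr.
  rewrite (_ : del * (4 * h ^+ 2 * b ^+ 2 * B / del) = 4 * h ^+ 2 * b ^+ 2 * B); last first.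
    by field; rewrite gt_eqF.
  by lra.
have hgap : (1 - `|h|) * (z2 * n) <= (1 - `|h|) * q.
  by rewrite ler_wpM2l// subr_ge0.
have main : del * n <= b ^+ 2 * ((zeta - z1 - h ^+ 2) * A + 2 * h * c) + 4 * h * b * Z.
  have e2 : q - z1 * n = (zeta - z1 - h ^+ 2) * (b ^+ 2 * A + n)
      + 2 * h * (Y + 2 * b * Z + b ^+ 2 * c) by rewrite -eN.
  rewrite /del.
  have -> : (z2 - z1 - `|h| * (z2 + 1) + h ^+ 2 - (zeta - z1)) * n =
    (1 - `|h|) * (z2 * n) - z1 * n - `|h| * n + (h ^+ 2 - (zeta - z1)) * n by ring.
  have -> : b ^+ 2 * ((zeta - z1 - h ^+ 2) * A + 2 * h * c) + 4 * h * b * Z =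
    (q - z1 * n) - 2 * h * Y - (zeta - z1 - h ^+ 2) * n by rewrite e2; ring.
  lra.
have b0 : b != 0.
  apply/eqP => b0; move: main eN; rewrite b0 expr0n/= !mul0r mulr0 mul0r !add0r => h3 eN.
  by have := mulr_gt0 del0 N0; rewrite eN; lra.
have b2 : 0 < b ^+ 2 by rewrite exprn_even_gt0.
rewrite -(pmulr_rge0 _ b2) (_ : b ^+ 2 * _ = b ^+ 2 * ((zeta - z1 - h ^+ 2) * A + 2 * h * c) +
   4 * h ^+ 2 * b ^+ 2 * B / del); last by ring.
by lra.
Qed.

End GapInequality.

(** * Critical points of the first eigenvalue *)

Section Critical.
Variable R : realType.
Implicit Types (tau h : R).

Lemma first_order_expansion (f : R -> R) x a e : has_deriv f x a -> 0 < e ->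
  exists2 d, 0 < d & forall h, `|h| < d -> `|f (x + h) - f x - a * h| <= e * `|h|.
Proof.
move=> [dfx dfa] e0; move: dfx dfa => /cvg_ex[l hl] dfa.
have la : l = a by rewrite -dfa; apply/esym; apply: cvg_lim => //; exact: hl.
rewrite la in hl; move/cvgrPdist_lt : hl => /(_ e e0).
move=> /nbhs_ballP[d /= d0 hd]; exists d => // h hd'.
have [->|h0] := eqVneq h 0; first by rewrite addr0 subrr mulr0 subrr normr0 mulr0.
have := hd h; rewrite /ball/= sub0r normrN => /(_ hd' h0).
have -> : f (h *: 1 + x) = f (x + h) by congr f; rewrite /GRing.scale/= mulr1 addrC.
move=> H; have hn : 0 < `|h| by rewrite normr_gt0.
rewrite distrC in H; rewrite -ler_pdivrMr// -normfV -normrM.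
apply: ltW; apply: le_lt_trans H; rewrite /GRing.scale/=.
by rewrite le_eqVlt; apply/orP; left; apply/eqP; congr (`|_|); field.
Qed.

(** A second derivative is only assumed at [x], so [f'] is compared with the linear
    function [m (y - x)] to the right of [x], and [f] with its primitive. *)
Lemma taylor_upper (f : R -> R) x d D m : 0 < d ->
  (forall t, `|t - x| < d -> derivable f t 1) ->
  derive1 f x = 0 -> has_deriv (derive1 f) x D -> D < m ->
  exists2 e, 0 < e & forall h, 0 < h -> h < e -> f (x + h) - f x <= m / 2 * h ^+ 2.
Proof.
move=> d0 fd fx hD Dm; have mD : 0 < m - D by rewrite subr_gt0.
have [d' d'0 hd'] := first_order_expansion hD mD.
have [e [e0 ed ed' _]] := exists_below d0 d'0 d'0.
exists e => // h h0 he.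
pose F y := f y - m / 2 * (y - x) ^+ 2.
pose dF y := derive1 f y - m * (y - x).
have near y : x <= y -> y <= x + h -> `|y - x| < e.
  by move=> xy yh; rewrite ger0_norm ?subr_ge0// ltrBlDl (le_lt_trans yh)// ltrD2l.
have hF y : x <= y -> y <= x + h -> has_deriv F y (dF y).
  move=> xy yh; have h' : has_deriv f y (derive1 f y).
    by rewrite derive1E; apply/derivableP/fd; exact: lt_trans (near y xy yh) ed.
  by rewrite /F; solve_deriv; rewrite /dF /=; field.
have : F (x + h) <= F x.
  apply: (@has_deriv_le0_ge _ F dF) => [|y /andP[xy yh]|y /andP[/ltW xy /ltW yh]|y /andP[/ltW xy /ltW yh]].
  - by rewrite lerDl ltW.
  - exact: has_deriv_continuous (hF y xy yh).
  - exact: hF.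
  - have yd := lt_trans (near y xy yh) ed'.
    have := hd' _ yd; rewrite fx subr0 (addrC x) subrK.
    have -> : `|y - x| = y - x by rewrite ger0_norm ?subr_ge0.
    move=> H.
    by have := le_trans (ler_norm _) H; rewrite /dF; lra.
by rewrite /F (addrC x) addrK subrr expr0n/= mulr0; lra.
Qed.

(** The second-order lower bound, for increments [h] of either sign; [del h] tends
    to [kap]. *)
Definition lower_expansion (A B c kap : R) (Delta del : R -> R) : Prop :=
  forall ep, 0 < ep -> ep < kap -> exists2 d, 0 < d & forall h, `|h| < d ->
    [/\ `|Delta h| <= ep * `|h|, kap - ep < del h &
        0 <= (Delta h - h ^+ 2) * A + 2 * h * c + 4 * h ^+ 2 * B / del h].

(** Divided by [|h|], the lower bound with [h c < 0] tends to [0 <= - 2 |c|], since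
    [Delta h] is [o(h)]. *)
Lemma first_moment_zero A B c kap Delta del : 0 < A -> 0 <= B -> 0 < kap ->
  lower_expansion A B c kap Delta del -> c = 0.
Proof.
move=> A0 B0 kap0 bound; apply: contrapT => /eqP c0.
have cn : 0 < `|c| by rewrite normr_gt0.
have k2 : 0 < kap / 2 by rewrite divr_gt0.
have cA : 0 < `|c| / A by rewrite divr_gt0.
have [ep [ep0 epk epA _]] := exists_below k2 cA cA.
have epk' : ep < kap by lra.
have [d d0 hd] := bound ep ep0 epk'.
have K0 : 0 <= 8 * B / kap by apply: divr_ge0; [rewrite mulr_ge0 | exact: ltW].
have K1 : 0 < 8 * B / kap + 1 by lra.
have q0 : 0 < `|c| / (8 * B / kap + 1) by rewrite divr_gt0.
have [s [s0 sd sc _]] := exists_below d0 q0 q0.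
(* The sign of [h] makes the linear term negative. *)
pose h := - Num.sg c * s.
have hs : `|h| = s by rewrite normrM normrN normr_sg c0 mul1r gtr0_norm.
have hcs : h * c = - (s * `|c|) by rewrite /h normrEsg; ring.
have hh : h ^+ 2 = s ^+ 2 by rewrite -real_normK ?num_real// hs.
have [|hDl hpos H] := hd h; first by rewrite hs.
rewrite hh -mulrA hcs hs in H hDl.
move: (Delta h) (del h) H hDl hpos => Dl dl H hDl hpos.
have del2 : kap / 2 <= dl by lra.
have e1 : 4 * s ^+ 2 * B / dl <= s * (s * (8 * B / kap)).
  have -> : s * (s * (8 * B / kap)) = 4 * s ^+ 2 * B / (kap / 2) by field; rewrite gt_eqF.
  apply: ler_wpM2l.
    by apply: mulr_ge0 => //; apply: mulr_ge0 => //; exact: sqr_ge0.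
  by rewrite lef_pV2// posrE// (lt_le_trans k2).
have e2 : Dl * A <= s * (ep * A).
  rewrite mulrA; apply: ler_wpM2r; first exact: ltW.
  by rewrite (mulrC s); exact: le_trans (ler_norm _) hDl.
have e3 : s * (ep * A) <= s * `|c|.
  by rewrite ler_pM2l// -ler_pdivlMr// ltW.
have e4 : s * (s * (8 * B / kap + 1)) <= s * `|c|.
  by rewrite ler_pM2l// -ler_pdivlMr// ltW.
have e5 : 0 < s ^+ 2 * A by rewrite mulr_gt0 ?exprn_gt0.
have e6 : 0 < s ^+ 2 by rewrite exprn_gt0.
move: e1 e4; rewrite mulrDr mulr1 mulrDr -expr2; lra.
Qed.

(** Divide the lower bound by [h^2], with [h] tending to 0 from above. *)
Lemma second_order_comparison A B kap m Delta del : 0 < A -> 0 <= B -> 0 < kap ->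
  lower_expansion A B 0 kap Delta del ->
  (exists2 e, 0 < e & forall h, 0 < h -> h < e -> Delta h <= m / 2 * h ^+ 2) ->
  (1 - m / 2) * kap * A <= 4 * B.
Proof.
move=> A0 B0 kap0 bound [e e0 he]; rewrite leNgt; apply/negP => lt.
have pos : 0 < (1 - m / 2) * kap * A by lra.
have m2 : 0 < (1 - m / 2) * A.
  by move: pos; rewrite mulrAC pmulr_lgt0.
have q0 : 0 < ((1 - m / 2) * kap * A - 4 * B) / ((1 - m / 2) * A).
  by rewrite divr_gt0// subr_gt0.
have [ep [ep0 epk epq _]] := exists_below kap0 q0 q0.
have [d d0 hd] := bound ep ep0 epk.
have [h [h0 hhd hhe _]] := exists_below d0 e0 e0.
have [|_ hpos H] := hd h; first by rewrite (gtr0_norm h0).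
have T := he h h0 hhe.
move: (Delta h) (del h) H T hpos => Dl dl H T hpos.
have dl0 : 0 < dl by lra.
have h20 : 0 < h ^+ 2 by rewrite exprn_gt0.
have e1 : 0 <= h ^+ 2 * ((m / 2 - 1) * A + 4 * B / dl).
  rewrite mulr0 addr0 in H; apply: (le_trans H).
  have : Dl * A <= m / 2 * h ^+ 2 * A by rewrite ler_wpM2r// ltW.
  have -> : h ^+ 2 * ((m / 2 - 1) * A + 4 * B / dl) =
    m / 2 * h ^+ 2 * A - h ^+ 2 * A + 4 * h ^+ 2 * B / dl by ring.
  by rewrite mulrBl; lra.
have e2 : (1 - m / 2) * A * dl <= 4 * B.
  by move: e1; rewrite pmulr_rge0// -ler_pdivlMr//; lra.
have e3 : (1 - m / 2) * A * (kap - ep) < (1 - m / 2) * A * dl by rewrite ltr_pM2l.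
move: epq; rewrite ltr_pdivlMr// => epq.
by lra.
Qed.

(** Once the first moment [c] vanishes, the second-order comparison bounds
    [1 - D / 2] by [4 B / (A (z2 - z1))], and Pohozaev's identity evaluates [B]. *)
Theorem critical_second_derivative (zeta1 : R -> R) (tau z2 z D : R) :
  (forall t, decaying t (zeta1 t)) -> zeta1 tau < z2 -> decaying tau z2 ->
  ~ takes_neg tau (zeta1 tau) -> changes_once tau z2 z ->
  (\forall t \near tau, derivable zeta1 t 1) ->
  derive1 zeta1 tau = 0 -> has_deriv (derive1 zeta1) tau D ->
  2 * ((z2 - 3 * zeta1 tau) / (z2 - zeta1 tau)) <= D.
Proof.
set z1 := zeta1 tau => hdec z12 dec2 neg1 once2 hder hcrit hD.
have dec1 : decaying tau z1 := hdec tau; have [du1 dd1] := dec1.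
have uc : continuous (phi tau z1) by exact: phi_continuous.
have [A hA] : exists l, integral_is (fun r => r * phi tau z1 r ^+ 2) l.
  by apply: integral_is_exists; [solve_cont | solve_decays].
have [c hc] : exists l, integral_is (fun r => r * (r - tau) * phi tau z1 r ^+ 2) l.
  by apply: integral_is_exists; [solve_cont | solve_decays].
have [B hB] : exists l, integral_is (fun r => r * (r - tau) ^+ 2 * phi tau z1 r ^+ 2) l.
  by apply: integral_is_exists; [solve_cont | solve_decays].
have [e0 e00 he0] := phi_pos_near0 tau z1.
have A0 : 0 < A.
  apply: integral_is_gt0 e00 _ _ hA => x hx; first by rewrite mulr_ge0 ?sqr_ge0.
  by apply: mulr_gt0; [lra | apply: exprn_gt0; apply: he0; lra].
have B0 : 0 <= B.
  by apply: integral_is_ge0 hB => x x0; apply: mulr_ge0; [apply: mulr_ge0 => //|]; exact: sqr_ge0.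
pose kap := z2 - z1; have kap0 : 0 < kap by rewrite subr_gt0.
have [d1 d10 hd1] : exists2 d, 0 < d & forall t, `|t - tau| < d -> derivable zeta1 t 1.
  by move/nbhs_ballP: hder => [d /= d0 hd]; exists d => // t td; apply: hd; rewrite /ball/= distrC.
have hz0 : has_deriv zeta1 tau 0.
  by rewrite -hcrit derive1E; apply/derivableP/hd1; rewrite subrr normr0.
have bound : lower_expansion A B c kap (fun h => zeta1 (tau + h) - z1)
    (fun h => kap - `|h| * (z2 + 1) + h ^+ 2 - (zeta1 (tau + h) - z1)).
  move=> ep ep0 epk; have [d2 d20 hd2] := first_order_expansion hz0 ep0.
  have z21 : 0 < `|z2| + 1 + ep + 1 by have := normr_ge0 z2; lra.
  have q0 : 0 < ep / (`|z2| + 1 + ep + 1) by rewrite divr_gt0.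
  have [d [d0 dd2 dd1' dq]] := exists_below d20 (@ltr01 R) q0.
  exists d => // h hd; have h1 : `|h| <= 1 by exact: ltW (lt_trans hd dd1').
  have := lt_trans hd dq; rewrite ltr_pdivlMr// => h3.
  have := hd2 h (lt_trans hd dd2); rewrite mul0r subr0 -/z1 => hDl.
  have hpos : kap - ep < kap - `|h| * (z2 + 1) + h ^+ 2 - (zeta1 (tau + h) - z1).
    have : zeta1 (tau + h) - z1 <= ep * `|h| by exact: le_trans (ler_norm _) hDl.
    have : `|h| * z2 <= `|h| * `|z2| by rewrite ler_wpM2l// ler_norm.
    have := sqr_ge0 h; have := normr_ge0 h; nra.
  split => //; apply: (@second_order_bound R tau z1 z2 z) => //.
  by apply: lt_trans hpos; rewrite subr_gt0.
have c0 : c = 0 := first_moment_zero A0 B0 kap0 bound.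
rewrite c0 in hc bound.
(* With vanishing first moment, Pohozaev balances kinetic and potential energy. *)
have vir : 2 * B = z1 * A.
  have H := integral_is_lin 4 hB (integral_is_lin (- (2 * z1)) hA
    (integral_is_lin (2 * tau) hc (@integral_is0 R))).
  have e : 4 * B + (- (2 * z1) * A + (2 * tau * 0 + 0)) = 0.
    apply: integral_is_uniq (pohozaev dec1); apply: integral_is_ext H => r _.
    by rewrite /potential; ring.
  by lra.
apply/ler_addgt0Pr => e ep0.
have De : D < D + e by rewrite ltrDl.
have T := second_order_comparison A0 B0 kap0 bound (taylor_upper d10 hd1 hcrit hD De).
have {}T : (1 - (D + e) / 2) * kap <= 2 * z1.
  rewrite -(ler_pM2r A0); apply: (le_trans T).
  by rewrite -mulrA -vir; lra.
by rewrite mulrA ler_pdivrMr//; move: T; rewrite /kap; lra.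
Qed.

End Critical.

(** * Decaying solutions are eigenfunctions *)

Section HalfLine.
Variable R : realType.
Local Notation mu := (@lebesgue_measure R).
Local Notation hl := (@half_line R).
Implicit Types (f g F v : R -> R).

Lemma half_lineE x : hl x = (0 < x) :> Prop.
Proof. by rewrite /half_line/= in_itv/= andbT. Qed.

Lemma measurable_half_line : measurable hl.
Proof. exact: measurable_itv. Qed.

Lemma open_half_line : open hl.
Proof. exact: interval_open. Qed.

Lemma half_line_measurable_fun f : (forall x, 0 < x -> {for x, continuous f}) ->
  measurable_fun hl f.
Proof.
move=> fc; apply: open_continuous_measurable_fun; first exact: open_half_line.
by move=> x; rewrite inE half_lineE; exact: fc.
Qed.

Lemma integral_exp_lt_pinfty (C : R) : 0 <= C ->
  (\int[mu]_(x in hl) (C * expR (- x))%:E < +oo)%E.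
Proof.
move=> C0.
have hF x : has_deriv (fun y => - (C * expR (- y))) x (C * expR (- x)) by solve_deriv; ring.
have fc : continuous (fun y => C * expR (- y)).
  by move=> x; apply: (@has_deriv_continuous _ _ _ (- (C * expR (- x)))); solve_deriv; ring.
have e : (\int[mu]_(x in `[0%R, +oo[) (C * expR (- x))%:E =
    0%:E - (- (C * expR (- 0)))%:E)%E.
  apply: (@ge0_continuous_FTC2y _ (fun x => C * expR (- x)) (fun x => - (C * expR (- x)))).
  - by move=> x _; rewrite mulr_ge0 ?expR_ge0.
  - by apply: continuous_subspaceT.
  - rewrite -[X in _ --> X]oppr0; apply: cvgN; rewrite -(mulr0 C).
    by apply: cvgMl_tmp; exact: cvgr_expR.
  - by move=> x _; have [] := hF x.
  - by apply: cvg_at_right_filter; exact: has_deriv_continuous (hF 0).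
  - by move=> x _; exact: has_deriv1E (hF x).
apply: (@le_lt_trans _ _ (\int[mu]_(x in `[0%R, +oo[) (C * expR (- x))%:E)%E); last by rewrite e ltry.
apply: ge0_subset_integral => //.
- exact: measurable_half_line.
- apply/measurable_EFinP; apply: measurable_funTS.
  exact: continuous_measurable_fun.
- by move=> x _; rewrite lee_fin mulr_ge0 ?expR_ge0.
- by move=> x; rewrite half_lineE/= in_itv/= andbT => /ltW.
Qed.

Lemma L2r_decays f g : decays g -> (forall x, 0 < x -> f x = g x) ->
  (forall x, 0 < x -> {for x, continuous f}) -> L2r f.
Proof.
move=> dg fg fc; split; first exact: half_line_measurable_fun.
have [C hC] := decaysX (decaysM dg dg) 1.
have C0 : 0 <= C.
  by have := le_trans (normr_ge0 _) (hC 0 (lexx 0)); rewrite mulr0 oppr0 expR0 mulr1.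
apply: le_lt_trans (integral_exp_lt_pinfty C0).
apply: (@ge0_le_integral _ _ _ mu hl measurable_half_line).
- move=> x; rewrite half_lineE => x0; rewrite lee_fin; apply: mulr_ge0; last exact: ltW.
  exact: sqr_ge0.
- apply/measurable_EFinP; apply: half_line_measurable_fun => x x0.
  apply: continuousM; last by [].
  change {for x, continuous (fun y => f y * f y)}.
  by apply: continuousM; exact: fc.
- apply/measurable_EFinP; apply: half_line_measurable_fun => x _.
  by apply: (@has_deriv_continuous _ _ _ (- (C * expR (- x)))); solve_deriv; ring.
move=> x; rewrite half_lineE => x0; rewrite lee_fin fg//.
have := hC x (ltW x0); rewrite mul1r; apply: le_trans.
by rewrite (le_trans (ler_norm _))// expr2 mulrC.
Qed.

Lemma locally_integrable_continuous f : (forall x, 0 < x -> {for x, continuous f}) ->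
  locally_integrable hl f.
Proof.
move=> fc; split; [exact: half_line_measurable_fun | exact: open_half_line |].
move=> K Khl cK.
have : mu.-integrable K (EFin \o f).
  apply: continuous_compact_integrable => //.
  apply: continuous_in_subspaceT => x; rewrite inE => /Khl; rewrite half_lineE.
  exact: fc.
by case/integrableP.
Qed.

Lemma Rintegral_support (A B : set R) f : B `<=` A ->
  (forall x, A x -> ~ B x -> f x = 0) ->
  \int[mu]_(x in A) f x = \int[mu]_(x in B) f x.
Proof.
move=> BA f0; rewrite Rintegral_mkcond [RHS]Rintegral_mkcond.
congr Rintegral; apply/funext => x; rewrite /patch.
have [/set_mem Bx|Bx] := boolP (x \in B); first by rewrite mem_set//; exact: BA.
case: ifP => // /set_mem Ax; apply: f0 => // /mem_set; exact/negP.
Qed.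

(** The support may be taken in a nondegenerate segment of the open half-line. *)
Lemma test_function_support (phi : R -> R) : test_function phi -> exists a b : R,
  [/\ 0 < a, a < b, forall r, ~ (a <= r <= b) -> phi r = 0,
      forall r, ~ (a <= r <= b) -> derive1 phi r = 0 & phi a = 0 /\ phi b = 0].
Proof.
move=> [dphi cphi [a [b [a0 phi0]]]].
have p0 r : ~ (a <= r <= b) -> phi r = 0.
  by move=> h; apply: phi0; rewrite in_itv/=; exact/negP.
exists (a / 2), (Num.max a b + 1).
have ab : a <= Num.max a b /\ b <= Num.max a b by rewrite !le_max !lexx orbT.
split => //.
- by rewrite divr_gt0.
- by have [? ?] := ab; lra.
- by move=> r h; apply: p0 => h'; apply: h; have [? ?] := ab; lra.
- move=> r h.
  have [d d0 hd] : exists2 d, 0 < d & forall t, `|t - r| < d -> phi t = 0.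
    have [ra|ar] := ltP r (a / 2).
      exists (a / 2) => [|t]; first by rewrite divr_gt0.
      by rewrite ltr_norml => /andP[? ?]; apply: p0; lra.
    exists 1 => // t; rewrite ltr_norml => /andP[? ?]; apply: p0 => ?; apply: h.
    by have [? ?] := ab; lra.
  rewrite derive1E (@near_eq_derive _ _ _ phi (fun=> 0))//.
    by rewrite derive_cst.
  apply/nbhs_ballP; exists d => // t; rewrite /ball/= distrC; exact: hd.
- by have [? ?] := ab; split; apply: p0; lra.
Qed.

Lemma weak_derivative_classical F f : (forall x, 0 < x -> has_deriv F x (f x)) ->
  (forall x, 0 < x -> {for x, continuous f}) -> weak_derivative F f.
Proof.
move=> hF fc.
have Fc x : 0 < x -> {for x, continuous F} by move=> x0; exact: has_deriv_continuous (hF x x0).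
split; [exact: locally_integrable_continuous | exact: locally_integrable_continuous |].
move=> phi tphi; have [dphi cphi _] := tphi.
have [a [b [a0 ab p0 d0 [pa pb]]]] := test_function_support tphi.
have sub : `[a, b] `<=` hl.
  by move=> x; rewrite half_lineE/= in_itv/= => /andP[ax _]; exact: lt_le_trans a0 ax.
rewrite !(@Rintegral_support hl `[a, b])//; last 2 first.
- by move=> x _; rewrite /= in_itv/= => /p0 ->; rewrite mulr0.
- by move=> x _; rewrite /= in_itv/= => /d0 ->; rewrite mulr0.
rewrite (@Rintegration_by_parts _ F phi f (derive1 phi) a b ab).
- by rewrite pa pb !mulr0 subrr sub0r.
- by apply: continuous_within => x /andP[ax _]; apply: fc; exact: lt_le_trans a0 ax.
- split.
  + by move=> x; rewrite in_itv/= => /andP[ax _]; have [] := hF x (lt_trans a0 ax).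
  + by apply: cvg_at_right_filter; exact: Fc.
  + by apply: cvg_at_left_filter; apply: Fc; exact: lt_trans a0 ab.
- by move=> x; rewrite in_itv/= => /andP[ax _]; exact: has_deriv1E (hF x (lt_trans a0 ax)).
- by apply: continuous_within => x _; exact: cphi.
- have pc x : {for x, continuous phi}.
    by apply: differentiable_continuous; apply/derivable1_diffP; exact: dphi.
  split; first by move=> x _; exact: dphi.
  + by apply: cvg_at_right_filter; exact: pc.
  + by apply: cvg_at_left_filter; exact: pc.
- by [].
Qed.

Lemma not_ae_zero f (e : R) : 0 < e -> (forall x, 0 < x < e -> f x != 0) ->
  ~ ae_half_line (fun r => f r = 0).
Proof.
move=> e0 fe; rewrite /ae_half_line => -[A [mA A0 hA]].
have : (mu `]0%R, e[ <= mu A)%E.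
  apply: le_measure; rewrite ?inE//.
  move=> x; rewrite /= in_itv/= => xe; apply: hA => /= h.
  by have := fe x xe; rewrite h ?eqxx// half_lineE; case/andP: xe.
by rewrite A0 lebesgue_measure_itv/= lte_fin e0 -EFinD lee_fin; lra.
Qed.

End HalfLine.

Section Eigenfunction.
Variable R : realType.
Implicit Types (tau lam : R).

(** [phi' / r = sig] is entire, so every membership condition of the domain follows
    from the decay of [phi] and [phi']. *)
Lemma decaying_eigenvalue tau lam : decaying tau lam -> eigenvalue_g tau lam.
Proof.
move=> [dp dd].
have pc := @phi_continuous R tau lam; have dc := @phi_prime_continuous R tau lam.
have sc := @sig_continuous R tau lam.
exists (phi tau lam).
  have [e e0 he] := phi_pos_near0 tau lam.
  apply: (@not_ae_zero _ _ e e0) => x /andP[x0 xe].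
  by rewrite gt_eqF// he// (ltW x0).
pose w x := potential tau lam x * phi tau lam x - sig tau lam x.
have ds : decays (sig tau lam).
  apply: decays_tail => // k; have [C hC] := dd k; exists C, 1 => r r1.
  have r0 : 0 <= r by lra.
  apply: le_trans (hC r r0).
  by rewrite /phi_prime normrM (ger0_norm r0) ler_peMl.
have dXp : decays (fun r => r * phi tau lam r) by exact: decaysX.
have dXXp : decays (fun r => r ^+ 2 * phi tau lam r).
  by apply: decays_ext (decaysX dXp) => r _; rewrite expr2 mulrA.
have dw : decays w.
  apply: decays_ext (decaysD dXXp (decaysD (decaysZ (- 2 * tau) dXp)
     (decaysD (decaysZ (tau ^+ 2 - lam) dp) (decaysZ (-1) ds)))) => r _ /=.
  by rewrite /w /potential; ring.
have wc : continuous w.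
  by rewrite /w /potential; solve_cont.
have invE r : 0 < r -> r^-1 * phi_prime tau lam r = sig tau lam r.
  by move=> r0; rewrite /phi_prime mulKf// gt_eqF.
have wd1 : weak_derivative (phi tau lam) (phi_prime tau lam).
  by apply: weak_derivative_classical => x _; [exact: phi_deriv | exact: dc].
have wd2 : weak_derivative (phi_prime tau lam) w.
  by apply: weak_derivative_classical => x _; [exact: phi_prime_deriv | exact: wc].
have Lp : L2r (phi tau lam) by apply: (L2r_decays dp) => // x _; exact: pc.
exists (phi_prime tau lam), w; split; last first.
  by apply: aeW => r; rewrite half_lineE => r0; rewrite invE// /w /potential; ring.
split; first split => //.
- exists (phi_prime tau lam) => //.
  by apply: (L2r_decays dd) => // x _; exact: dc.
- by apply: (L2r_decays dXp) => // x _; apply: continuousM; [|exact: pc].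
split; split => //.
- by apply: (L2r_decays dw) => // x _; exact: wc.
- apply: (L2r_decays ds) => [x x0|x x0]; first exact: invE.
  apply: continuousM; last exact: dc.
  by apply: inv_continuous; rewrite gt_eqF.
- apply: (L2r_decays dXXp) => // x _; apply: continuousM; last exact: pc.
  exact: exprn_continuous.
- have c0 : {for (0 : R), continuous (fun x : R => x * phi_prime tau lam x)}.
    by apply: continuousM; [|exact: dc].
  have := cvg_at_right_filter c0; rewrite mul0r; exact.
Qed.

End Eigenfunction.

(** * Functions with vanishing weak derivative *)

Section Gluing.
Variable R : realType.
Implicit Types (f F G : R -> R) (a b c x : R).

Lemma has_deriv0_cst F a b : a <= b -> (forall x, a <= x <= b -> has_deriv F x 0) -> F a = F b.
Proof.
move=> ab hF; apply/eqP; rewrite eq_le; apply/andP; split.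
- apply: (@has_deriv_ge0_le _ F (fun=> 0)) => // x hx.
  + exact: has_deriv_continuous (hF x hx).
  + by apply: hF; case/andP: hx => *; rewrite !ltW.
- apply: (@has_deriv_le0_ge _ F (fun=> 0)) => // x hx.
  + exact: has_deriv_continuous (hF x hx).
  + by apply: hF; case/andP: hx => *; rewrite !ltW.
Qed.

(** Primitives based at the same point agree where they are both defined, so they
    can be glued along a family of half-lines. *)
Lemma primitive_glued f c (S : R -> Prop) :
  (forall a, S a -> forall x, a <= x -> {for x, continuous f}) ->
  exists F, forall x, (exists a, [/\ S a, a < x & a < c]) -> has_deriv F x (f x).
Proof.
move=> fc.
have /choice[Fa hFa] : forall a, exists F, S a -> a < c ->
    F c = 0 /\ forall x, a < x -> has_deriv F x (f x).
  move=> a; have [[Sa ac]|h] := pselect (S a /\ a < c); last first.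
    by exists f => Sa ac; case: h.
  by have [F F0 dF] := primitive_exists ac (fc a Sa); exists F.
have agree a b x : S a -> S b -> a < c -> b < c -> a < x -> b < x -> Fa a x = Fa b x.
  move=> Sa Sb ac bc ax bx.
  have [Fac dFa] := hFa a Sa ac; have [Fbc dFb] := hFa b Sb bc.
  have dd y : a < y -> b < y -> has_deriv (fun z => Fa a z - Fa b z) y 0.
    move=> ay by'; have h1 := dFa y ay; have h2 := dFb y by'.
    by solve_deriv; rewrite subrr.
  have e : Fa a c - Fa b c = Fa a x - Fa b x.
    have [cx|/ltW xc] := leP c x.
      apply: (@has_deriv0_cst (fun z => Fa a z - Fa b z)) => // y /andP[cy _].
      by apply: dd; [exact: lt_le_trans ac cy | exact: lt_le_trans bc cy].
    apply/esym; apply: (@has_deriv0_cst (fun z => Fa a z - Fa b z)) => // y /andP[xy _].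
    by apply: dd; [exact: lt_le_trans ax xy | exact: lt_le_trans bx xy].
  by apply/eqP; rewrite -subr_eq0 -e Fac Fbc subrr.
have /choice[F hF] : forall x, exists y, forall a, S a -> a < x -> a < c -> y = Fa a x.
  move=> x; have [[a [Sa ax ac]]|h] := pselect (exists a, [/\ S a, a < x & a < c]).
    by exists (Fa a x) => b Sb bx bc; exact: agree.
  by exists 0 => a Sa ax ac; case: h; exists a.
exists F => x [a [Sa ax ac]]; have [_ dFa] := hFa a Sa ac.
have h := dFa x ax.
apply: (@near_eq_is_derive _ _ _ (Fa a) F x 1 (f x) _ h).
apply/nbhs_ballP; exists (x - a); first by rewrite /= subr_gt0.
move=> y; rewrite /ball/= ltr_distlC => /andP[h1 _].
by apply/esym; apply: hF => //; lra.
Qed.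

Lemma primitive_line f : continuous f -> exists F, forall x, has_deriv F x (f x).
Proof.
move=> fc; have [|F hF] := @primitive_glued f 0 (fun=> True).
  by move=> a _ x _; exact: fc.
exists F => x; apply: hF; exists (Num.min x 0 - 1); split => //.
  by case: (leP x 0) => ?; lra.
by case: (leP x 0) => ?; lra.
Qed.

Lemma primitive_half_line f : (forall x, 0 < x -> {for x, continuous f}) ->
  exists F, forall x, 0 < x -> has_deriv F x (f x).
Proof.
move=> fc; have [|F hF] := @primitive_glued f 1 (fun a => 0 < a).
  by move=> a a0 x ax; apply: fc; exact: lt_le_trans a0 ax.
exists F => x x0; apply: hF; exists (Num.min x 1 / 2).
by case: (leP x 1) => ?; split; lra.
Qed.

Definition unit_step (t : R) : R := (`|t| - `|t - 1| + 1) / 2.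

Lemma unit_step_lo t : t <= 0 -> unit_step t = 0.
Proof. by move=> t0; rewrite /unit_step !ler0_norm; [field|lra|lra]. Qed.

Lemma unit_step_hi t : 1 <= t -> unit_step t = 1.
Proof. by move=> t0; rewrite /unit_step !ger0_norm; [field|lra|lra]. Qed.

Lemma unit_step_itv t : 0 <= unit_step t <= 1.
Proof.
have [t0|t0] := leP t 0; first by rewrite unit_step_lo// lexx ler01.
have [t1|t1] := leP 1 t; first by rewrite unit_step_hi// lexx ler01.
by rewrite /unit_step ger0_norm ?ler0_norm; lra.
Qed.

Lemma unit_step_continuous : continuous unit_step.
Proof.
have nc (f : R -> R) : continuous f -> continuous (fun x => `|f x|).
  by move=> cf x; apply: continuous_comp; [exact: cf | exact: norm_continuous].
have c1 : continuous (fun x : R => `|x|) by apply: nc; solve_cont.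
have c2 : continuous (fun x : R => `|x - 1|) by apply: (@nc (fun x => x - 1)); solve_cont.
by rewrite /unit_step; solve_cont.
Qed.

Definition trapezoid k a b x := unit_step (k * (x - a) + 1) * unit_step (k * (b - x) + 1).

Lemma trapezoid_itv k a b x : 0 <= trapezoid k a b x <= 1.
Proof.
have /andP[p0 p1] := unit_step_itv (k * (x - a) + 1).
have /andP[q0 q1] := unit_step_itv (k * (b - x) + 1).
by rewrite /trapezoid mulr_ge0//= mulr_ile1.
Qed.

Lemma trapezoid_in k a b x : 0 <= k -> a <= x <= b -> trapezoid k a b x = 1.
Proof.
move=> k0 /andP[ax xb]; rewrite /trapezoid !unit_step_hi ?mul1r// lerDr.
  by rewrite mulr_ge0// subr_ge0.
by rewrite mulr_ge0// subr_ge0.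
Qed.

Lemma trapezoid_out k a b x : (k * (a - x) >= 1) \/ (k * (x - b) >= 1) ->
  trapezoid k a b x = 0.
Proof.
move=> [h|h]; rewrite /trapezoid.
  by rewrite unit_step_lo ?mul0r//; lra.
by rewrite (@unit_step_lo (k * (b - x) + 1)) ?mulr0//; lra.
Qed.

Lemma trapezoid_continuous k a b : continuous (trapezoid k a b).
Proof.
have h (f : R -> R) : continuous f -> continuous (fun x => unit_step (f x)).
  by move=> cf x; apply: continuous_comp; [exact: cf | exact: unit_step_continuous].
have c1 : continuous (fun x => unit_step (k * (x - a) + 1)).
  by apply: (@h (fun x => k * (x - a) + 1)); solve_cont.
have c2 : continuous (fun x => unit_step (k * (b - x) + 1)).
  by apply: (@h (fun x => k * (b - x) + 1)); solve_cont.
by rewrite /trapezoid; solve_cont.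
Qed.

End Gluing.

Section DuBoisReymond.
Variable R : realType.
Local Notation mu := (@lebesgue_measure R).
Local Notation hl := (@half_line R).
Implicit Types (f g : R -> R) (a b x : R).

(** Take a primitive of the trapezoid minus its translate: it is constant on either
    side of the trapezoid, so the difference has compact support. *)
Lemma trapezoid_test k a b s : 0 < a -> a <= b -> 0 <= s -> 1 <= k -> 2 / a <= k ->
  exists phi, [/\ test_function phi &
    forall x, derive1 phi x = trapezoid k a b x - trapezoid k a b (x - s)].
Proof.
move=> a0 ab s0 k1 ka; set T := trapezoid k a b.
have Tc : continuous T := @trapezoid_continuous R k a b.
have [P hP] := primitive_line Tc.
have k2 : 2 <= k * a by rewrite -ler_pdivrMr.
have Tlo x : x <= a / 2 -> T x = 0 by move=> xa; apply: trapezoid_out; left; nra.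
have Thi x : b + 1 <= x -> T x = 0 by move=> xb; apply: trapezoid_out; right; nra.
pose phi x := P x - P (x - s).
have shift_deriv x : has_deriv (fun y => P (y - s)) x (T (x - s)).
  have h : has_deriv (fun y : R => y - s) x 1 by solve_deriv; ring.
  by apply: has_deriv_eq; [exact: (@is_derive1_comp _ P _ x _ _ (hP (x - s)) h) | rewrite mulr1].
have hphi x : has_deriv phi x (T x - T (x - s)).
  by have h1 := hP x; have h2 := shift_deriv x; rewrite /phi; exact: has_derivD h1 (has_derivN h2).
have ephi x : derive1 phi x = T x - T (x - s) by exact: has_deriv1E (hphi x).
exists phi; split => //; split.
- by move=> x; have [] := hphi x.
- rewrite (_ : derive1 phi = fun x => T x - T (x - s)); last exact/funext.
  have c2 : continuous (fun x => T (x - s)).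
    move=> x; apply: (@continuous_comp _ _ _ (fun y : R => y - s) T); last exact: Tc.
    by have c1 : continuous (fun y : R => y - s) := ltac:(solve_cont); exact: c1.
  by solve_cont.
exists (a / 2), (b + 1 + s); split; first by rewrite divr_gt0.
move=> x; rewrite in_itv/= negb_and -!ltNge => /orP[xa|xb]; rewrite /phi.
  rewrite (@has_deriv0_cst _ P (x - s) x) ?subrr//; first by rewrite gerBl.
  by move=> y hy; rewrite -(@Tlo y)//; lra.
rewrite (@has_deriv0_cst _ P (x - s) x) ?subrr//; first by rewrite gerBl.
by move=> y hy; rewrite -(@Thi y)//; lra.
Qed.

Lemma locally_integrable_segment f a b : locally_integrable hl f -> 0 < a ->
  mu.-integrable `[a, b] (EFin \o f).
Proof.
move=> [mf _ If] a0.
have sub : `[a, b] `<=` hl.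
  by move=> x; rewrite half_lineE/= in_itv/= => /andP[ax _]; exact: lt_le_trans a0 ax.
apply/integrableP; split.
  apply/measurable_EFinP; apply: measurable_funS mf => //; exact: measurable_half_line.
by apply: If => //; exact: segment_compact.
Qed.

(** Letting the trapezoids tend to indicators, the integral of [f] over a
    segment is invariant under translation. *)
Lemma integral_shift f a b s : locally_integrable hl f ->
  (forall phi, test_function phi ->
     \int[mu]_(r in hl) (f r * derive1 phi r) = 0) ->
  0 < a -> a <= b -> 0 <= s ->
  \int[mu]_(r in `[a, b]) f r = \int[mu]_(r in `[a + s, b + s]) f r.
Proof.
move=> lf hf a0 ab s0.
pose K : set R := `[a / 2, b + s + 1]%classic.
have a20 : 0 < a / 2 by rewrite divr_gt0.
have fK : mu.-integrable K (EFin \o f) by exact: locally_integrable_segment.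
have mK : measurable K by exact: measurable_itv.
have mfK : measurable_fun K f by case/integrableP: fK => /measurable_EFinP.
have Khl : K `<=` hl.
  by move=> x; rewrite half_lineE /K/= in_itv/= => /andP[ax _]; exact: lt_le_trans a20 ax.
pose k (n : nat) : R := 2 / a + 1 + n%:R.
have k1 n : 1 <= k n.
  by rewrite /k -addrA addrCA lerDl addr_ge0// divr_ge0// ltW.
have ka n : 2 / a <= k n by rewrite /k -addrA lerDl addr_ge0.
pose D n x := trapezoid (k n) a b x - trapezoid (k n) a b (x - s).
pose I (c d x : R) : R := if c <= x <= d then 1 else 0.
pose D0 x : R := I a b x - I (a + s) (b + s) x.
have Dc n : continuous (D n).
  have Tc := @trapezoid_continuous R (k n) a b.
  have c2 : continuous (fun x => trapezoid (k n) a b (x - s)).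
    move=> x; apply: (@continuous_comp _ _ _ (fun y : R => y - s)); last exact: Tc.
    by have c1 : continuous (fun y : R => y - s) := ltac:(solve_cont); exact: c1.
  by rewrite /D; solve_cont.
have D1 n x : `|D n x| <= 1.
  have /andP[p0 p1] := trapezoid_itv (k n) a b x.
  have /andP[q0 q1] := trapezoid_itv (k n) a b (x - s).
  by rewrite /D ler_norml; lra.
have trap_lim (c d x : R) : trapezoid (k n) c d x @[n --> \oo] --> I c d x.
  rewrite /I; case: ifPn => [cxd|].
    by apply: cvg_near_cst; apply: nearW => n; apply: trapezoid_in => //; exact: le_trans (k1 n).
  rewrite negb_and -!ltNge => h.
  have [e e0 he] : exists2 e : R, 0 < e & (e <= c - x) \/ (e <= x - d).
    by case/orP: h => h; [exists (c - x) | exists (x - d)]; rewrite ?subr_gt0//; [left|right].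
  apply: cvg_near_cst; exists (Num.bound (e^-1)) => // n /= hn.
  apply: trapezoid_out.
  have kn : 1 <= k n * e.
    rewrite -ler_pdivrMr// div1r; apply: (@le_trans _ _ n%:R).
      apply: ltW; apply: lt_le_trans (archi_boundP _) _; first by rewrite invr_ge0 ltW.
      by rewrite ler_nat.
    by rewrite /k lerDr addr_ge0// divr_ge0// ltW.
  by case: he => he; [left|right]; apply: le_trans kn _; rewrite ler_wpM2l// (le_trans _ (k1 n)).
have D_lim x : D n x @[n --> \oo] --> D0 x.
  rewrite /D /D0; apply: cvgB; first exact: trap_lim.
  have -> : I (a + s) (b + s) x = I a b (x - s) by rewrite /I lerBrDr lerBlDr.
  exact: trap_lim.
have mI c d : measurable_fun K (fun x => f x * I c d x).
  apply: measurable_funM => //.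
  rewrite (_ : I c d = \1_`[c, d]); first exact: measurable_indic.
  apply/funext => x; rewrite indicE /I.
  have [h|h] := boolP (c <= x <= d); first by rewrite mem_set//= in_itv.
  by rewrite memNset//= in_itv/=; exact/negP.
have iI c d : mu.-integrable K (EFin \o (fun x => f x * I c d x)).
  apply: (@le_integrable _ _ _ mu K mK _ (EFin \o f)) => //.
    by apply/measurable_EFinP; exact: mI.
  move=> x _ /=; rewrite lee_fin normrM ler_piMr//.
  by rewrite /I; case: ifP; rewrite ?normr1 ?normr0.
have eI c d : a / 2 <= c -> d <= b + s + 1 ->
    \int[mu]_(r in K) (f r * I c d r) = \int[mu]_(r in `[c, d]) f r.
  move=> hc hd; rewrite (@Rintegral_support _ K `[c, d]).
  - by apply: eq_Rintegral => x; rewrite inE/= in_itv/= /I => ->; rewrite mulr1.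
  - by move=> x; rewrite /K/= !in_itv/= => /andP[? ?]; lra.
  - by move=> x _; rewrite /= in_itv/= /I => /negP/negPf ->; rewrite mulr0.
have iD n : mu.-integrable K (EFin \o (fun x => f x * D n x)).
  apply: (@le_integrable _ _ _ mu K mK _ (EFin \o f)) => //.
    apply/measurable_EFinP; apply: measurable_funM => //.
    by apply: measurable_funTS; exact: continuous_measurable_fun.
  by move=> x _ /=; rewrite lee_fin normrM ler_piMr.
have intD n : (\int[mu]_(x in K) (f x * D n x)%:E = 0)%E.
  have [phi [tphi dphi]] := trapezoid_test a0 ab s0 (k1 n) (ka n).
  have := hf phi tphi; rewrite (@Rintegral_support _ hl K)//; last first.
    move=> x _; rewrite /K/= in_itv/= => /negP; rewrite negb_and -!ltNge dphi => h.
    have k2 : 2 <= k n * a by rewrite -ler_pdivrMr.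
    have k1n := k1 n.
    by rewrite !trapezoid_out ?subrr ?mulr0//; case/orP: h => h; [left|right|left|right]; nra.
  rewrite /Rintegral; under eq_integral do rewrite dphi -/(D n _).
  move=> e; rewrite -[LHS]fineK; last exact: integrable_fin_num (iD n).
  by rewrite e.
have h0 : (\int[mu]_(x in K) (f x * D0 x)%:E = 0)%E.
  have H : (\int[mu]_(x in K) (f x * D n x)%:E)%E @[n --> \oo] -->
      (\int[mu]_(x in K) (f x * D0 x)%:E)%E.
    apply: (@dominated_cvg _ _ _ mu K mK _ _ (fun x => `|f x|%:E)).
    - by move=> n; case/integrableP: (iD n).
    - move=> x _; apply: cvg_EFin; first exact: nearW.
      by apply: cvgMl_tmp; exact: D_lim.
    - by [].
    - exact: integrable_abse fK.
    - by move=> n x _; rewrite /= lee_fin normrM ler_piMr.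
  rewrite (_ : (fun n => _) = fun=> 0%E) in H; last by apply/funext => n; exact: intD.
  by rewrite -(cvg_lim _ H)// lim_cst.
suff : \int[mu]_(x in K) (f x * I a b x - f x * I (a + s) (b + s) x) = 0.
  rewrite RintegralB//.
  by rewrite !eI; [move/eqP; rewrite subr_eq0 => /eqP | lra..].
rewrite /Rintegral (_ : (fun x => _) = (fun x => (f x * D0 x)%:E)) ?h0//.
by apply/funext => x; rewrite /D0 mulrBr.
Qed.

End DuBoisReymond.

Section AEConstant.
Variable R : realType.
Local Notation mu := (@lebesgue_measure R).
Local Notation hl := (@half_line R).
Implicit Types (f g : R -> R) (a b x : R).

Lemma ae_exists (P : R -> Prop) (a b : R) : a < b -> {ae mu, forall x, P x} ->
  exists2 x, a < x < b & P x.
Proof.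
move=> ab [A [mA A0 hA]]; apply: contrapT => h.
have : (mu `]a, b[ <= mu A)%E.
  apply: le_measure; rewrite ?inE//.
  move=> x; rewrite /= in_itv/= => xab; apply: hA => /= Px.
  by apply: h; exists x.
by rewrite A0 lebesgue_measure_itv/= lte_fin ab -EFinD lee_fin; lra.
Qed.

(** Lebesgue points carry the value of [f] as the derivative of its integral,
    and by translation invariance this derivative is the same at all of them. *)
Lemma weak_derivative0_ae_const f : locally_integrable hl f ->
  (forall phi, test_function phi ->
     \int[mu]_(r in hl) (f r * derive1 phi r) = 0) ->
  exists c, ae_half_line (fun r => f r = c).
Proof.
move=> lf hf.
pose K (k : nat) : set R := `[k.+1%:R^-1, k.+1%:R]%classic.
pose g k := f \_ (K k).
pose G k x := \int[mu]_(t in `]-oo, x]) g k t.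
have mK k : measurable (K k) by exact: measurable_itv.
have k0 k : 0 < k.+1%:R^-1 :> R by rewrite invr_gt0.
have ig k : mu.-integrable setT (EFin \o g k).
  have := (@integrable_mkcond _ _ _ mu (K k) (EFin \o f) (mK k)).1.
  by rewrite restrict_EFin; apply; exact: locally_integrable_segment.
have igS k (D : set R) : measurable D -> mu.-integrable D (EFin \o g k).
  by move=> mD; apply: integrableS (ig k).
have good : {ae mu, forall x, forall k, derivable (G k) x 1 /\ derive1 (G k) x = g k x}.
  apply: ae_foralln => k; apply: FTC1Ny; first by move=> y; exact: igS.
  by apply: open_integrable_locally => //; exact: openT.
have key x y : 0 < x -> x <= y ->
    (forall k, derivable (G k) x 1 /\ derive1 (G k) x = g k x) ->
    (forall k, derivable (G k) y 1 /\ derive1 (G k) y = g k y) -> f x = f y.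
  move=> x0 xy gx gy; have y0 : 0 < y by exact: lt_le_trans x0 xy.
  pose k := (Num.bound x^-1 + Num.bound y)%N.
  have xk : k.+1%:R^-1 < x.
    rewrite invf_plt ?posrE//; apply: lt_le_trans (archi_boundP _) _.
      by rewrite invr_ge0 ltW.
    by rewrite ler_nat /k -addnS leq_addr.
  have yk : y < k.+1%:R.
    apply: lt_le_trans (archi_boundP (ltW y0)) _.
    by rewrite ler_nat /k -addSn leq_addl.
  clearbody k.
  have gE z : k.+1%:R^-1 <= z -> z <= k.+1%:R -> g k z = f z.
    by move=> h1 h2; rewrite /g patchE mem_set// /K/= in_itv/= h1.
  have hd z : k.+1%:R^-1 <= z -> z <= k.+1%:R ->
      (forall k, derivable (G k) z 1 /\ derive1 (G k) z = g k z) ->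
      has_deriv (G k) z (f z).
    move=> h1 h2 gz; have [dG eG] := gz k.
    by have := derivableP dG; rewrite -derive1E eG (gE z h1 h2).
  have hx : has_deriv (G k) x (f x) by apply: hd => //; [exact: ltW | exact: le_trans xy (ltW yk)].
  have hy : has_deriv (G k) y (f y) by apply: hd => //; [exact: ltW (lt_le_trans xk xy) | exact: ltW].
  have incr z h : k.+1%:R^-1 <= z -> 0 <= h -> z + h <= k.+1%:R ->
      G k (z + h) - G k z = \int[mu]_(t in `[z, z + h]) f t.
    move=> kz h0 zh; rewrite /G Rintegral_itvB//; last 2 first.
    - exact: igS.
    - by rewrite bnd_simp lerDl.
    rewrite Rintegral_itv_obnd_cbnd; last exact: igS.
    apply: eq_Rintegral => t; rewrite inE/= in_itv/= => /andP[zt tz].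
    by apply: gE; [exact: le_trans kz zt | exact: le_trans tz zh].
  apply/eqP; rewrite -subr_eq0 -normr_le0; apply/ler_addgt0Pl => e e0.
  rewrite addr0.
  have e2 : 0 < e / 2 by rewrite divr_gt0.
  have [d d0 hdx] := first_order_expansion hx e2.
  have [d' d'0 hdy] := first_order_expansion hy e2.
  have yk0 : 0 < k.+1%:R - y by rewrite subr_gt0.
  have [h [h0 hh hh' hk']] := exists_below d0 d'0 yk0.
  have hk : y + h <= k.+1%:R by rewrite addrC -lerBrDr ltW.
  have := hdx h; have := hdy h; rewrite (gtr0_norm h0) => /(_ hh') + /(_ hh).
  have xhk : x + h <= k.+1%:R by apply: le_trans hk; rewrite lerD2r.
  rewrite (incr x h (ltW xk) (ltW h0) xhk).
  rewrite (incr y h (ltW (lt_le_trans xk xy)) (ltW h0) hk).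
  have -> : \int[mu]_(t in `[x, x + h]) f t = \int[mu]_(t in `[y, y + h]) f t.
    have e1 : x + (y - x) = y by ring.
    have e2' : x + h + (y - x) = y + h by ring.
    have := @integral_shift R f x (x + h) (y - x) lf hf x0.
    by rewrite e1 e2'; apply; rewrite ?subr_ge0// lerDl ltW.
  set J := \int[mu]_(t in _) _ => H1 H2.
  rewrite -(ler_pM2r h0) -{1}(gtr0_norm h0) -normrM.
  rewrite (_ : _ * h = (J - f y * h) - (J - f x * h)); last by ring.
  by rewrite (le_trans (ler_normB _ _))//; lra.
have [x0 /andP[x00 _] gx0] := ae_exists (@ltr01 R) good.
exists (f x0); rewrite /ae_half_line.
move: good; apply: filterS; first exact: (ae_filter_ringOfSetsType mu).
move=> x gx; rewrite half_lineE => xp.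
by have [xx|xx] := leP x x0; [apply: key | apply/esym/key => //; exact: ltW].
Qed.

End AEConstant.

(** * Eigenfunctions are decaying solutions *)

Section Regularity.
Variable R : realType.
Local Notation mu := (@lebesgue_measure R).
Local Notation hl := (@half_line R).
Implicit Types (f g u v w U : R -> R).

Lemma integrable_support (A B : set R) f : measurable A -> measurable B -> B `<=` A ->
  (forall x, A x -> ~ B x -> f x = 0) -> mu.-integrable B (EFin \o f) ->
  mu.-integrable A (EFin \o f).
Proof.
move=> mA mB BA f0 fB.
have h := (@integrable_mkcond _ _ _ mu B (EFin \o f) mB).1 fB.
apply: (@integrable_mkcond _ _ _ mu A (EFin \o f) mA).2.
rewrite (_ : _ \_ A = (EFin \o f) \_ B)//; apply/funext => x; rewrite /patch.
have [/set_mem Bx|Bx] := boolP (x \in B); first by rewrite mem_set//; exact: BA.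
case: ifP => // /set_mem Ax /=; rewrite f0// => /mem_set; exact/negP.
Qed.

Lemma test_integrable f phi : locally_integrable hl f -> test_function phi ->
  mu.-integrable hl (EFin \o (fun r => f r * derive1 phi r)).
Proof.
move=> lf tphi; have [dphi cphi _] := tphi.
have [a [b [a0 ab p0 d0 _]]] := test_function_support tphi.
have fK := @locally_integrable_segment R f a b lf a0.
apply: (@integrable_support hl `[a, b]).
- exact: measurable_half_line.
- exact: measurable_itv.
- by move=> x; rewrite half_lineE/= in_itv/= => /andP[ax _]; exact: lt_le_trans a0 ax.
- by move=> x _; rewrite /= in_itv/= => /d0 ->; rewrite mulr0.
have [M M0 hM] := continuous_bounded a b cphi.
apply: (@le_integrable _ _ _ mu _ _ _ (EFin \o (fun x => M * f x))) => //.
- apply/measurable_EFinP; apply: measurable_funM.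
    by case/integrableP: fK => /measurable_EFinP.
  by apply: measurable_funTS; exact: continuous_measurable_fun.
- move=> x; rewrite /= in_itv/= => xab; rewrite lee_fin !normrM mulrC.
  by apply: ler_wpM2r => //; rewrite (ger0_norm M0); exact: hM.
- rewrite (_ : EFin \o _ = fun x => (M%:E * (EFin \o f) x)%E)//.
  exact: integrableZl.
Qed.

(** The difference of [u] and a primitive of [v] has zero weak derivative. *)
Lemma weak_derivative_primitive u v : weak_derivative u v ->
  (forall x, 0 < x -> {for x, continuous v}) ->
  exists U, (forall x, 0 < x -> has_deriv U x (v x)) /\ ae_half_line (fun r => u r = U r).
Proof.
move=> [lu lv hu] vc; have [U hU] := primitive_half_line vc.
have [lU _ hwU] := weak_derivative_classical hU vc.
have [|phi tphi|c hc] := @weak_derivative0_ae_const R (u \- U).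
- exact: locally_integrableB.
- have -> : (fun r => (u \- U) r * derive1 phi r) =
     (fun r => u r * derive1 phi r - U r * derive1 phi r).
    by apply/funext => r; rewrite /= mulrBl.
  rewrite RintegralB; [|exact: measurable_half_line|exact: test_integrable..].
  by rewrite hu// hwU// subrr.
exists (fun x => U x + c); split.
  by move=> x x0; have h := hU x x0; solve_deriv; rewrite addr0.
rewrite /ae_half_line in hc *; move: hc; apply: filterS; first exact: (ae_filter_ringOfSetsType mu).
by move=> x hx xh; rewrite -(hx xh)/= addrC subrK.
Qed.

Lemma ae_continuous_eq f g : (forall x, 0 < x -> {for x, continuous f}) ->
  (forall x, 0 < x -> {for x, continuous g}) ->
  ae_half_line (fun r => f r = g r) -> forall x, 0 < x -> f x = g x.
Proof.
move=> fc gc fg x x0; apply/eqP; rewrite -subr_eq0 -sqrf_eq0.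
apply: contraT => h.
have h0 : 0 < (f x - g x) * (f x - g x) by rewrite -expr2 lt_neqAle eq_sym h sqr_ge0.
have c : {for x, continuous (fun y => (f y - g y) * (f y - g y))}.
  by apply: continuousM; apply: continuousB; [exact: fc|exact: gc|exact: fc|exact: gc].
have [e e0 he] := continuous_pos_near c h0.
have xe : x < x + e by rewrite ltrDl.
have [y /andP[y1 y2] hy] := ae_exists xe fg.
have := he y; rewrite hy; last by rewrite half_lineE; exact: lt_trans x0 y1.
rewrite subrr mulr0 ltxx; apply.
by rewrite gtr0_norm; lra.
Qed.

End Regularity.

Section ClassicalSolution.
Variable R : realType.
Variables (tau lam : R).
Implicit Types (U v : R -> R).
Local Notation phi := (phi tau lam).
Local Notation dphi := (phi_prime tau lam).
Local Notation sig := (sig tau lam).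

(** The trace condition at the origin excludes the logarithmic solution: it makes
    the Wronskian with the regular solution vanish. *)
Lemma wronskian_zero U v : (forall x, 0 < x -> has_deriv U x (v x)) ->
  (forall x, 0 < x -> has_deriv v x (potential tau lam x * U x - x^-1 * v x)) ->
  (forall e, 0 < e -> exists2 d, 0 < d & forall x, 0 < x < d -> `|x * v x| < e) ->
  forall x, 0 < x -> v x * phi x = U x * dphi x.
Proof.
move=> hU hv h0 x x0.
pose W y := y * (v y * phi y - U y * dphi y).
have hW y : 0 < y -> has_deriv W y 0.
  move=> y0; have h1 := hU y y0; have h2 := hv y y0.
  by rewrite /W; solve_deriv; rewrite /phi_prime; field; rewrite gt_eqF.
have Wcst y : 0 < y -> W y = W x.
  move=> y0; have [yx|/ltW xy] := leP y x.
    by apply: has_deriv0_cst => // z /andP[yz _]; apply: hW; exact: lt_le_trans y0 yz.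
  by apply/esym; apply: has_deriv0_cst => // z /andP[xz _]; apply: hW; exact: lt_le_trans x0 xz.
suff : W x = 0.
  by move/eqP; rewrite mulf_eq0 gt_eqF//= subr_eq0 => /eqP.
apply/eqP; apply: contraT => k0.
have kp : 0 < `|W x| by rewrite normr_gt0.
have [Mp Mp0 hMp] := continuous_bounded 0 1 (@phi_continuous R tau lam).
have [Ms Ms0 hMs] := continuous_bounded 0 1 (@sig_continuous R tau lam).
pose e := Num.min 1 (`|W x| / (3 * (Mp + 1))).
have Mp1 : 0 < 3 * (Mp + 1) by lra.
have [e0 [e1 eW]] : 0 < e /\ e <= 1 /\ e * (3 * (Mp + 1)) <= `|W x|.
  split; first by rewrite /e lt_min ltr01 divr_gt0.
  by rewrite -ler_pdivlMr// /e !ge_min !lexx orbT.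
have [d d0 hd] := h0 e e0.
have [d' [d'0 d'd d'1 _]] := exists_below d0 (@ltr01 R) (@ltr01 R).
(* The trace condition only gives [|v| <= z^-2], hence [U = O(1 / y)]; this is enough
   as [y U phi' = y^2 U sig] in the Wronskian. *)
have U_le y : 0 < y -> y <= d' -> `|U y| <= `|U d'| + y^-1.
  move=> y0 yd.
  have vb z : y < z < d' -> `|v z| <= z ^- 2.
    move=> hz; have z0 : 0 < z by lra.
    have zz : 0 < z < d by lra.
    have := hd z zz; rewrite normrM (gtr0_norm z0) => h.
    have z2 : 0 < z ^+ 2 by rewrite exprn_gt0.
    rewrite -(ler_pM2l z2) divff ?gt_eqF// expr2 -mulrA.
    have : z * (z * `|v z|) <= z * e by rewrite ler_pM2l// ltW.
    nra.
  have hinv z : 0 < z -> has_deriv (fun t : R => t^-1) z (- z ^- 2).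
    move=> z0; eapply has_deriv_eq.
      by apply: (@has_derivV R (fun t : R => t) z 1); [rewrite gt_eqF | exact: has_deriv_id].
    by rewrite mulr1.
  have up : U y - y^-1 <= U d' - d'^-1.
    apply: (@has_deriv_ge0_le _ (fun z => U z - z^-1) (fun z => v z + z ^- 2)) => // z hz.
    - have z0 : 0 < z by lra.
      apply: (@has_deriv_continuous _ _ _ (v z + z ^- 2)).
      by have h1 := hU z z0; have h2 := hinv z z0; solve_deriv; rewrite opprK.
    - have z0 : 0 < z by lra.
      by have h1 := hU z z0; have h2 := hinv z z0; solve_deriv; rewrite opprK.
    - by have := vb z hz; rewrite ler_norml; lra.
  have lo : U d' + d'^-1 <= U y + y^-1.
    apply: (@has_deriv_le0_ge _ (fun z => U z + z^-1) (fun z => v z - z ^- 2)) => // z hz.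
    - have z0 : 0 < z by lra.
      apply: (@has_deriv_continuous _ _ _ (v z - z ^- 2)).
      by have h1 := hU z z0; have h2 := hinv z z0; solve_deriv.
    - have z0 : 0 < z by lra.
      by have h1 := hU z z0; have h2 := hinv z z0; solve_deriv.
    - by have := vb z hz; rewrite ler_norml; lra.
  have di : 0 < d'^-1 by rewrite invr_gt0.
  have := ler_norm (U d'); have := ler_norm (- U d'); rewrite normrN => ? ?.
  by rewrite ler_norml; lra.
pose Q := 3 * (`|U d'| + 1) * (Ms + 1).
have Q0 : 0 < Q by rewrite !mulr_gt0//; have := normr_ge0 (U d'); lra.
pose y := Num.min d' (`|W x| / Q).
have [y0 [yd yQ]] : 0 < y /\ y <= d' /\ y * Q <= `|W x|.
  split; first by rewrite /y lt_min d'0 divr_gt0.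
  by rewrite -ler_pdivlMr// /y !ge_min !lexx orbT.
have WE : `|W x| <= `|y * v y| * `|phi y| + y * (y * `|U y|) * `|sig y|.
  rewrite -(Wcst y y0) /W.
  rewrite (_ : y * (v y * phi y - U y * dphi y) = (y * v y) * phi y - y * (y * U y) * sig y);
    last first.
    by rewrite /phi_prime; ring.
  apply: le_trans (ler_normB _ _) _; rewrite !normrM !(gtr0_norm y0)//.
have y1 : 0 <= y <= 1 by lra.
have b1 : `|y * v y| * `|phi y| <= e * Mp.
  apply: ler_pM => //; last exact: hMp.
  by apply/ltW/hd; lra.
have b2 : y * `|U y| <= `|U d'| + 1.
  have : y * `|U y| <= y * (`|U d'| + y^-1) by rewrite ler_pM2l// U_le.
  rewrite mulrDr divff ?gt_eqF// => h; apply: (le_trans h).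
  by rewrite lerD2r ler_piMl//; lra.
have b3 : y * (y * `|U y|) * `|sig y| <= y * (`|U d'| + 1) * Ms.
  apply: ler_pM => //; last exact: hMs.
    by rewrite !mulr_ge0// ltW.
  by rewrite ler_pM2l.
have b4 : y * (`|U d'| + 1) * Ms <= y * (`|U d'| + 1) * (Ms + 1).
  by apply: ler_wpM2l; [rewrite mulr_ge0 ?addr_ge0// ltW | lra].
move: yQ; rewrite /Q => yQ.
have : y * (3 * (`|U d'| + 1) * (Ms + 1)) = 3 * (y * (`|U d'| + 1) * (Ms + 1)) by ring.
have : e * (3 * (Mp + 1)) = 3 * (e * Mp) + 3 * e by ring.
lra.
Qed.

(** [(U, v)] is parallel to [(phi, phi')], which never vanishes, and the factor of
    proportionality [(U phi + v phi') / (phi^2 + phi'^2)] has zero derivative. *)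
Lemma classical_multiple U v : (forall x, 0 < x -> has_deriv U x (v x)) ->
  (forall x, 0 < x -> has_deriv v x (potential tau lam x * U x - x^-1 * v x)) ->
  (forall e, 0 < e -> exists2 d, 0 < d & forall x, 0 < x < d -> `|x * v x| < e) ->
  exists c, forall x, 0 < x -> U x = c * phi x.
Proof.
move=> hU hv h0; have W0 := wronskian_zero hU hv h0.
pose N x := U x * phi x + v x * dphi x.
pose D x := phi x ^+ 2 + dphi x ^+ 2.
have D0 x : 0 < x -> D x != 0.
  move=> x0; apply/eqP => /eqP; rewrite /D paddr_eq0 ?sqr_ge0// !sqrf_eq0.
  by move=> /andP[/eqP p0 /eqP d0]; exact: (no_double_zero x0 p0 d0).
have UE x : 0 < x -> U x = N x / D x * phi x.
  move=> x0; have Dx := D0 x x0; apply: (mulIf Dx).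
  rewrite mulrAC divfK// /N /D mulrDl mulrDr -[v x * _ * _]mulrAC W0//; ring.
have vE x : 0 < x -> v x = N x / D x * dphi x.
  move=> x0; have Dx := D0 x x0; apply: (mulIf Dx).
  rewrite mulrAC divfK// /N /D mulrDr expr2 mulrA W0//; ring.
have hq x : 0 < x -> has_deriv (fun y => N y / D y) x 0.
  move=> x0; have h1 := hU x x0; have h2 := hv x x0.
  have Dx := D0 x x0.
  have h3 : has_deriv N x (U x * dphi x + phi x * v x +
      (v x * (potential tau lam x * phi x - sig x) + dphi x * (potential tau lam x * U x - x^-1 * v x))).
    by rewrite /N; solve_deriv.
  have h4 : has_deriv D x (2 * phi x * dphi x + 2 * dphi x * (potential tau lam x * phi x - sig x)).
    by rewrite /D; solve_deriv; rewrite /=; ring.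
  eapply has_deriv_eq; first exact: (has_derivM h3 (has_derivV Dx h4)).
  have sE : sig x = dphi x / x by rewrite /phi_prime mulrC mulKf// gt_eqF.
  have eN : N x = N x / D x * D x by rewrite divfK.
  rewrite sE; rewrite {1}eN; rewrite (UE x x0) (vE x x0).
  set c := N x / D x.
  have xn : x != 0 by rewrite gt_eqF.
  by rewrite /D in Dx *; field; rewrite Dx xn.
exists (N 1 / D 1) => x x0; rewrite UE//; congr (_ * _).
have [x1|/ltW x1] := leP x 1.
  by apply: (@has_deriv0_cst _ (fun y => N y / D y)) => // z /andP[xz _]; apply: hq; exact: lt_le_trans x0 xz.
apply/esym; apply: (@has_deriv0_cst _ (fun y => N y / D y)) => // z /andP[xz _]; apply: hq.
exact: lt_le_trans ltr01 xz.
Qed.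

End ClassicalSolution.

Section EigenvalueDecaying.
Variable R : realType.
Local Notation mu := (@lebesgue_measure R).
Local Notation hl := (@half_line R).
Implicit Types (tau lam : R) (u v w : R -> R).

(** A growing solution satisfies [r phi^2 >= const > 0] far out. *)
Lemma square_integrable_decaying tau lam :
  (\int[mu]_(r in hl) (phi tau lam r ^+ 2 * r)%:E < +oo)%E -> decaying tau lam.
Proof.
move=> fin; apply: contrapT => nd.
have [r0 fr0 gr0] := not_decaying_grows (far tau lam) nd.
have r00 : 0 < r0 := lt_le_trans (far_gt0 tau lam) fr0.
pose m := phi tau lam r0 ^+ 2 * r0.
have m0 : 0 < m.
  rewrite mulr_gt0// exprn_even_gt0//=; apply/eqP => e.
  by move: gr0; rewrite e mul0r ltxx.
have lb r : r0 <= r -> m <= phi tau lam r ^+ 2 * r.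
  move=> rr; apply: ler_pM => //; [exact: sqr_ge0|exact: ltW|].
  apply: phi_sqr_le => //; first by rewrite /flux ltW// mulr_gt0.
  by move=> x /andP[rx _]; apply: (@V_far _ tau lam); [rewrite subrr normr0|lra].
have mphi : measurable_fun hl (fun r => (phi tau lam r ^+ 2 * r)%:E).
  apply/measurable_EFinP; apply: half_line_measurable_fun => x _.
  have c : continuous (fun r => phi tau lam r ^+ 2 * r) by solve_cont.
  exact: c.
have mI : measurable (`[r0, +oo[ : set R) by exact: measurable_itv.
have sub : `[r0, +oo[ `<=` hl.
  by move=> x; rewrite half_lineE/= in_itv/= andbT; exact: lt_le_trans.
suff : (+oo <= \int[mu]_(r in hl) (phi tau lam r ^+ 2 * r)%:E)%E.
  by move=> h; have := le_lt_trans h fin; rewrite ltxx.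
apply: (@le_trans _ _ (\int[mu]_(r in `[r0, +oo[) (phi tau lam r ^+ 2 * r)%:E)%E); last first.
  apply: ge0_subset_integral => //; first exact: measurable_half_line.
  move=> x; rewrite half_lineE => x0; rewrite lee_fin; apply: mulr_ge0; first exact: sqr_ge0.
  exact: ltW.
apply: (@le_trans _ _ (\int[mu]_(r in `[r0, +oo[) (cst m%:E r))%E).
  have muI : (mu (`[r0, +oo[ : set R) = +oo)%E.
    by rewrite lebesgue_measure_itv/= ltry.
  have e := @integral_cst _ _ _ mu _ mI m%:E.
  by rewrite e; rewrite [X in (_ * X)%E]muI gt0_muley ?lte_fin.
apply: (@ge0_le_integral _ _ _ mu _ mI).
- by move=> x _; rewrite lee_fin ltW.
- exact: measurable_cst.
- by apply: measurable_funS mphi => //; exact: measurable_half_line.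
- by move=> x; rewrite /= in_itv/= andbT => rx; rewrite lee_fin lb.
Qed.

Lemma L2r_multiple u c tau lam : c != 0 -> L2r u ->
  ae_half_line (fun r => u r = c * phi tau lam r) ->
  (\int[mu]_(r in hl) (phi tau lam r ^+ 2 * r)%:E < +oo)%E.
Proof.
move=> c0 [mu_ fin] ue.
have c2 : 0 < c ^+ 2 by rewrite exprn_even_gt0.
have mphi : measurable_fun hl (fun r => phi tau lam r ^+ 2 * r).
  apply: half_line_measurable_fun => x _.
  have cc : continuous (fun r => phi tau lam r ^+ 2 * r) by solve_cont.
  exact: cc.
have e : (\int[mu]_(r in hl) (u r ^+ 2 * r)%:E =
    \int[mu]_(r in hl) ((c ^+ 2)%:E * (phi tau lam r ^+ 2 * r)%:E))%E.
  apply: ae_eq_integral => //.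
  - exact: measurable_half_line.
  - apply/measurable_EFinP; apply: measurable_funM => //.
    exact: measurable_funX.
  - apply/measurable_EFinP; apply: measurable_funM => //; exact: measurable_cst.
  - rewrite /ae_half_line in ue; move: ue; apply: filterS; first exact: (ae_filter_ringOfSetsType mu).
    by move=> x ux xh; rewrite -EFinM ux//; congr EFin; ring.
move: fin; rewrite e ge0_integralZl//; last 4 first.
- exact: measurable_half_line.
- exact/measurable_EFinP.
- by move=> x; rewrite half_lineE => x0; rewrite lee_fin mulr_ge0 ?sqr_ge0// ltW.
- by rewrite lee_fin ltW.
move=> h; rewrite ltey; apply/eqP => einf; move: h; rewrite einf.
by rewrite gt0_muley// ?lte_fin// ltxx.
Qed.

(** The equation makes [u''] continuous up to a null set, so [u] is a classical
    solution; the trace condition makes it a multiple of [phi], and integrability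
    excludes growth. *)
Lemma eigenvalue_decaying tau lam : eigenvalue_g tau lam -> decaying tau lam.
Proof.
move=> [u unz [v [w [[[Lu _ _] [[wuv vc wvw] [_ _ _ tr]]] eqn]]]].
have vc' x : 0 < x -> {for x, continuous v}.
  by move=> x0; apply: vc; rewrite inE half_lineE.
have [U [hU uU]] := weak_derivative_primitive wuv vc'.
have Uc x : 0 < x -> {for x, continuous U} by move=> x0; exact: has_deriv_continuous (hU x x0).
pose om x := potential tau lam x * U x - x^-1 * v x.
have omc x : 0 < x -> {for x, continuous om}.
  move=> x0; have Vc : {for x, continuous (potential tau lam)}.
    by apply: (@has_deriv_continuous _ _ _ (2 * (x - tau))); rewrite /potential; solve_deriv; ring.
  have ic : {for x, continuous (fun y : R => y^-1)} by apply: inv_continuous; rewrite gt_eqF.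
  rewrite /om; apply: (@continuousB _ _ _ (fun x => potential tau lam x * U x) (fun x => x^-1 * v x)).
    by apply: (@continuousM _ _ (potential tau lam) U) => //; exact: Uc.
  by apply: (@continuousM _ _ (fun y : R => y^-1) v) => //; exact: vc'.
have wom : ae_half_line (fun r => w r = om r).
  rewrite /ae_half_line in eqn uU *.
  move: eqn uU; apply: filterS2; first exact: (ae_filter_ringOfSetsType mu).
  move=> x h1 h2 xh; have := h1 xh; rewrite /om /potential -(h2 xh) => h3.
  lra.
have wvom : weak_derivative v om.
  have [lv lw hw] := wvw; split => //; first exact: locally_integrable_continuous.
  move=> phi tphi; rewrite hw//; congr (- _).
  have [dphi _ _] := tphi.
  have mphi : measurable_fun hl phi.
    apply: half_line_measurable_fun => x _; apply: differentiable_continuous.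
    exact/derivable1_diffP.
  congr fine; apply: ae_eq_integral => //.
  - exact: measurable_half_line.
  - by apply/measurable_EFinP; apply: measurable_funM => //; case: lw.
  - by apply/measurable_EFinP; apply: measurable_funM => //; exact: half_line_measurable_fun.
  - rewrite /ae_half_line in wom; move: wom; apply: filterS; first exact: (ae_filter_ringOfSetsType mu).
    by move=> x hx xh; rewrite hx.
have [v' [hv' vv']] := weak_derivative_primitive wvom omc.
have v'c x : 0 < x -> {for x, continuous v'} by move=> x0; exact: has_deriv_continuous (hv' x x0).
have evv' := ae_continuous_eq vc' v'c vv'.
have hv x : 0 < x -> has_deriv v x (om x).
  move=> x0; apply: (@near_eq_is_derive _ _ _ v' v x 1 (om x) _ (hv' x x0)).
  by apply/nbhs_ballP; exists x => // y; rewrite /ball/= ltr_distlC => /andP[h _];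
    apply/esym/evv'; lra.
have tr0 e : 0 < e -> exists2 d, 0 < d & forall x, 0 < x < d -> `|x * v x| < e.
  move=> e0; move/cvgrPdist_lt: tr => /(_ e e0).
  move=> /nbhs_ballP[d /= d0 hd]; exists d => // x /andP[x0 xd].
  have := hd x; rewrite /ball/= sub0r normrN (gtr0_norm x0) => /(_ xd x0).
  by rewrite sub0r normrN.
have [c hc] := classical_multiple hU hv tr0.
have ue : ae_half_line (fun r => u r = c * phi tau lam r).
  rewrite /ae_half_line in uU *; move: uU; apply: filterS; first exact: (ae_filter_ringOfSetsType mu).
  by move=> x hx xh; rewrite hx// hc// -half_lineE.
apply: square_integrable_decaying; apply: (L2r_multiple _ Lu ue).
apply/eqP => c0; apply: unz; move: ue; rewrite /ae_half_line c0.
apply: filterS; first exact: (ae_filter_ringOfSetsType mu).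
by move=> x hx xh; rewrite hx// mul0r.
Qed.

End EigenvalueDecaying.

(** * Counting the eigenvalues *)

(** With a single eigenvalue up to [z1], [z2 <= z1] would leave one instead of two
    up to [z2]; and a third one up to [z2] contradicts the pigeonhole principle. *)
Lemma first_two_eigenvalues (R : realType) (E : R -> Prop) (z1 z2 : R) :
  E z1 -> ([set l : R | E l /\ l <= z1] #= `I_1)%card ->
  E z2 -> ([set l : R | E l /\ l <= z2] #= `I_2)%card ->
  z1 < z2 /\ forall l, E l -> l <= z2 -> l = z1 \/ l = z2.
Proof.
move=> e1 /card_set_bijP[f [ff fi _]] e2 /card_set_bijP[g [gf gi gs]].
have only1 l : E l -> l <= z1 -> l = z1.
  move=> el lz; apply: fi; rewrite ?inE//=.
  have := ff l (conj el lz); have := ff z1 (conj e1 (lexx _)).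
  by rewrite /= !ltnS !leqn0 => /eqP -> /eqP ->.
have z12 : z1 < z2.
  rewrite ltNge; apply/negP => z21.
  have only2 l : E l -> l <= z2 -> l = z1.
    by move=> el lz; apply: only1 => //; exact: le_trans z21.
  have [x [ex xz] gx] := gs 0%N isT; have [y [ey yz] gy] := gs 1%N isT.
  by move: gx gy; rewrite (only2 x)// (only2 y)// => ->.
split => // l el lz.
have [->|lz1] := eqVneq l z1; first by left.
have [->|lz2] := eqVneq l z2; first by right.
have A1 : [set l : R | E l /\ l <= z2] z1 by split => //; exact: ltW.
have A2 : [set l : R | E l /\ l <= z2] z2 by [].
have A3 : [set l : R | E l /\ l <= z2] l by [].
have ne x y : [set l : R | E l /\ l <= z2] x -> [set l : R | E l /\ l <= z2] y ->
    x != y -> g x != g y.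
  by move=> Ax Ay; apply: contra_neq => gxy; apply: gi; rewrite ?inE.
have := ne _ _ A3 A1 lz1; have := ne _ _ A3 A2 lz2.
have := ne _ _ A1 A2; rewrite lt_eqF// => /(_ isT).
have := gf _ A1; have := gf _ A2; have := gf _ A3; rewrite /=.
by move: (g z1) (g z2) (g l) => [|[|?]] [|[|?]] [|[|?]].
Qed.

Theorem proposition3p5 (R : realType) (zeta1 zeta2 : R -> R) (tauC : R)
    (hzeta1 : forall tau : R, nth_eigenvalue_g tau 1 (zeta1 tau))
    (hzeta2 : forall tau : R, nth_eigenvalue_g tau 2 (zeta2 tau))
    (zeta1_derivable : \forall tau \near tauC, derivable zeta1 tau 1)
    (zeta1_derivable2 : derivable (derive1 zeta1) tauC 1)
    (tauC_critical : derive1 zeta1 tauC = 0) :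
  derive1n 2 zeta1 tauC >=
    2 * ((zeta2 tauC - 3 * zeta1 tauC) / (zeta2 tauC - zeta1 tauC)).
Proof.
have [e1 c1] := hzeta1 tauC; have [e2 c2] := hzeta2 tauC.
have [z12 only] := first_two_eigenvalues e1 c1 e2 c2.
have d1 := eigenvalue_decaying e1; have d2 := eigenvalue_decaying e2.
have [|n1 [z hz]] := first_two_shapes z12 d1 d2.
  by move=> l /decaying_eigenvalue; exact: only.
have decs t : decaying t (zeta1 t).
  by have [e _] := hzeta1 t; exact: eigenvalue_decaying e.
have hD : has_deriv (derive1 zeta1) tauC (derive1n 2 zeta1 tauC).
  by rewrite derive1nS derive1n1 derive1E; exact/derivableP.
exact: critical_second_derivative decs z12 d2 n1 hz zeta1_derivable tauC_critical hD.
Qed.
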